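(* Fix a finite relational signature $\tau$ and $k,k'\in\mathbb{N}$. The separator synthesis problem for $\mathrm{SO}(k,k')$ is decidable in $2\mathsf{EXPTIME}$: there is an algorithm that, given finite sets $\mathit{Pos},\mathit{Neg}$ of finite $\tau$-structures and a regular tree grammar $G$ over the ranked alphabet of $\mathrm{SO}(k,k')$, runs in doubly exponential time and either outputs a sentence $\varphi\in L(G)$ true in every structure of $\mathit{Pos}$ and false in every structure of $\mathit{Neg}$, or correctly answers ''No'' if none exists.
   Context: $\mathrm{SO}(k,k')$ is relational second-order logic restricted to $k$ first-order variables $x_1,\dots,x_k$ and $k'$ second-order relation variables $X_1,\dots,X_{k'}$ (each of a fixed arity; variables may be requantified/reused): atomic formulas $R(\bar x)$ for $R\in\tau$ and $X_i(\bar x)$, closed under $\wedge,\vee,\neg$, first-order quantifiers $\exists x,\forall x$ and second-order quantifiers $\exists X_i,\forall X_i$ ranging over relations of the appropriate arity on the domain; standard semantics. Formulas are represented as trees over the corresponding finite ranked alphabet (nullary atom symbols, binary $\wedge,\vee$, unary $\neg$ and quantifier symbols). A regular tree grammar $G=\langle N,\Sigma,S,P\rangle$ has nonterminals, axiom $S$ and rules $B\to t$ ($t$ a tree over $\Sigma\cup N$); $L(G)$ is the set of trees over $\Sigma$ derivable from $S$.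
   Formalization: The sentence φ is output with shared subformulas (as a DAG) rather than as a tree, since smallest separators written as trees can have triply exponential size, so that doubly exponential time could not suffice; domains are nonempty. *)

(* Defs.v *)
From HB Require Import structures.
From Stdlib Require Import Relation_Operators.
From Stdlib Require List.
From mathcomp Require Import all_boot.

Set Implicit Arguments.
Unset Strict Implicit.
Unset Printing Implicit Defensive.

(* Finite relational signatures and finite structures.  The domain is         *)
(* {0, ..., dom}, hence nonempty.                                             *)

Record signature := Signature { nrel : nat; arity : 'I_nrel -> nat }.

Record structure (tau : signature) := Structure {
  dom : nat;
  interp : forall R : 'I_(nrel tau), {set (arity R).-tuple 'I_dom.+1}
}.

Section Logic.

(* arX X is the arity of the second-order variable X; there is no equality.   *)
Variables (tau : signature) (k k' : nat) (arX : 'I_k' -> nat).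

Inductive sym0 :=
| AtomRel (R : 'I_(nrel tau)) of (arity R).-tuple 'I_k
| AtomVar (X : 'I_k') of (arX X).-tuple 'I_k.

Inductive sym1 :=
| Not
| Ex1 of 'I_k
| All1 of 'I_k
| Ex2 of 'I_k'
| All2 of 'I_k'.

Inductive sym2 := And | Or.

(* Trees over the ranked alphabet extended with nullary symbols from N.       *)
Inductive tree (N : Type) :=
| Leaf of N
| Node0 of sym0
| Node1 of sym1 & tree N
| Node2 of sym2 & tree N & tree N.

Arguments Node0 {N}.

Definition formula := tree void.

Fixpoint tree_of_formula (N : Type) (phi : formula) : tree N :=
  match phi with
  | Leaf v => of_void (tree N) v
  | Node0 a => Node0 a
  | Node1 f p => Node1 f (tree_of_formula N p)
  | Node2 f p q => Node2 f (tree_of_formula N p) (tree_of_formula N q)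
  end.

Fixpoint free1 (x : 'I_k) (phi : formula) : bool :=
  match phi with
  | Leaf _ => false
  | Node0 (AtomRel _ xs) => x \in xs
  | Node0 (AtomVar _ xs) => x \in xs
  | Node1 (Ex1 y) p | Node1 (All1 y) p => (x != y) && free1 x p
  | Node1 _ p => free1 x p
  | Node2 _ p q => free1 x p || free1 x q
  end.

Fixpoint free2 (X : 'I_k') (phi : formula) : bool :=
  match phi with
  | Leaf _ => false
  | Node0 (AtomRel _ _) => false
  | Node0 (AtomVar Y _) => X == Y
  | Node1 (Ex2 Y) p | Node1 (All2 Y) p => (X != Y) && free2 X p
  | Node1 _ p => free2 X p
  | Node2 _ p q => free2 X p || free2 X q
  end.

Definition sentence (phi : formula) : Prop :=
  (forall x, ~~ free1 x phi) /\ (forall X, ~~ free2 X phi).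

Section Semantics.

Variable A : structure tau.

Definition env1 := 'I_k -> 'I_(dom A).+1.
Definition env2 := forall X : 'I_k', {set (arX X).-tuple 'I_(dom A).+1}.

Fixpoint eval (s : env1) (S : env2) (phi : formula) : bool :=
  match phi with
  | Leaf _ => false
  | Node0 (AtomRel R xs) => map_tuple s xs \in interp A R
  | Node0 (AtomVar X xs) => map_tuple s xs \in S X
  | Node1 Not p => ~~ eval s S p
  | Node1 (Ex1 x) p => [exists a, eval [eta s with x |-> a] S p]
  | Node1 (All1 x) p => [forall a, eval [eta s with x |-> a] S p]
  | Node1 (Ex2 X) p =>
      [exists P : {set (arX X).-tuple 'I_(dom A).+1}, eval s (dfwith S P) p]
  | Node1 (All2 X) p =>
      [forall P : {set (arX X).-tuple 'I_(dom A).+1}, eval s (dfwith S P) p]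
  | Node2 And p q => eval s S p && eval s S q
  | Node2 Or p q => eval s S p || eval s S q
  end.

(* For a sentence the environments are irrelevant.                            *)
Definition models (phi : formula) : Prop := forall s S, eval s S phi.

End Semantics.

Record grammar := Grammar {
  nonterm : nat;
  axiom : 'I_nonterm;
  rules : seq ('I_nonterm * tree 'I_nonterm)
}.

Inductive derives1 (G : grammar) :
    tree 'I_(nonterm G) -> tree 'I_(nonterm G) -> Prop :=
| Derive_rule B t :
    List.In (B, t) (rules G) -> derives1 (Leaf B) t
| Derive_1 f t t' :
    derives1 t t' -> derives1 (Node1 f t) (Node1 f t')
| Derive_2l f t t' u :
    derives1 t t' -> derives1 (Node2 f t u) (Node2 f t' u)
| Derive_2r f t u u' :
    derives1 u u' -> derives1 (Node2 f t u) (Node2 f t u').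

Definition language (G : grammar) (phi : formula) : Prop :=
  clos_refl_trans _ (@derives1 G) (Leaf (axiom G))
    (tree_of_formula 'I_(nonterm G) phi).

Definition separator (Pos Neg : seq (structure tau)) (G : grammar)
    (phi : formula) : Prop :=
  [/\ sentence phi, language G phi,
      forall A, List.In A Pos -> models A phi &
      forall A, List.In A Neg -> ~ models A phi].

(* Formulas as DAGs.  Written out as a tree, a smallest separator can have    *)
(* triply exponential size (the grammar can force both arguments of a binary  *)
(* symbol to agree along a derivation of doubly exponential height), so no    *)
(* algorithm can print it within doubly exponential time; with shared         *)
(* subformulas it can.  The natural numbers in a node are positions of        *)
(* earlier nodes, and the last node is the root.                              *)

Inductive node :=
| Dag0 of sym0
| Dag1 of sym1 & nat
| Dag2 of sym2 & nat & nat.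

Definition dag := seq node.

Definition node_formula (ts : seq formula) (n : node) : option formula :=
  match n with
  | Dag0 a => Some (Node0 a)
  | Dag1 f i => if onth ts i is Some p then Some (Node1 f p) else None
  | Dag2 f i j =>
      if (onth ts i, onth ts j) is (Some p, Some q)
      then Some (Node2 f p q) else None
  end.

Definition dag_formulas (d : dag) : option (seq formula) :=
  foldl (fun acc n =>
           if acc is Some ts then omap (rcons ts) (node_formula ts n) else None)
        (Some [::]) d.

Definition dag_denotes (d : dag) (phi : formula) : Prop :=
  exists ts, dag_formulas d = Some (rcons ts phi).

(* Encodings as sequences of natural numbers.  Trees are in prefix notation,  *)
(* every symbol being a tag followed by its indices, and a sequence is        *)
(* preceded by its length; a relation is the list of its tuples.              *)

Definition code_seq (T : Type) (f : T -> seq nat) (s : seq T) : seq nat :=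
  size s :: flatten (map f s).

Definition code_tuple (m n : nat) (t : m.-tuple 'I_n) : seq nat :=
  map (@nat_of_ord n) t.

Definition code_structure (A : structure tau) : seq nat :=
  (dom A).+1 ::
  flatten [seq code_seq (@code_tuple _ _) (enum (interp A R))
             | R <- enum 'I_(nrel tau)].

Definition code_sym0 (a : sym0) : seq nat :=
  match a with
  | AtomRel R xs => 1 :: nat_of_ord R :: code_tuple xs
  | AtomVar X xs => 2 :: nat_of_ord X :: code_tuple xs
  end.

Definition code_sym1 (f : sym1) : seq nat :=
  match f with
  | Not => [:: 3]
  | Ex1 x => [:: 4; nat_of_ord x]
  | All1 x => [:: 5; nat_of_ord x]
  | Ex2 X => [:: 6; nat_of_ord X]
  | All2 X => [:: 7; nat_of_ord X]
  end.

Definition code_sym2 (f : sym2) : seq nat :=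
  match f with And => [:: 8] | Or => [:: 9] end.

Fixpoint code_tree (n : nat) (t : tree 'I_n) : seq nat :=
  match t with
  | Leaf B => [:: 0; nat_of_ord B]
  | Node0 a => code_sym0 a
  | Node1 f p => code_sym1 f ++ code_tree p
  | Node2 f p q => code_sym2 f ++ code_tree p ++ code_tree q
  end.

Definition code_grammar (G : grammar) : seq nat :=
  nonterm G :: nat_of_ord (axiom G) ::
  code_seq (fun r => nat_of_ord r.1 :: code_tree r.2) (rules G).

Definition code_node (n : node) : seq nat :=
  match n with
  | Dag0 a => code_sym0 a
  | Dag1 f i => code_sym1 f ++ [:: i]
  | Dag2 f i j => code_sym2 f ++ [:: i; j]
  end.

(* A number n is written 1^n 0.  Domain sizes and numbers of nonterminals     *)
(* are thus given in unary, as usual for explicitly listed sets.              *)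
Definition bits (s : seq nat) : seq bool :=
  flatten [seq rcons (nseq n true) false | n <- s].

Definition encode_input (Pos Neg : seq (structure tau)) (G : grammar) :
    seq bool :=
  bits (code_seq code_structure Pos ++ code_seq code_structure Neg
          ++ code_grammar G).

(* None is the answer "No".                                                   *)
Definition encode_answer (ans : option dag) : seq bool :=
  bits (if ans is Some d then 1 :: code_seq code_node d else [:: 0]).

End Logic.

(* Deterministic multi-tape Turing machines with two-way infinite tapes.      *)

Inductive move := MoveL | Stay | MoveR.

Record TM := {
  ntape : nat; (* the machine has ntape.+1 tapes *)
  state : finType;
  sym : finType;
  blank : sym;
  bit : bool -> sym;
  bit_inj : injective bit;
  bit_neq_blank : forall b, bit b != blank;
  start : state;
  halting : pred state;
  trans : state -> {ffun 'I_ntape.+1 -> sym} ->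
          state * {ffun 'I_ntape.+1 -> sym * move}
}.

(* The cells to the left of the head are listed from the head outwards; all   *)
(* cells beyond the two lists are blank.                                      *)
Record tape (M : TM) := Tape {
  cells_left : seq (sym M);
  cell : sym M;
  cells_right : seq (sym M)
}.

Definition tape_of (M : TM) (w : seq (sym M)) : tape M :=
  Tape [::] (head (blank M) w) (behead w).

Definition tape_act (M : TM) (t : tape M) (a : sym M * move) : tape M :=
  let: Tape l _ r := t in
  match a.2 with
  | MoveL => Tape (behead l) (head (blank M) l) (a.1 :: r)
  | Stay => Tape l a.1 r
  | MoveR => Tape (a.1 :: l) (head (blank M) r) (behead r)
  end.

Definition config (M : TM) : Type :=
  (state M * {ffun 'I_(ntape M).+1 -> tape M})%type.

Definition init (M : TM) (w : seq bool) : config M :=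
  (start M, [ffun i => tape_of (if i == ord0 then map (@bit M) w else [::])]).

Definition step (M : TM) (c : config M) : config M :=
  if halting c.1 then c
  else let: (q, act) := trans c.1 [ffun i => cell (c.2 i)] in
       (q, [ffun i => tape_act (c.2 i) (act i)]).

(* The word starting at the head and followed by blanks only.                 *)
Definition tape_reads (M : TM) (t : tape M) (w : seq bool) : Prop :=
  forall i, nth (blank M) (cell t :: cells_right t) i
          = nth (blank M) (map (@bit M) w) i.

(* On input w (on the first tape), M halts after at most T steps with out     *)
(* written on the last tape.                                                  *)
Definition outputs_within (M : TM) (w : seq bool) (T : nat) (out : seq bool) :
    Prop :=
  exists n, [/\ n <= T,
    halting (iter n (@step M) (init M w)).1 &
    tape_reads ((iter n (@step M) (init M w)).2 ord_max) out].

(* Main.v *)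
(* Over the input structures a formula has one of doubly exponentially many   *)
(* meanings: its truth values under all assignments to the k first-order and  *)
(* k' second-order variables, together with its free variables.  Hence a      *)
(* table of the triples (tree occurring in a rule, meaning of a formula that  *)
(* it generates, DAG node for such a formula), in which every pair (tree,     *)
(* meaning) is listed once, is saturated after doubly exponentially many      *)
(* additions, and a separator exists iff some entry for a right-hand side of  *)
(* the axiom has a separating meaning.                                        *)
(* To run this on a Turing machine, call a function on encoded data           *)
(* polynomial-time if a program on four stacks of bits computes it; such      *)
(* functions are closed under composition and under folds with values of      *)
(* polynomial size.  The machine first writes the doubly exponential number   *)
(* of rounds in unary, and all the rest is polynomial-time in that number.    *)

From Stdlib Require Import Relation_Operators Operators_Properties.
From Stdlib Require List.
Require Import Defs.
From mathcomp Require Import all_boot.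
From mathcomp Require Import zify.

Set Implicit Arguments.
Unset Strict Implicit.
Unset Printing Implicit Defensive.

(** * Stack programs and their simulation by Turing machines *)

(** The grammar may generate infinitely many formulas, but only the meaning of a formula over the
    given structures matters, and the meaning of a compound formula is a function of the meanings of
    its parts. Hence the pairs of a tree from the rules and the meaning of a formula generated by it
    form the least set closed under finitely many operations. For an input of length n and fixed k,
    k' and arities, an environment takes polynomially many bits, so there are at most exponentially
    many environments and doubly exponentially many pairs.

    Saturation adds one new pair per round, and counting the pairs bounds the number of rounds
    ([size_sound], [saturated]). Every entry carries a node of a shared DAG, so each pair in the
    table is witnessed by a formula that can be printed ([sound_saturate]). Conversely, a saturated
    table contains the meaning of every generated formula ([complete]). Both directions meet in
    [solve_correct].

    Environments are coded by numbers whose bits are split into one block per variable. Every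
    environment has a code ([env_surj]), so a quantifier is a search through the numbers that differ
    from a given one in a single block ([exists1P], [exists2P]), and truth tables can be computed
    bit by bit.

    For the running time, programs on four stacks are compiled to Turing machines ([simulation]).
    Data are binary trees in a self-delimiting code, and [computes mu f] means that f is computed in
    time polynomial in mu plus the size of the argument. This notion is closed under composition,
    pairing, case distinction and folds with bounded accumulators ([computes_foldl]), so the tactic
    [pt] derives it from the text of the algorithm. With the doubly exponential [budget] for mu,
    [machine_of_computes] and [double_exp_bound] give the time bound. *)

Definition stacks := (seq bool * seq bool * seq bool * seq bool)%type.

(** The input is on tape 0 and the output on the last tape, so [a] and [c] are the stacks 0 and 3.
    The main stack [m], on which values are kept, is written first in a state but is tape 1. *)
Definition get (s : stacks) (i : 'I_4) : seq bool :=
  let: (m, a, b, c) := s in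
  match val i with 0 => a | 1 => m | 2 => b | _ => c end.

Definition put (s : stacks) (i : 'I_4) (w : seq bool) : stacks :=
  let: (m, a, b, c) := s in
  match val i with
  | 0 => (m, w, b, c) | 1 => (w, a, b, c) | 2 => (m, a, w, c) | _ => (m, a, b, w)
  end.

Lemma get_put s i w j : get (put s i w) j = if j == i then w else get s j.
Proof.
by case: s => [[[m a] b] c]; case: i => [[|[|[|[|?]]]] ?];
  case: j => [[|[|[|[|?]]]] ?].
Qed.

(** A test sees the top of one stack; [None] stands for the empty stack. *)
Inductive prog :=
| Skip
| Push of 'I_4 & bool
| Pop of 'I_4
| Seq of prog & prog
| If of 'I_4 & (option bool -> bool) & prog & prog
| While of 'I_4 & (option bool -> bool) & prog.

(* The number is an upper bound on the running time, by [EWeak]. *)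
Inductive exec : prog -> stacks -> nat -> stacks -> Prop :=
| ESkip s : exec Skip s 0 s
| EPush t b s : exec (Push t b) s 2 (put s t (b :: get s t))
| EPop t s : exec (Pop t) s 1 (put s t (behead (get s t)))
| ESeq p q s n s1 m s2 :
    exec p s n s1 -> exec q s1 m s2 -> exec (Seq p q) s (n + m) s2
| EIfT t (v : option bool -> bool) p q s n s' :
    v (ohead (get s t)) -> exec p s n s' -> exec (If t v p q) s n.+2 s'
| EIfF t (v : option bool -> bool) p q s n s' :
    ~~ v (ohead (get s t)) -> exec q s n s' -> exec (If t v p q) s n.+1 s'
| EWhileF t (v : option bool -> bool) p s :
    ~~ v (ohead (get s t)) -> exec (While t v p) s 1 s
| EWhileT t (v : option bool -> bool) p s n s1 m s2 :
    v (ohead (get s t)) -> exec p s n s1 -> exec (While t v p) s1 m s2 ->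
    exec (While t v p) s (n + m).+2 s2
| EWeak p s n m s' : exec p s n s' -> n <= m -> exec p s m s'.

Section Compilation.

Definition instr := ('I_4 * (option bool -> option bool * move * nat))%type.

(** Addresses are absolute: the code starts at [pc] and control leaves it just past its last
    instruction. A transition writes before it moves, so a push takes two instructions, one to step
    left and one to write. *)
Fixpoint compile (pc : nat) (p : prog) : seq instr :=
  match p with
  | Skip => [::]
  | Push t b => [:: (t, fun x => (x, MoveL, pc.+1));
                    (t, fun x => (Some b, Stay, pc.+2))]
  | Pop t => [:: (t, fun x => (None, MoveR, pc.+1))]
  | Seq p q => let c := compile pc p in c ++ compile (pc + size c) q
  | If t v p q =>
      let cp := compile pc.+1 p in
      let pc' := pc.+1 + size cp in
      let cq := compile pc'.+1 q in
      (t, fun x => (x, Stay, if v x then pc.+1 else pc'.+1)) :: cp ++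
      (t, fun x => (x, Stay, pc'.+1 + size cq)) :: cq
  | While t v p =>
      let cp := compile pc.+1 p in
      (t, fun x => (x, Stay, if v x then pc.+1 else (pc.+1 + size cp).+1)) ::
      cp ++ [:: (t, fun x => (x, Stay, pc))]
  end.

Variable code : seq instr.

Definition machine_trans (q : 'I_(size code).+1)
    (x : {ffun 'I_4 -> option bool}) :
    'I_(size code).+1 * {ffun 'I_4 -> option bool * move} :=
  let: (t, f) := nth (ord0, fun x => (x, Stay, 0)) code q in
  let: (a, q') := f (x t) in
  (inord q', [ffun i => if i == t then a else (x i, Stay)]).

Definition machine : TM := {|
  ntape := 3;
  state := 'I_(size code).+1;
  sym := option bool;
  blank := None;
  bit := Some;
  bit_inj := @Some_inj _;
  bit_neq_blank := fun b => isT;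
  start := ord0;
  halting := fun q => val q == size code;
  trans := machine_trans
|}.

(* A stack occupies the cells from the head to the right. *)
Definition holds (T : tape machine) (w : seq bool) : Prop :=
  all (pred1 None) (cells_left T) /\ tape_reads T w.

Definition holds_all (T : {ffun 'I_4 -> tape machine}) (s : stacks) : Prop :=
  forall i, holds (T i) (get s i).

Lemma reads_cell (T : tape machine) w : holds T w -> cell T = ohead w.
Proof. by case=> _ /(_ 0); case: w. Qed.

Lemma holds_pop (T : tape machine) w : holds T w ->
  holds (tape_act T ((None : sym machine), MoveR)) (behead w).
Proof.
case: T => l x r [/= al rd]; split=> //= i.
have -> : nth None (head None r :: behead r) i = nth None (x :: r) i.+1.
  by case: r {rd} => [|y r]; rewrite //= nth_nil; case: i => //= i; rewrite nth_nil.
by rewrite rd; case: w {rd} => [|y w]; rewrite //= !nth_nil.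
Qed.

Lemma holds_push (T : tape machine) w b : holds T w ->
  holds (tape_act (tape_act T (cell T, MoveL)) ((Some b : sym machine), Stay))
    (b :: w).
Proof.
case: T => l x r [/= al rd]; split=> /=; first by case: l al rd => //= ? ? /andP[].
by case=> [|i] //=; apply: rd.
Qed.

Definition code_at pc (c : seq instr) :=
  exists a b, code = a ++ c ++ b /\ size a = pc.

Lemma code_at_cat pc c d :
  code_at pc (c ++ d) -> code_at pc c /\ code_at (pc + size c) d.
Proof.
case=> a [b [e <-]]; split; first by exists a, (d ++ b); rewrite e -!catA.
by exists (a ++ c), b; rewrite e size_cat -!catA.
Qed.

Lemma step_at pc t f c (T : {ffun 'I_4 -> tape machine}) :
  code_at pc ((t, f) :: c) ->
  @step machine (inord pc, T) =
  (inord (f (cell (T t))).2,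
   [ffun i => if i == t then tape_act (T i) (f (cell (T t))).1 else T i]).
Proof.
case=> a [b [e <-]].
have lt_pc : size a < size code by rewrite e size_cat /= addnS; lia.
rewrite /step /= inordK; last exact: ltnW.
rewrite ltn_eqF // /machine_trans inordK; last exact: ltnW.
rewrite {1}e nth_cat ltnn subnn /= ffunE.
case: (f (cell (T t))) => [a' q'] /=; congr pair.
apply/ffunP => i; rewrite !ffunE.
by case: eqP => // _; case: (T i).
Qed.

(** Tests and jumps write back the symbol that they have read, so only the program counter
    changes. *)
Lemma holds_same (T : {ffun 'I_4 -> tape machine}) s t : holds_all T s ->
  holds_all [ffun i => if i == t then tape_act (T i) (cell (T t), Stay) else T i] s.
Proof.
by move=> h i; rewrite ffunE; case: eqP => [->|//]; have := h t; case: (T t).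
Qed.

(** Induction on the execution. A test takes one step, and one more step jumps over the else-branch
    or back to the test, which is what the rules of [exec] charge. After one turn of a loop control
    is again at the same address, where the second induction hypothesis applies. *)
Lemma simulation p s n s' : exec p s n s' ->
  forall pc T, code_at pc (compile pc p) -> holds_all T s ->
  exists n' T', [/\ n' <= n,
    iter n' (@step machine) (inord pc, T)
      = (inord (pc + size (compile pc p)), T') & holds_all T' s'].
Proof.
elim=> {p s n s'}.
- by move=> s pc T _ h; exists 0, T; rewrite addn0.
- move=> t b s pc T c_at h.
  have [c1 c2] := @code_at_cat pc [:: _] [:: _] c_at.
  exists 2; eexists; split=> //=.
    rewrite (step_at _ c_at) /=; rewrite addn1 in c2; rewrite (step_at _ c2) /=.
    by rewrite addn2.
  move=> i; rewrite !ffunE get_put; case: (i =P t) => [->|_]; last exact: h.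
  exact: holds_push.
- move=> t s pc T c_at h; exists 1; eexists; split=> //=.
    by rewrite (step_at _ c_at) /= addn1.
  move=> i; rewrite !ffunE get_put; case: eqP => [->|_]; last exact: h.
  exact: holds_pop.
- move=> p q s n s1 m s2 _ IH1 _ IH2 pc T /=/code_at_cat[c1 c2] h.
  have [n1 [T1 [le1 e1 h1]]] := IH1 _ _ c1 h.
  have [n2 [T2 [le2 e2 h2]]] := IH2 _ _ c2 h1.
  exists (n2 + n1), T2; split=> //; first lia.
  by rewrite iterD e1 e2 size_cat addnA.
- move=> t v p q s n s' vt _ IH pc T /= c_at h.
  set cp := compile pc.+1 p in c_at *.
  have [c1] := @code_at_cat pc [:: _] _ c_at; rewrite addn1 => /code_at_cat[c2 c3].
  have [n1 [T1 [le1 e1 h1]]] := IH _ _ c2 (holds_same t h).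
  exists (n1.+2); eexists; split; first lia.
    rewrite iterS iterSr (step_at _ c_at) /= (reads_cell (h t)) vt.
    move: e1; rewrite /= (reads_cell (h t)) => ->.
    rewrite (step_at _ c3) /=; congr (inord _, _).
    by rewrite /= ?size_cat /= ?size_cat /=; lia.
  exact: (holds_same t h1).
- move=> t v p q s n s' vt _ IH pc T /= c_at h.
  set cp := compile pc.+1 p in c_at *.
  have [c1] := @code_at_cat pc [:: _] _ c_at; rewrite addn1 => /code_at_cat[c2 c3].
  have [_] := @code_at_cat _ [:: _] _ c3; rewrite addn1 => c4.
  have [n1 [T1 [le1 e1 h1]]] := IH _ _ c4 (holds_same t h).
  exists (n1.+1), T1; split=> //.
  rewrite iterSr (step_at _ c_at) /= (reads_cell (h t)) (negbTE vt).
  move: e1; rewrite /= (reads_cell (h t)) => ->.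
  by congr (inord _, _); rewrite /= ?size_cat /= ?size_cat /=; lia.
- move=> t v p s vt pc T /= c_at h.
  exists 1; eexists; split; [by [] | | exact: (holds_same t h)].
  rewrite /= (step_at _ c_at) /= (reads_cell (h t)) (negbTE vt).
  by congr (inord _, _); rewrite /= ?size_cat /=; lia.
- move=> t v p s n s1 m s2 vt _ IH1 _ IH2 pc T /= c_at h.
  set cp := compile pc.+1 p in c_at *.
  have [c1] := @code_at_cat pc [:: _] _ c_at; rewrite addn1 => /code_at_cat[c2 c3].
  have [n1 [T1 [le1 e1 h1]]] := IH1 _ _ c2 (holds_same t h).
  have [n2 [T2 [le2 e2 h2]]] := IH2 _ _ c_at (holds_same t h1).
  exists (n2 + n1.+2), T2; split=> //; first lia.
  rewrite iterD iterS iterSr (step_at _ c_at) /= (reads_cell (h t)) vt.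
  move: e1; rewrite /= (reads_cell (h t)) => ->.
  by rewrite (step_at _ c3) /= e2.
- move=> p s n m s' _ IH le_nm pc T c_at h.
  have [n' [T' [le' e' h']]] := IH _ _ c_at h.
  by exists n', T'; split=> //; lia.
Qed.

End Compilation.

Lemma exec_outputs p w n s : exec p ([::], w, [::], [::]) n s ->
  outputs_within (machine (compile 0 p)) w n (get s ord_max).
Proof.
set code := compile 0 p => ex.
have c_at : code_at code 0 (compile 0 p) by exists [::], [::]; rewrite cats0.
have hT : holds_all (init (machine code) w).2 ([::], w, [::], [::]).
  move=> i; rewrite ffunE; split=> //= j.
  by case: i => [[|[|[|[|?]]]] ?] //=; case: w {ex} j => [|b w] [|j];
    rewrite //= ?nth_nil //; case: j => //= j; rewrite nth_nil.
have [n' [T' [le_n' e h]]] := simulation ex c_at hT.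
have e0 : (inord 0, (init (machine code) w).2) = init (machine code) w.
  by congr pair; apply: val_inj; rewrite /= inordK.
by rewrite e0 in e; exists n'; rewrite e; split=> //=;
  [rewrite inordK | case: (h ord_max)].
Qed.

(** * Programs on binary trees *)

Inductive dat := Nl | Cn of dat & dat.

(** Prefix notation is self-delimiting ([ser_inj]), so values can lie on one stack one after another
    without separators. *)
Fixpoint ser (x : dat) : seq bool :=
  if x is Cn y z then true :: ser y ++ ser z else [:: false].

Definition dsize (x : dat) := size (ser x).

Lemma ser_inj x y r r' : ser x ++ r = ser y ++ r' -> x = y /\ r = r'.
Proof.
elim: x y r r' => [|x IHx x' IHx'] [|y y'] r r' //= []; first by [].
rewrite -!catA => /IHx[<-] /IHx'[<-]; by split.
Qed.

Notation tM := (@Ordinal 4 1 isT).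
Notation tA := (@Ordinal 4 0 isT).
Notation tB := (@Ordinal 4 2 isT).
Notation tC := (@Ordinal 4 3 isT).

Notation istrue := (fun o : option bool => o == Some true).
Notation full := (fun o : option bool => o != None).

Fixpoint seqs (ps : seq prog) : prog :=
  match ps with [::] => Skip | [:: p] => p | p :: ps => Seq p (seqs ps) end.

(* B counts the trees that are still to be read. *)
Definition pull_tree := seqs [:: Push tB true;
  While tB full (If tM istrue (seqs [:: Pop tM; Push tA true; Push tB true])
                              (seqs [:: Pop tM; Push tA false; Pop tB]))].

Definition move_all (i j : 'I_4) :=
  While i full (If i istrue (Seq (Pop i) (Push j true)) (Seq (Pop i) (Push j false))).

Definition move_all2 (i j k : 'I_4) :=
  While i full (If i istrue (seqs [:: Pop i; Push j true; Push k true])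
                            (seqs [:: Pop i; Push j false; Push k false])).

Definition clear (i : 'I_4) := While i full (Pop i).

Lemma exec_push t b s s' n :
  s' = put s t (b :: get s t) -> 2 <= n -> exec (Push t b) s n s'.
Proof. by move=> -> le_n; apply: EWeak le_n; constructor. Qed.

Lemma exec_pop t s s' n :
  s' = put s t (behead (get s t)) -> 0 < n -> exec (Pop t) s n s'.
Proof. by move=> -> le_n; apply: EWeak le_n; constructor. Qed.

Lemma exec_seq p q s n m k s1 s2 : exec p s n s1 -> exec q s1 m s2 ->
  n + m <= k -> exec (Seq p q) s k s2.
Proof. by move=> ep eq; apply: EWeak; apply: ESeq ep eq. Qed.

Lemma exec_if t (v : option bool -> bool) p q s n k s' :
  exec (if v (ohead (get s t)) then p else q) s n s' -> n + 2 <= k ->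
  exec (If t v p q) s k s'.
Proof.
move=> e le_k; apply: (@EWeak _ _ n.+2); last lia.
case: ifP e => [vt|/negbT vt] e; first exact: EIfT.
by apply: (@EWeak _ _ n.+1) => //; apply: EIfF.
Qed.

Lemma exec_whileF t (v : option bool -> bool) p s n :
  ~~ v (ohead (get s t)) -> 0 < n -> exec (While t v p) s n s.
Proof. by move=> vt le_n; apply: EWeak le_n; apply: EWhileF. Qed.

Lemma exec_whileT t (v : option bool -> bool) p s n s1 m s2 k :
  v (ohead (get s t)) -> exec p s n s1 -> exec (While t v p) s1 m s2 ->
  n + m + 2 <= k -> exec (While t v p) s k s2.
Proof.
move=> vt e1 e2 le_k; apply: (@EWeak _ _ (n + m).+2); last lia.
exact: EWhileT e1 e2.
Qed.

Ltac run_prog := lazymatch goal with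
  | |- exec (Seq _ _) _ _ _ => eapply exec_seq; [run_prog | run_prog | ]
  | |- exec (Push _ _) _ _ _ => eapply exec_push; [reflexivity | apply: leqnn]
  | |- exec (Pop _) _ _ _ => eapply exec_pop; [reflexivity | apply: leqnn]
  | |- exec Skip _ _ _ => eapply ESkip
  | |- _ => idtac end.
Ltac runs := rewrite /=; run_prog; try apply: leqnn.

(** Stated backwards: an execution that starts after [x] has been read yields one that starts before
    it. A node replaces one mark by two, one for each subtree, so in this form the two induction
    hypotheses compose. *)
Lemma pull_loop x m a b c n s :
  exec (While tB full (If tM istrue (seqs [:: Pop tM; Push tA true; Push tB true])
          (seqs [:: Pop tM; Push tA false; Pop tB]))) (m, catrev (ser x) a, b, c) n s ->
  exec (While tB full (If tM istrue (seqs [:: Pop tM; Push tA true; Push tB true])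
          (seqs [:: Pop tM; Push tA false; Pop tB])))
    (ser x ++ m, a, true :: b, c) (n + 9 * dsize x) s.
Proof.
elim: x m a b n => [|x IHx y IHy] m a b n e.
  eapply exec_whileT => //; [eapply exec_if; [by runs|apply: leqnn] | exact: e |].
  by rewrite /dsize /=; lia.
eapply exec_whileT => //; first by [eapply exec_if; [by runs|apply: leqnn]].
  rewrite /= -catA; apply: (IHx _ _ _); apply: (IHy _ _ _).
  by move: e; rewrite /= catrev_catl; apply.
by rewrite /dsize /= size_cat; lia.
Qed.

Lemma exec_pull x m c :
  exec pull_tree (ser x ++ m, [::], [::], c) (9 * dsize x + 3)
    (m, rev (ser x), [::], c).
Proof.
eapply exec_seq; [by runs | apply: pull_loop | ].
  by apply: (@exec_whileF _ _ _ _ 1).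
by rewrite /=; lia.
Qed.

Lemma put_put s i v w : put (put s i v) i w = put s i w.
Proof. by case: s => [[[m a] b] c]; case: i => [[|[|[|[|?]]]] ?]. Qed.

Lemma put_get s i : put s i (get s i) = s.
Proof. by case: s => [[[m a] b] c]; case: i => [[|[|[|[|?]]]] ?]. Qed.

Lemma putC s i j v w : i != j -> put (put s i v) j w = put (put s j w) i v.
Proof.
by case: s => [[[m a] b] c]; case: i => [[|[|[|[|?]]]] ?];
  case: j => [[|[|[|[|?]]]] ?].
Qed.

Lemma exec_move_all i j s : i != j ->
  exec (move_all i j) s (7 * size (get s i) + 1)
    (put (put s i [::]) j (catrev (get s i) (get s j))).
Proof.
move=> ij; move e: (get s i) => w; elim: w s e => [|x w IH] s e.
  by rewrite -{2}e !put_get; apply: exec_whileF; rewrite ?e.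
pose s1 := put (put s i w) j (x :: get s j).
eapply (@exec_whileT _ _ _ _ 5 s1); first by rewrite e.
- eapply (@exec_if _ _ _ _ _ 3); last by [].
  rewrite (_ : ohead _ = Some x) ?e //.
  have -> : s1 = put (put s i (behead (get s i))) j
      (x :: get (put s i (behead (get s i))) j).
    by rewrite get_put eq_sym (negbTE ij) e.
  case: (x); rewrite /=; run_prog; lia.
- have e1 : get s1 i = w by rewrite !get_put (negbTE ij) eqxx.
  have -> : put (put s i [::]) j (catrev (x :: w) (get s j))
    = put (put s1 i [::]) j (catrev w (get s1 j)).
    by rewrite /s1 (putC _ _ _ (i:=j)) 1?eq_sym // !put_put get_put eqxx.
  exact: IH.
- by rewrite /=; lia.
Qed.

Lemma exec_move_all2 m a b c :
  exec (move_all2 tA tM tC) (m, a, b, c) (9 * size a + 1)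
    (catrev a m, [::], b, catrev a c).
Proof.
elim: a m c => [|x a IH] m c; first by apply: exec_whileF.
eapply (@exec_whileT _ _ _ _ 7); [by [] | | exact: IH | by rewrite /=; lia].
by eapply (@exec_if _ _ _ _ _ 5) => //; case: x; runs.
Qed.

Lemma exec_clear i s :
  exec (clear i) s (3 * size (get s i) + 1) (put s i [::]).
Proof.
move e: (get s i) => w; elim: w s e => [|x w IH] s e.
  by rewrite -{2}e put_get; apply: exec_whileF; rewrite ?e.
eapply (@exec_whileT _ _ _ _ 1 (put s i w)); first by rewrite e.
- by eapply exec_pop; rewrite ?e.
- by rewrite -(put_put s i w [::]); apply: IH; rewrite get_put eqxx.
- by rewrite /=; lia.
Qed.

Definition Drop := seqs [:: pull_tree; clear tA].
Definition Dup := seqs [:: pull_tree; move_all2 tA tM tC; move_all tC tA; move_all tA tM].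
Definition Swap := seqs [:: pull_tree; move_all tA tC; pull_tree;
  move_all tC tB; move_all tB tM; move_all tA tM].

Lemma exec_drop x m : exec Drop (ser x ++ m, [::], [::], [::])
  (12 * dsize x + 4) (m, [::], [::], [::]).
Proof.
eapply exec_seq; [exact: exec_pull | exact: exec_clear |].
by rewrite /= size_rev /dsize; lia.
Qed.

Lemma exec_eq p s n s1 m s2 : exec p s n s1 -> s1 = s2 -> n <= m -> exec p s m s2.
Proof. by move=> e <-; apply: EWeak. Qed.

Lemma exec_dup x m : exec Dup (ser x ++ m, [::], [::], [::])
  (40 * dsize x + 20) (ser x ++ ser x ++ m, [::], [::], [::]).
Proof.
eapply exec_eq.
- by eapply exec_seq; [exact: exec_pull | eapply exec_seq; [exact: exec_move_all2 |
   eapply exec_seq; [exact: exec_move_all | exact: exec_move_all | exact: leqnn]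
   | exact: leqnn] | exact: leqnn].
- by rewrite /= !catrevE !cats0 !revK.
- by rewrite /= !catrevE !revK !cats0 !size_rev /dsize; lia.
Qed.

Lemma exec_swap x y m : exec Swap (ser x ++ ser y ++ m, [::], [::], [::])
  (40 * (dsize x + dsize y) + 20) (ser y ++ ser x ++ m, [::], [::], [::]).
Proof.
eapply exec_eq.
- by eapply exec_seq; [exact: exec_pull | eapply exec_seq; [exact: exec_move_all |
    eapply exec_seq; [exact: exec_pull | eapply exec_seq; [exact: exec_move_all |
    eapply exec_seq; [exact: exec_move_all | exact: exec_move_all | exact: leqnn]
    | exact: leqnn] | exact: leqnn] | exact: leqnn] | exact: leqnn].
- by rewrite /= !catrevE ?cats0 !revK.
- by rewrite /= !catrevE !revK ?cats0 !size_rev /dsize; lia.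
Qed.

(* One mark is pushed on A for every mismatch. *)
Definition compare := While tB full (seqs [::
    If tB istrue (If tC istrue Skip (Push tA true))
                 (If tC (fun o => o == Some false) Skip (Push tA true));
    Pop tB; Pop tC]).

(** The words pushed at the end are the codes of the booleans: a single leaf for [false], a node
    with two leaves for [true]. *)
Definition Eqb := seqs [:: pull_tree; move_all tA tC; pull_tree; move_all tA tB;
  compare; clear tC;
  If tA full (seqs [:: clear tA; Push tM false])
             (seqs [:: Push tM false; Push tM false; Push tM true])].

(** Only as many letters of [c] are inspected as [b] has, so the marks decide whether [b] is a
    prefix of [c]. *)
Lemma exec_compare m a b c : exists2 a',
  exec compare (m, a, b, c) (10 * size b + 1) (m, a', [::], drop (size b) c)
  & (a' == [::]) = (a == [::]) && (take (size b) c == b) /\ size a' <= size a + size b.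
Proof.
elim: b a c => [|x b IH] a c.
  by exists a; [rewrite drop0; apply: exec_whileF | rewrite take0 andbT addn0].
have [a' e [e1 e2]] := IH (if ohead c == Some x then a else true :: a) (behead c).
exists a'; last first.
  split; last by move: e2; case: ifP => /=; lia.
  rewrite e1; case: c {e e1 e2} => [|y c] /=; first by rewrite andbF.
  by rewrite eqseq_cons (inj_eq Some_inj); case: (y == x); rewrite /= ?andbF.
have -> : drop (size (x :: b)) c = drop (size b) (behead c) by case: (c).
eapply (@exec_whileT _ _ _ _ 8); [by [] | | exact: e |by rewrite /=; lia].
eapply (@exec_seq _ _ _ 6 2 _
  (m, if ohead c == Some x then a else true :: a, x :: b, c)).
- eapply (@exec_if _ _ _ _ _ 4) => //=.
  by clear; case: x; eapply (@exec_if _ _ _ _ _ 2) => //=; case: c => [|[] c] /=;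
    first [by apply: exec_push | by apply: EWeak (ESkip _) _].
- by eapply exec_eq; [runs | | ].
- by [].
Qed.

(** No code is a proper prefix of another, hence the prefix test of [compare] decides equality. *)
Lemma ser_take x y : (take (size (ser x)) (ser y) == ser x) = (ser y == ser x).
Proof.
apply/eqP/eqP => [e|->]; last exact: take_size.
have := cat_take_drop (size (ser x)) (ser y); rewrite e.
by rewrite -{2}(cats0 (ser y)) => /ser_inj[<-].
Qed.

Lemma exec_eqb x y m : exec Eqb (ser x ++ ser y ++ m, [::], [::], [::])
  (60 * (dsize x + dsize y) + 60)
  ((if ser x == ser y then [:: true; false; false] else [:: false]) ++ m,
   [::], [::], [::]).
Proof.
have [a' e [e1 e2]] := exec_compare m [::] (ser y) (ser x).
rewrite ser_take /= in e1; rewrite /= add0n in e2; rewrite -e1.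
eapply (@exec_eq _ _ _ ((if a' == [::] then [:: true; false; false]
                         else [:: false]) ++ m, [::], [::], [::])).
- eapply exec_seq; [exact: exec_pull | eapply exec_seq; [exact: exec_move_all |
    eapply exec_seq; [exact: exec_pull | eapply exec_seq; [exact: exec_move_all |
    rewrite /= !catrevE !revK !cats0; eapply exec_seq; [exact: e
    | eapply exec_seq; [exact: exec_clear | | exact: leqnn] | exact: leqnn]
    | exact: leqnn] | exact: leqnn] | exact: leqnn] | exact: leqnn].
  eapply (@exec_if _ _ _ _ _ (3 * size a' + 6)); last exact: leqnn.
  rewrite /=; clear; case: a' => [|z a']; rewrite /=.
    by eapply exec_eq; [runs | |].
  eapply exec_eq; [eapply exec_seq; [exact: exec_clear | runs | exact: leqnn] | by [] |].
  by rewrite /=; lia.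
- by [].
- by rewrite /= ?catrevE ?revK ?cats0 ?size_rev ?size_drop /dsize; lia.
Qed.

(** * Polynomial time on encoded data *)

Definition total (s : stacks) :=
  let: (m, a, b, c) := s in size m + size a + size b + size c.

(** A program writes no more letters than it makes steps, so a time bound also bounds the size of
    the result. *)
Lemma exec_total p s n s' : exec p s n s' -> total s' <= total s + n.
Proof.
elim=> {p s n s'} /=; try (intros; lia).
- by move=> [[|[|[|[|?]]]] ?] b [[[? ?] ?] ?] //=; lia.
- by move=> [[|[|[|[|?]]]] ?] [[[? ?] ?] ?] //=; rewrite size_behead; lia.
Qed.

Class Enc (T : Type) := { enc : T -> dat; enc_inj : injective enc }.

Lemma enc_unit_inj : injective (fun _ : unit => Nl).
Proof. by do 2!case. Qed.

#[export] Instance enc_unit : Enc unit := Build_Enc enc_unit_inj.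

Lemma enc_bool_inj : injective (fun b => if b then Cn Nl Nl else Nl).
Proof. by do 2!case. Qed.

#[export] Instance enc_bool : Enc bool := Build_Enc enc_bool_inj.

Fixpoint enc_list (T : Type) (e : T -> dat) (s : seq T) : dat :=
  if s is x :: s' then Cn (e x) (enc_list e s') else Nl.

Lemma enc_list_inj T (E : Enc T) : injective (enc_list (@enc T E)).
Proof. by elim=> [|x s IH] [|y t] //= [e e']; rewrite (enc_inj e) (IH _ e'). Qed.

#[export] Instance enc_seq T (E : Enc T) : Enc (seq T) := Build_Enc (@enc_list_inj T E).

Lemma enc_prod_inj A B (EA : Enc A) (EB : Enc B) :
  injective (fun p : A * B => Cn (enc p.1) (enc p.2)).
Proof. by move=> [a b] [a' b'] /= [e e']; rewrite (enc_inj e) (enc_inj e'). Qed.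

#[export] Instance enc_prod A B (EA : Enc A) (EB : Enc B) : Enc (A * B) :=
  Build_Enc (@enc_prod_inj A B EA EB).

Lemma enc_nat_inj : injective (fun n => enc (nseq n tt)).
Proof. by move=> m n e; have {}e := enc_inj e; rewrite -(size_nseq m tt) e size_nseq. Qed.

(** Numbers are stored in unary; those that occur in the algorithm stay polynomial in the time
    budget. *)
#[export] Instance enc_nat : Enc nat := Build_Enc enc_nat_inj.

Definition esize {T : Type} {E : Enc T} (x : T) := dsize (enc x).

Lemma esize_gt0 (T : Type) (E : Enc T) (x : T) : 0 < esize x.
Proof. by rewrite /esize; case: (enc x). Qed.

Lemma esize_pair (A B : Type) (EA : Enc A) (EB : Enc B) (p : A * B) :
  esize p = (esize p.1 + esize p.2).+1.
Proof. by rewrite /esize /dsize /= size_cat. Qed.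

Lemma esize_cons (A : Type) (EA : Enc A) (x : A) s :
  esize (x :: s) = (esize x + esize s).+1.
Proof. by rewrite /esize /dsize /= size_cat. Qed.

Lemma esize_nil (A : Type) (EA : Enc A) : esize ([::] : seq A) = 1.
Proof. by []. Qed.

Lemma esize_nat (n : nat) : esize n = (2 * n).+1.
Proof.
elim: n => // n IH; rewrite (_ : esize n.+1 = (esize n).+2) // IH; lia.
Qed.

Lemma esize_bool (b : bool) : esize b <= 3.
Proof. by case: b. Qed.

Lemma size_esize (A : Type) (EA : Enc A) (s : seq A) : size s < esize s.
Proof. by elim: s => // x s IH; rewrite esize_cons /=; lia. Qed.

Section PolynomialBounds.
Variables (C : Type) (Y : C -> nat).

(** The base is at least 2, so that a single exponent absorbs constants, sums and products. *)
Definition pb (f : C -> nat) := exists k, forall c, f c <= (Y c).+2 ^ k.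

Lemma pb_le f g : (forall c, f c <= g c) -> pb g -> pb f.
Proof. by move=> le_fg [k le_g]; exists k => c; apply: leq_trans (le_fg c) _. Qed.

Lemma pb_const n : pb (fun=> n).
Proof. by exists n => c; apply: ltnW; apply: ltn_expl. Qed.

Lemma pb_Y : pb Y.
Proof. by exists 1 => c; rewrite expn1; lia. Qed.

Lemma pb_mul f g : pb f -> pb g -> pb (fun c => f c * g c).
Proof. by move=> [k hf] [l hg]; exists (k + l) => c; rewrite expnD leq_mul. Qed.

Lemma pb_add f g : pb f -> pb g -> pb (fun c => f c + g c).
Proof.
move=> [k hf] [l hg]; exists (k + l).+1 => c.
have hk : (Y c).+2 ^ k <= (Y c).+2 ^ (k + l) by rewrite leq_pexp2l // leq_addr.
have hl : (Y c).+2 ^ l <= (Y c).+2 ^ (k + l) by rewrite leq_pexp2l // leq_addl.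
have := leq_trans (hf c) hk; have := leq_trans (hg c) hl; rewrite expnS; nia.
Qed.

Lemma pb_exp f k : pb f -> pb (fun c => f c ^ k).
Proof. by move=> [l hf]; exists (l * k) => c; rewrite expnM; case: k => // k; rewrite leq_exp2r.
Qed.

Lemma pb_S f : pb f -> pb (fun c => (f c).+1).
Proof. by move=> hf; apply: pb_le (pb_add hf (pb_const 1)) => c; lia. Qed.

End PolynomialBounds.

Ltac pbs := cbv beta; first [assumption | lazymatch goal with
  | |- pb _ (fun _ => ?n) => exact (@pb_const _ _ n)
  | |- pb _ (fun c => @?f c + @?g c) => refine (@pb_add _ _ f g _ _); pbs
  | |- pb _ (fun c => @?f c * @?g c) => refine (@pb_mul _ _ f g _ _); pbs
  | |- pb _ (fun c => @?f c ^ ?k) => refine (@pb_exp _ _ f k _); pbs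
  | |- pb _ (fun c => (@?f c).+1) => refine (@pb_S _ _ f _); pbs
  | |- _ => idtac end].

Definition st (w : seq bool) : stacks := (w, [::], [::], [::]).

(* The junk r below the argument is what makes programs composable. *)
Definition computes {C B : Type} {EC : Enc C} {EB : Enc B} (mu : C -> nat)
    (f : C -> B) : Prop :=
  exists p t, pb (fun c => mu c + esize c) t /\
    forall c r, exec p (st (ser (enc c) ++ r)) (t c) (st (ser (enc (f c)) ++ r)).

Definition ptime {C B : Type} {EC : Enc C} {EB : Enc B} (f : C -> B) :=
  computes (fun=> 0) f.

Section Closure.
Variables (C : Type) (EC : Enc C) (mu : C -> nat).
Notation Y := (fun c => mu c + esize c).
Notation pbC := (pb Y).

Lemma pb_mu : pbC mu.
Proof. by apply: pb_le (pb_Y Y) => c; apply: leq_addr. Qed.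

Lemma pb_esize : pbC esize.
Proof. by apply: pb_le (pb_Y Y) => c; apply: leq_addl. Qed.

Lemma computes_esize B (EB : Enc B) (f : C -> B) :
  computes mu f -> pbC (fun c => esize (f c)).
Proof.
case=> p [t [ht hp]]; apply: pb_le (pb_add pb_esize ht) => c.
by have := exec_total (hp c [::]); rewrite /= !cats0 !addn0.
Qed.

(** The running time of [g] depends on the size of its argument, which [computes_esize] bounds; [nu]
    is a budget for [g], measured on that argument. *)
Lemma computes_gcomp A B (EA : Enc A) (EB : Enc B) nu (g : A -> B) (f : C -> A) :
  computes nu g -> computes mu f -> pbC (fun c => nu (f c)) ->
  computes mu (fun c => g (f c)).
Proof.
case=> p [t [[k ht] hp]] hf hnu; have hs := computes_esize hf.
case: hf => q [u [hu hq]].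
exists (Seq q p), (fun c => u c + (nu (f c) + esize (f c) + 2) ^ k); split; first by pbs.
move=> c r; eapply exec_seq; [exact: hq | exact: hp | rewrite leq_add2l].
by rewrite addn2.
Qed.

Lemma computes_comp A B (EA : Enc A) (EB : Enc B) (g : A -> B) (f : C -> A) :
  ptime g -> computes mu f -> computes mu (fun c => g (f c)).
Proof. by move=> hg hf; apply: computes_gcomp hg hf (pb_const _ 0). Qed.

(** For passing between types with the same codes, such as the pair of a head and a tail and the
    list made of them. *)
Lemma computes_cast B (EB : Enc B) (f : C -> B) :
  (forall c, enc (f c) = enc c) -> computes mu f.
Proof.
move=> ef; exists Skip, (fun=> 0); split; first exact: pb_const.
by move=> c r; rewrite ef; constructor.
Qed.

Lemma computes_id : computes mu (fun c => c).
Proof. exact: computes_cast. Qed.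

Definition push_word (w : seq bool) := foldr (fun b p => Seq p (Push tM b)) Skip w.

Lemma exec_push_word w m : exec (push_word w) (st m) (2 * size w) (st (w ++ m)).
Proof.
elim: w => [|b w IH] /=; first exact: ESkip.
by eapply exec_seq; [exact: IH | runs | lia].
Qed.

Lemma computes_const B (EB : Enc B) (b : B) : computes mu (fun=> b).
Proof.
exists (Seq Drop (push_word (ser (enc b)))),
  (fun c => (12 * esize c + 4) + 2 * esize b); split; first by pbs; exact: pb_esize.
move=> c r; eapply exec_seq; [exact: exec_drop | exact: exec_push_word | exact: leqnn].
Qed.

(** The second component is computed first, because the first one must end up on top; the last push
    is the constructor of the pair. *)
Lemma computes_pair A B (EA : Enc A) (EB : Enc B) (f : C -> A) (g : C -> B) :
  computes mu f -> computes mu g -> computes mu (fun c => (f c, g c)).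
Proof.
move=> hf hg; have sg := computes_esize hg; have sC := pb_esize.
case: hf => p [t [ht hp]]; case: hg => q [u [hu hq]].
exists (seqs [:: Dup; q; Swap; p; Push tM true]), (fun c => 40 * esize c + 20 +
  (u c + (40 * (esize (g c) + esize c) + 20 + (t c + 2)))); split; first by pbs.
move=> c r; eapply exec_seq; [exact: exec_dup | | exact: leqnn].
eapply exec_seq; [exact: hq | | exact: leqnn].
eapply exec_seq; [exact: exec_swap | | exact: leqnn].
eapply exec_seq; [exact: hp | | exact: leqnn].
by apply: exec_push; rewrite //= -catA.
Qed.

Lemma computes_if B (EB : Enc B) (b : C -> bool) (f g : C -> B) :
  computes mu b -> computes mu f -> computes mu g ->
  computes mu (fun c => if b c then f c else g c).
Proof.
move=> [pb' [tb [htb hb]]] [p [t [ht hp]]] [q [u [hu hq]]]; have sC := pb_esize.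
exists (seqs [:: Dup; pb';
   If tM istrue (seqs [:: Pop tM; Pop tM; Pop tM; p]) (Seq (Pop tM) q)]),
  (fun c => 40 * esize c + 20 + (tb c + (3 + t c + u c + 2))); split; first by pbs.
move=> c r; eapply exec_seq; [exact: exec_dup | | exact: leqnn].
eapply exec_seq; [exact: hb | | exact: leqnn].
eapply exec_if; last exact: leqnn; case: (b c) => /=.
  eapply exec_eq; [eapply exec_seq; [runs | eapply exec_seq; [runs |
    eapply exec_seq; [runs | exact: hp | exact: leqnn] | exact: leqnn] |exact: leqnn]
    | by [] | lia].
by eapply exec_eq; [eapply exec_seq; [runs | exact: hq | exact: leqnn] | | lia].
Qed.

End Closure.

Lemma ptime_fst A B (EA : Enc A) (EB : Enc B) : ptime (@fst A B).
Proof.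
exists (seqs [:: Pop tM; Swap; Drop]), (fun p => 60 * esize p + 60); split.
  by pbs; exact: pb_esize.
move=> [a b] r; eapply exec_seq; [runs | eapply exec_seq;
  [ rewrite /= -catA; exact: exec_swap | exact: exec_drop | exact: leqnn] | ].
by rewrite esize_pair /= /esize; lia.
Qed.

Lemma ptime_snd A B (EA : Enc A) (EB : Enc B) : ptime (@snd A B).
Proof.
exists (seqs [:: Pop tM; Drop]), (fun p => 60 * esize p + 60); split.
  by pbs; exact: pb_esize.
move=> [a b] r; eapply exec_seq; [runs | rewrite /= -catA; exact: exec_drop | ].
by rewrite esize_pair /= /esize; lia.
Qed.

Lemma ptime_eq (A : eqType) (EA : Enc A) : ptime (fun p : A * A => p.1 == p.2).
Proof.
exists (Seq (Pop tM) Eqb), (fun p => 60 * esize p + 61); split.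
  by pbs; exact: pb_esize.
move=> [a b] r; eapply exec_seq; [runs | rewrite /= -catA | ].
  eapply exec_eq; [exact: exec_eqb | | exact: leqnn].
  rewrite /=; case: eqP => [e|ne].
    have [e1 _] := ser_inj (congr1 (cat^~ [::]) e).
    by rewrite (enc_inj e1) eqxx.
  by case: eqP => // e; case: ne; rewrite e.
by rewrite esize_pair /= /esize; lia.
Qed.

Section Closure2.
Variables (C : Type) (EC : Enc C) (mu : C -> nat).

Lemma computes_fst A B (EA : Enc A) (EB : Enc B) (f : C -> A * B) :
  computes mu f -> computes mu (fun c => (f c).1).
Proof. by move=> hf; apply: computes_comp hf; apply: ptime_fst. Qed.

Lemma computes_snd A B (EA : Enc A) (EB : Enc B) (f : C -> A * B) :
  computes mu f -> computes mu (fun c => (f c).2).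
Proof. by move=> hf; apply: computes_comp hf; apply: ptime_snd. Qed.

Lemma computes_comp2 A B D (EA : Enc A) (EB : Enc B) (ED : Enc D)
    (h : A -> B -> D) (f : C -> A) (g : C -> B) :
  ptime (fun p => h p.1 p.2) -> computes mu f -> computes mu g ->
  computes mu (fun c => h (f c) (g c)).
Proof.
by move=> hh hf hg; exact: (computes_comp hh (computes_pair hf hg)).
Qed.

Lemma computes_cons A (EA : Enc A) (f : C -> A) (g : C -> seq A) :
  computes mu f -> computes mu g -> computes mu (fun c => f c :: g c).
Proof. by apply: computes_comp2; apply: computes_cast. Qed.

End Closure2.

Ltac pt0 := cbv beta; first [assumption | lazymatch goal with
  | |- computes _ (fun c => c) => exact: computes_id
  | |- ptime (fun c => c) => exact: computes_id
  | |- computes _ (fun _ => ?n) => exact: computes_const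
  | |- computes _ (fun c => (@?f c, @?g c)) => refine (@computes_pair _ _ _ _ _ _ _ f g _ _); pt0
  | |- computes _ (fun c => (@?f c).1) => refine (@computes_fst _ _ _ _ _ _ _ f _); pt0
  | |- computes _ (fun c => (@?f c).2) => refine (@computes_snd _ _ _ _ _ _ _ f _); pt0
  | |- ptime _ => unfold ptime; pt0
  | |- _ => idtac end].

Section Closure3.
Variables (C : Type) (EC : Enc C) (mu : C -> nat).
Notation Y := (fun c => mu c + esize c).
Notation pbC := (pb Y).

(** A nonempty list has the code of the pair of its head and tail. Popping the tag of the pair of
    [l c] and c exposes the list for the test, and in the cons branch pushing the tag back gives a
    valid argument for [w]. *)
Lemma computes_case A B (EA : Enc A) (EB : Enc B) (l : C -> seq A) (z : C -> B)
    (g : C -> A -> seq A -> B) :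
  computes mu l -> computes mu z -> ptime (fun p => g p.1 p.2.1 p.2.2) ->
  computes mu (fun c => if l c is a :: l' then g c a l' else z c).
Proof.
move=> hl hz hg; have sl := computes_esize hl; have sC := pb_esize EC mu.
have [p [t [ht hp]]] : computes mu (fun c => (l c, c)) by pt0.
case: hz => q [u [hu hq]].
have [w [v [[k hv] hw]]] : ptime (fun p : (A * seq A) * C => g p.2 p.1.1 p.1.2).
  by apply: (computes_comp hg (f := fun p : (A * seq A) * C => (p.2, (p.1.1, p.1.2)))); pt0.
exists (seqs [:: p; Pop tM; If tM istrue (Seq (Push tM true) w) (Seq (Pop tM) q)]),
  (fun c => t c + (1 + (2 + (0 + (esize (l c) + esize c).+1).+2 ^ k + (1 + u c) + 2))).
split; first by pbs.
move=> c r; eapply exec_seq; [exact: hp | | exact: leqnn].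
eapply exec_seq; [runs | | exact: leqnn].
eapply exec_if; last exact: leqnn.
case e: (l c) => [|a l'] /=.
  by eapply exec_eq; [eapply exec_seq; [runs | exact: hq | exact: leqnn] | | lia].
eapply exec_eq; [eapply exec_seq; [runs | | exact: leqnn] | by [] | ].
  have := hw ((a, l'), c) r; rewrite /= -!catA; exact.
have := hv ((a, l'), c); rewrite !esize_pair /= esize_cons /=; lia.
Qed.

(** A polynomial-time step does not suffice, since an accumulator could double in every round; [S]
    bounds all accumulators that occur. During the loop the stack holds the rest of the list and
    below it the pair of context and accumulator. The tag of the enclosing pair is missing there, so
    the top letter tells whether the list is empty. *)
Lemma computes_foldl A B (EA : Enc A) (EB : Enc B) (l : C -> seq A) (z : C -> B)
    (g : C -> B -> A -> B) (S : C -> nat) :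
  ptime (fun p => g p.1 p.2.1 p.2.2) -> computes mu l -> computes mu z ->
  pbC S -> (forall c i, esize (foldl (g c) (z c) (take i (l c))) <= S c) ->
  computes mu (fun c => foldl (g c) (z c) (l c)).
Proof.
move=> hg hl hz hS leS; have sl := computes_esize hl; have sC := pb_esize EC mu.
have [p [t [ht hp]]] : computes mu (fun c => (l c, (c, z c))) by pt0.
have [w [v [[k hv] hw]]] : ptime (fun p : (A * seq A) * (C * B) =>
    (p.1.2, (p.2.1, g p.2.1 p.2.2 p.1.1))).
  pt0; apply: (computes_comp hg (f := fun p : (A * seq A) * (C * B) =>
    (p.2.1, (p.2.2, p.1.1)))); pt0.
have [q [u [[k' hu] hq]]] := ptime_snd EC EB.
pose T := fun c => (@esize _ (enc_seq EA) (l c) + @esize _ EC c + S c + 6) ^ k + 6.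
exists (seqs [:: p; Pop tM; While tM istrue (seqs [:: Push tM true; w; Pop tM]);
                 Pop tM; q]),
  (fun c => t c + (1 + (esize (l c) * T c + 1 + (1 + ((esize c + S c + 3) ^ k'))))).
split; first by rewrite /T; pbs.
move=> c r; eapply exec_seq; [exact: hp | | exact: leqnn].
eapply exec_seq; [runs | | exact: leqnn].
set W := While _ _ _.
have loop s b : esize s <= esize (l c) ->
    (forall i, esize (foldl (g c) b (take i s)) <= S c) ->
  exec W (st (ser (enc s) ++ ser (enc (c, b)) ++ r)) (esize s * T c + 1)
    (st (false :: ser (enc (c, foldl (g c) b s)) ++ r)).
  elim: s b => [|a s IH] b les leb.
    by eapply exec_eq; [exact: (@exec_whileF _ _ _ _ 1) | | lia].
  rewrite esize_cons in les.
  have {}IH : exec W (st (ser (enc s) ++ ser (enc (c, g c b a)) ++ r))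
    (esize s * T c + 1) (st (false :: ser (enc (c, foldl (g c) b (a :: s))) ++ r)).
    by apply: IH => [|i]; [lia | apply: (leb i.+1)].
  have {}hw := hw ((a, s), (c, b)) r; rewrite /= in hw.
  eapply exec_whileT; [by [] | | exact: IH | ].
    eapply exec_seq; [runs | | exact: leqnn].
    rewrite /= -!catA /= -!catA in hw.
    rewrite /= -!catA.
    by eapply exec_seq; [exact: hw | runs | exact: leqnn].
  have hb := leb 0; rewrite take0 /= in hb.
  have: v ((a, s), (c, b)) <= (esize (l c) + esize c + S c + 6) ^ k.
    apply: leq_trans (hv _) _; rewrite !esize_pair /=; case: (k) => // k0.
    by rewrite leq_exp2r //; lia.
  by rewrite esize_cons mulSn /T; have := esize_gt0 EA a; nia.
eapply exec_seq; [ | | exact: leqnn].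
  have := loop (l c) (z c) (leqnn _) (leS c); rewrite /= -!catA => {}loop.
  rewrite /= -!catA; exact: loop.
eapply exec_seq; [runs | | exact: leqnn].
have := hq (c, foldl (g c) (z c) (l c)) r; rewrite /= -!catA => {}hq.
eapply exec_eq; [exact: hq | by [] |].
have := leS c (size (l c)); rewrite take_size => hb.
apply: leq_trans (hu _) _; rewrite esize_pair /=; case: (k') => // k0.
by rewrite leq_exp2r //; lia.
Qed.

End Closure3.

Lemma esize_take A (EA : Enc A) i (s : seq A) : esize (take i s) <= esize s.
Proof.
elim: s i => [|x s IH] [|i] //=; rewrite !esize_cons.
by have := IH i; lia.
Qed.

Lemma esize_drop A (EA : Enc A) i (s : seq A) : esize (drop i s) <= esize s.
Proof.
elim: s i => [|x s IH] [|i] //=; rewrite !esize_cons; have := IH i; lia.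
Qed.

(** If the growth per step depends on the context and the letter but not on the accumulator, the
    accumulators are polynomial of themselves. Most loops below are of this kind. *)
Lemma computes_foldl_add C (EC : Enc C) mu A B (EA : Enc A) (EB : Enc B) (l : C -> seq A)
    (z : C -> B) (g : C -> B -> A -> B) (h : C * A -> nat) :
  ptime (fun p => g p.1 p.2.1 p.2.2) -> computes mu l -> computes mu z ->
  (forall c b a, esize (g c b a) <= esize b + h (c, a)) ->
  pb esize h ->
  computes mu (fun c => foldl (g c) (z c) (l c)).
Proof.
move=> hg hl hz hS [k hk]; have sl := computes_esize hl; have sz := computes_esize hz.
have sC := pb_esize EC mu.
apply: (computes_foldl hg hl hz
  (S := fun c => esize (z c) + esize (l c) * (esize c + esize (l c) + 3) ^ k)).
  by pbs.
move=> c i; set M := (_ + _ + 3) ^ k.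
have le_h a : esize a < esize (l c) -> h (c, a) <= M.
  move=> lt_a; apply: leq_trans (hk _) _; rewrite /M esize_pair; case: (k) => // k0.
  by rewrite leq_exp2r //=; lia.
have gen s b : esize s <= esize (l c) ->
  esize (foldl (g c) b s) <= esize b + size s * M.
  elim: s b => [|a s IH] b /=; first by lia.
  rewrite esize_cons => le_s; apply: leq_trans (IH _ _) _; first lia.
  have lt_a : esize a < esize (l c) by lia.
  by have := hS c b a; have := le_h a lt_a; rewrite mulSn; lia.
have le_t := esize_take EA i (l c).
apply: leq_trans (gen _ _ le_t) _; rewrite leq_add2l leq_mul2r.
by apply/orP; right; apply: leq_trans (ltnW (size_esize EA _)) le_t.
Qed.

Lemma computes_ext C B (EC : Enc C) (EB : Enc B) mu (f g : C -> B) :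
  f =1 g -> computes mu f -> computes mu g.
Proof.
by move=> e [p [t [ht hp]]]; exists p, t; split=> // c r; rewrite -e.
Qed.

Lemma ptime_ext C B (EC : Enc C) (EB : Enc B) (f g : C -> B) :
  f =1 g -> ptime f -> ptime g.
Proof. exact: computes_ext. Qed.

Lemma computes_comp3 C (EC : Enc C) (mu : C -> nat) A B D G (EA : Enc A) (EB : Enc B)
    (ED : Enc D) (EG : Enc G) (h : A -> B -> D -> G) (f : C -> A) (g : C -> B) (k : C -> D) :
  ptime (fun p => h p.1 p.2.1 p.2.2) -> computes mu f -> computes mu g ->
  computes mu k -> computes mu (fun c => h (f c) (g c) (k c)).
Proof.
move=> hh hf hg hk.
exact: (computes_comp hh (computes_pair hf (computes_pair hg hk))).
Qed.

(* Automation, arithmetic and list operations in polynomial time *)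
Create HintDb pt.

(** A hook for functions under binders, redefined once map, filter and the like are known to
    preserve polynomial time. *)
Ltac pt_closure := fail.
Ltac pt := cbv beta; first [assumption | lazymatch goal with
  | |- ptime _ => unfold ptime; pt
  | |- computes _ (fun c => c) => exact: computes_id
  | |- computes _ (fun _ => ?n) => exact: computes_const
  | |- computes _ (fun c => (@?f c, @?g c)) =>
      refine (@computes_pair _ _ _ _ _ _ _ f g _ _); pt
  | |- computes _ (fun c => (@?f c).1) => refine (@computes_fst _ _ _ _ _ _ _ f _); pt
  | |- computes _ (fun c => (@?f c).2) => refine (@computes_snd _ _ _ _ _ _ _ f _); pt
  | |- computes _ (fun c => @?f c :: @?g c) =>
      refine (@computes_cons _ _ _ _ _ f g _ _); pt
  | |- computes _ (fun c => if _ then _ else _) => apply computes_if; pt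
  | |- _ => first [progress pt_closure | match goal with
    | |- computes _ (fun c => ?h (@?f c) (@?g c) (@?k c)) =>
      refine (@computes_comp3 _ _ _ _ _ _ _ _ _ _ _ h f g k _ _ _ _);
        [solve [trivial with pt nocore] | pt | pt | pt]
    | |- computes _ (fun c => ?h (@?f c) (@?g c)) =>
      refine (@computes_comp2 _ _ _ _ _ _ _ _ _ h f g _ _ _);
        [solve [trivial with pt nocore] | pt | pt]
    | |- computes _ (fun c => ?h (@?f c)) =>
      refine (@computes_comp _ _ _ _ _ _ _ h f _ _);
        [solve [trivial with pt nocore] | pt]
    | |- computes _ ?h =>
      refine (@computes_comp _ _ _ _ _ _ _ h (fun c => c) _ _);
        [solve [trivial with pt nocore] | exact: computes_id]
    | |- _ => idtac end]
  end].

Lemma ptime_negb : ptime negb.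
Proof. by rewrite /negb; pt. Qed.
#[export] Hint Resolve ptime_fst ptime_snd ptime_negb : pt.

Lemma ptime_andb : ptime (fun p => andb p.1 p.2).
Proof. by apply: (computes_if (b := fun p => p.1) (f := fun p => p.2) (g := fun=> false)); pt. Qed.

Lemma ptime_orb : ptime (fun p => orb p.1 p.2).
Proof. by apply: (computes_if (b := fun p => p.1) (f := fun=> true) (g := fun p => p.2)); pt. Qed.

Lemma ptime_implb : ptime (fun p => implb p.1 p.2).
Proof. by apply: (computes_if (b := fun p => p.1) (f := fun p => p.2) (g := fun=> true)); pt. Qed.
#[export] Hint Resolve ptime_andb ptime_orb ptime_implb ptime_eq : pt.

(** In unary, the code of n + 1 is that of the pair of [tt] and n. *)
Lemma ptime_succ : ptime S.
Proof.
apply: (computes_comp (g := fun p : unit * nat => p.2.+1) (f := fun n => (tt, n))); last by pt.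
by apply: computes_cast; case; case.
Qed.
#[export] Hint Resolve ptime_succ : pt.

Lemma ptime_nseq_unit : ptime (fun p : nat * unit => nseq p.1 p.2).
Proof.
apply: (ptime_ext (f := fun p => nseq p.1 tt)) => [[n []] //|].
apply: (computes_comp (g := fun n => nseq n tt) (f := fun p => p.1)); last by pt.
exact: computes_cast.
Qed.

Lemma ptime_size_unit : ptime (@size unit).
Proof.
apply: computes_cast => s; rewrite -[in RHS](_ : nseq (size s) tt = s) //.
by elim: s => //= [[] s ->].
Qed.
#[export] Hint Resolve ptime_nseq_unit ptime_size_unit : pt.

Lemma ptime_behead A (EA : Enc A) : ptime (@behead A).
Proof.
by apply: (computes_case (l := fun c => c) (g := fun _ _ l' => l') (z := fun=> [::])); pt.
Qed.
#[export] Hint Resolve ptime_behead : pt.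

Lemma ptime_head A (EA : Enc A) : ptime (fun p => @head A p.1 p.2).
Proof.
by apply: (computes_case (l := fun c => c.2) (g := fun _ a _ => a) (z := fun c => c.1)); pt.
Qed.
#[export] Hint Resolve ptime_head : pt.

Lemma ptime_pred : ptime predn.
Proof.
apply: (ptime_ext (f := fun n => size (behead (nseq n tt)))); last by pt.
by case=> //= n; rewrite size_nseq.
Qed.
#[export] Hint Resolve ptime_pred : pt.

Lemma foldl_unit B (f : B -> B) z (s : seq unit) :
  foldl (fun b _ => f b) z s = iter (size s) f z.
Proof. by elim: s z => //= a s IH z; rewrite IH -iterSr. Qed.

Lemma computes_iter C (EC : Enc C) mu B (EB : Enc B) (n : C -> nat) (f : C -> B -> B)
    (z : C -> B) (S : C -> nat) :
  ptime (fun p => f p.1 p.2) -> computes mu n -> computes mu z ->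
  pb (fun c => mu c + esize c) S ->
  (forall c i, i <= n c -> esize (iter i (f c) (z c)) <= S c) ->
  computes mu (fun c => iter (n c) (f c) (z c)).
Proof.
move=> hf hn hz hS leS.
apply: (computes_ext (f := fun c => foldl (fun b (_ : unit) => f c b) (z c) (nseq (n c) tt))).
  by move=> c; rewrite foldl_unit size_nseq.
apply: (computes_foldl (S := S)) => //; try by pt.
move=> c i; rewrite foldl_unit size_take size_nseq; apply: leS.
by case: ltnP => // /ltnW.
Qed.

Lemma computes_iter_add C (EC : Enc C) mu B (EB : Enc B) (n : C -> nat) (f : C -> B -> B)
    (z : C -> B) (h : C -> nat) :
  ptime (fun p => f p.1 p.2) -> computes mu n -> computes mu z ->
  (forall c b, esize (f c b) <= esize b + h c) -> pb esize h ->
  computes mu (fun c => iter (n c) (f c) (z c)).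
Proof.
move=> hf hn hz hS hh.
apply: (computes_ext (f := fun c => foldl (fun b (_ : unit) => f c b) (z c) (nseq (n c) tt))).
  by move=> c; rewrite foldl_unit size_nseq.
apply: (computes_foldl_add (h := fun p => h p.1)) => //; try by pt.
case: hh => k hk; exists k => p; apply: leq_trans (hk _) _.
by case: k {hk} => // k; rewrite leq_exp2r // esize_pair; lia.
Qed.

Lemma ptime_addn : ptime (fun p => addn p.1 p.2).
Proof.
apply: (ptime_ext (f := fun p => iter p.1 (fun n => n.+1) p.2)) => [p|].
  by elim: p.1 => //= n ->.
apply: (computes_iter_add (f := fun _ n => n.+1) (h := fun=> 2)); try by pt.
  by move=> c b; rewrite !esize_nat; lia.
by pbs.
Qed.
#[export] Hint Resolve ptime_addn : pt.

Lemma ptime_subn : ptime (fun p => subn p.1 p.2).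
Proof.
apply: (ptime_ext (f := fun p => iter p.2 (fun n => n.-1) p.1)) => [p|].
  by elim: p.2 => /= [|n ->]; lia.
apply: (computes_iter_add (f := fun _ n => n.-1) (h := fun=> 0)); try by pt.
  by move=> c b; rewrite !esize_nat; lia.
by pbs.
Qed.
#[export] Hint Resolve ptime_subn : pt.

Lemma ptime_leq : ptime (fun p => leq p.1 p.2).
Proof. by rewrite /leq; pt. Qed.
#[export] Hint Resolve ptime_leq : pt.

Lemma ptime_muln : ptime (fun p => muln p.1 p.2).
Proof.
apply: (ptime_ext (f := fun p => iter p.1 (fun n => p.2 + n) 0)) => [p|].
  by elim: p.1 => //= n ->; lia.
apply: (computes_iter_add (f := fun p n => p.2 + n) (h := fun p => 2 * esize p)); try by pt.
  by move=> c b; rewrite esize_pair !esize_nat; lia.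
by pbs; exact: pb_Y.
Qed.
#[export] Hint Resolve ptime_muln : pt.

Lemma ptime_odd : ptime odd.
Proof.
apply: (ptime_ext (f := fun n => iter n (fun b => ~~ b) false)); first by elim=> //= n ->.
apply: (computes_iter_add (f := fun _ b => ~~ b) (h := fun=> 3)); try by pt.
  by move=> c [].
by pbs.
Qed.

Lemma ptime_half : ptime half.
Proof.
apply: (ptime_ext (f := fun n => (iter n (fun p => (~~ p.1, if p.1 then p.2.+1 else p.2))
   (false, 0)).2)).
  move=> n; suff -> : iter n (fun p => (~~ p.1, if p.1 then p.2.+1 else p.2)) (false, 0)
    = (odd n, n./2) by [].
  by elim: n => //= n ->; rewrite /= uphalf_half; case: odd.
pt; apply: (computes_iter_add (f := fun _ p => (~~ p.1, if p.1 then p.2.+1 else p.2))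
  (h := fun=> 5)); try by pt.
  move=> c [b n]; rewrite !esize_pair /=.
  by have := esize_bool (~~ b); have := esize_gt0 _ b; case: b; rewrite !esize_nat; lia.
by pbs.
Qed.
#[export] Hint Resolve ptime_odd ptime_half : pt.

Lemma ptime_catrev A (EA : Enc A) : ptime (fun p => @catrev A p.1 p.2).
Proof.
apply: (ptime_ext (f := fun p => foldl (fun s a => a :: s) p.2 p.1)).
  by case=> s t /=; elim: s t => //= a s IH t; rewrite IH.
apply: (computes_foldl_add (g := fun _ s a => a :: s) (h := fun p => (esize p.2).+1));
  try by pt.
  by move=> c s a; rewrite esize_cons /=; lia.
by pbs; apply: pb_le (pb_Y _) => p; rewrite esize_pair; lia.
Qed.
#[export] Hint Resolve ptime_catrev : pt.

Lemma ptime_rev A (EA : Enc A) : ptime (@rev A).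
Proof. by rewrite /rev; pt. Qed.
#[export] Hint Resolve ptime_rev : pt.

Lemma ptime_cat A (EA : Enc A) : ptime (fun p => @cat A p.1 p.2).
Proof.
apply: (ptime_ext (f := fun p => catrev (rev p.1) p.2)) => [p|]; last by pt.
by rewrite catrevE revK.
Qed.
#[export] Hint Resolve ptime_cat : pt.

Lemma ptime_rcons A (EA : Enc A) : ptime (fun p => @rcons A p.1 p.2).
Proof.
apply: (ptime_ext (f := fun p => p.1 ++ [:: p.2])) => [p|]; last by pt.
by rewrite cats1.
Qed.

Lemma ptime_drop A (EA : Enc A) : ptime (fun p => @drop A p.1 p.2).
Proof.
apply: (ptime_ext (f := fun p => iter p.1 (fun s => behead s) p.2)) => [[i s]|] /=.
  elim: i s => [|i IH] s; first by rewrite drop0.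
  by rewrite iterSr IH; case: s.
apply: (computes_iter_add (f := fun _ s => behead s) (h := fun=> 0)); try by pt.
  by move=> c s; rewrite -drop1 addn0 esize_drop.
by pbs.
Qed.
#[export] Hint Resolve ptime_rcons ptime_drop : pt.

Lemma ptime_size A (EA : Enc A) : ptime (@size A).
Proof.
apply: (ptime_ext (f := foldl (fun n _ => n.+1) 0)).
  move=> s; rewrite -[RHS]add0n; elim: s 0 => [|a s IH] n /=; first by rewrite addn0.
  by rewrite IH addSnnS.
apply: (computes_foldl_add (l := fun s => s) (g := fun _ n _ => n.+1) (h := fun=> 2));
  try by pt.
  by move=> c n a; rewrite !esize_nat; lia.
by pbs.
Qed.
#[export] Hint Resolve ptime_size : pt.

Lemma ptime_take A (EA : Enc A) : ptime (fun p => @take A p.1 p.2).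
Proof.
apply: (ptime_ext (f := fun p => rev (drop (size p.2 - p.1) (rev p.2)))) => [[i s]|];
  last by pt.
by rewrite /= -[in RHS](revK s) take_rev size_rev.
Qed.
#[export] Hint Resolve ptime_take : pt.

Lemma ptime_nth A (EA : Enc A) : ptime (fun p => @nth A p.1 p.2.1 p.2.2).
Proof.
apply: (ptime_ext (f := fun p => head p.1 (drop p.2.2 p.2.1))) => [[x [s i]]|] /=;
  last by pt.
by rewrite -nth0 nth_drop addn0.
Qed.
#[export] Hint Resolve ptime_nth : pt.

Lemma ptime_flatten A (EA : Enc A) : ptime (@flatten A).
Proof.
apply: (ptime_ext (f := foldl (fun s a => s ++ a) [::])).
  by move=> s; rewrite -[RHS]cat0s; elim: s [::] => [|a s IH] t /=;
    rewrite ?cats0 // IH catA.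
apply: (computes_foldl_add (l := fun s => s) (g := fun _ s a => s ++ a)
  (h := fun p => esize p.2)); try by pt.
  by move=> c s a; elim: s => [|x s IH] /=; rewrite ?esize_cons; try move: IH; rewrite /=; lia.
by pbs; apply: pb_le (pb_Y _) => p; rewrite esize_pair; lia.
Qed.
#[export] Hint Resolve ptime_flatten : pt.

Lemma ptime_zip A B (EA : Enc A) (EB : Enc B) : ptime (fun p => @zip A B p.1 p.2).
Proof.
pose g (st : seq (A * B) * seq B) a : seq (A * B) * seq B :=
  if st.2 is b :: t then ((a, b) :: st.1, t) else st.
apply: (ptime_ext (f := fun p => rev (foldl g ([::], p.2) p.1).1)).
  case=> s t /=.
  have e u : (foldl g (u, t) s).1 = catrev (zip s t) u.
    elim: s t u => [|a s IH] [|b t] u //=.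
      by rewrite {2}/g /=; elim: s {IH}.
    exact: IH.
  by rewrite e catrevE cats0 revK.
pt.
apply: (computes_foldl_add (g := fun _ => g) (h := fun p => (esize p.2).+2)); try by pt.
- by apply: (computes_case (l := fun p => p.2.1.2)
   (g := fun p b t => ((p.2.2, b) :: p.2.1.1, t)) (z := fun p => p.2.1)); pt.
- move=> c [s [|b t]] a; rewrite /g ?esize_pair /= ?esize_cons ?esize_pair /=; lia.
by pbs; apply: pb_le (pb_Y _) => p; rewrite esize_pair; lia.
Qed.
#[export] Hint Resolve ptime_zip : pt.

Section Closures.
Variables (C : Type) (EC : Enc C) (mu : C -> nat).
Variables (A B : Type) (EA : Enc A) (EB : Enc B).

Lemma computes_map (f : C -> A -> B) (l : C -> seq A) :
  ptime (fun p => f p.1 p.2) -> computes mu l -> computes mu (fun c => map (f c) (l c)).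
Proof.
move=> hf hl; have hs := computes_esize hf.
apply: (computes_ext (f := fun c => rev (foldl (fun s a => f c a :: s) [::] (l c)))).
  move=> c; rewrite (_ : foldl _ _ _ = catrev (map (f c) (l c)) [::]); last first.
    by elim: (l c) [::] => //= a s IH t; rewrite IH.
  by rewrite catrevE cats0 revK.
pt; apply: (computes_foldl_add (g := fun c s a => f c a :: s)
  (h := fun p => (esize (f p.1 p.2)).+1)); try by pt.
  by move=> c s a; rewrite esize_cons /=; lia.
by apply: pb_S hs.
Qed.

Lemma computes_filter (f : C -> A -> bool) (l : C -> seq A) :
  ptime (fun p => f p.1 p.2) -> computes mu l ->
  computes mu (fun c => filter (f c) (l c)).
Proof.
move=> hf hl.
apply: (computes_ext (f := fun c => rev (foldl (fun s a => if f c a then a :: s else s)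
  [::] (l c)))).
  move=> c; rewrite (_ : foldl _ _ _ = catrev (filter (f c) (l c)) [::]); last first.
    by elim: (l c) [::] => //= a s IH t; rewrite IH; case: (f c a).
  by rewrite catrevE cats0 revK.
pt; apply: (computes_foldl_add (g := fun c s a => if f c a then a :: s else s)
  (h := fun p => (esize p.2).+1)); try by pt.
  by move=> c s a; case: (f c a); rewrite ?esize_cons /=; lia.
by apply: pb_S; apply: pb_le (pb_Y _) => p; rewrite esize_pair; lia.
Qed.

Lemma computes_has (f : C -> A -> bool) (l : C -> seq A) :
  ptime (fun p => f p.1 p.2) -> computes mu l -> computes mu (fun c => has (f c) (l c)).
Proof.
move=> hf hl.
apply: (computes_ext (f := fun c => foldl (fun b a => b || f c a) false (l c))).
  move=> c; rewrite -[RHS]orFb; elim: (l c) false => [|a s IH] b /=; first by rewrite orbF.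
  by rewrite IH orbA.
apply: (computes_foldl_add (g := fun c b a => b || f c a) (h := fun p => 3)); try by pt.
  by move=> c s a; have := esize_bool (s || f c a); lia.
exact: pb_const.
Qed.

Lemma computes_all (f : C -> A -> bool) (l : C -> seq A) :
  ptime (fun p => f p.1 p.2) -> computes mu l -> computes mu (fun c => all (f c) (l c)).
Proof.
move=> hf hl.
apply: (computes_ext (f := fun c => ~~ has (fun a => ~~ f c a) (l c))).
  by move=> c; rewrite -all_predC; apply: eq_all => a /=; rewrite negbK.
apply: computes_comp; first exact: ptime_negb.
by apply: (computes_has (f := fun c a => ~~ f c a)); pt.
Qed.

Lemma computes_count (f : C -> A -> bool) (l : C -> seq A) :
  ptime (fun p => f p.1 p.2) -> computes mu l -> computes mu (fun c => count (f c) (l c)).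
Proof.
move=> hf hl; apply: (computes_ext (f := fun c => size (filter (f c) (l c)))).
  by move=> c; rewrite size_filter.
by apply: computes_comp; [apply: ptime_size | apply: computes_filter].
Qed.

End Closures.

Lemma esize_seq_le (s : seq nat) b : (forall x, x \in s -> x <= b) ->
  esize s <= size s * (2 * b + 2) + 1.
Proof.
elim: s => // x s IH le_s; rewrite esize_cons esize_nat /= mulSn.
have := le_s x (mem_head _ _); have: esize s <= size s * (2 * b + 2) + 1.
  by apply: IH => y ys; apply: le_s; rewrite inE ys orbT.
lia.
Qed.

Lemma ptime_iota : ptime (fun p => iota p.1 p.2).
Proof.
have e m n : iter n (fun st : nat * seq nat => (st.1.+1, st.1 :: st.2)) (m, [::])
    = (m + n, rev (iota m n)).
  elim: n => [|n IH]; first by rewrite addn0.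
  have -> : iota m n.+1 = iota m n ++ [:: m + n] by rewrite -addn1 iotaD.
  by rewrite iterS IH /= rev_cat addnS.
apply: (ptime_ext (f := fun p => rev (iter p.2 (fun st => (st.1.+1, st.1 :: st.2))
  (p.1, [::])).2)) => [[m n]|] /=; first by rewrite e revK.
pt; apply: (computes_iter (f := fun _ st => (st.1.+1, st.1 :: st.2))
  (S := fun p => 2 * esize p + 1 + (esize p * (2 * esize p + 2) + 1))); try by pt.
  by pbs; exact: pb_Y.
move=> [m n] i /= le_i; rewrite e !esize_pair /=.
have: esize (rev (iota m i)) <= i * (2 * (m + i) + 2) + 1.
  rewrite -{2}(size_iota m i) -size_rev; apply: esize_seq_le => x.
  by rewrite mem_rev mem_iota; lia.
by rewrite !esize_nat; nia.
Qed.
#[export] Hint Resolve ptime_iota : pt.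

Lemma computes_expn C (EC : Enc C) mu (f : C -> nat) k :
  computes mu f -> computes mu (fun c => f c ^ k).
Proof.
move=> hf; elim: k => [|k IH]; first exact: computes_const.
by apply: (computes_ext (f := fun c => f c * f c ^ k)) => [c|]; rewrite ?expnS //; pt.
Qed.

(* The doubly exponential time is spent here. *)
Lemma computes_pow2 C (EC : Enc C) mu (f : C -> nat) :
  computes mu f -> (forall c, 2 ^ f c <= mu c) -> computes mu (fun c => 2 ^ f c).
Proof.
move=> hf le_mu.
apply: (computes_ext (f := fun c => iter (f c) (fun n => n + n) 1)) => [c|].
  by elim: (f c) => //= n ->; rewrite expnS mul2n addnn.
apply: (computes_iter (f := fun _ n => n + n) (S := fun c => 2 * mu c + 1));
  try by pt.
  by pbs; exact: pb_mu.
move=> c i le_i; rewrite esize_nat.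
have -> : iter i (fun n => n + n) 1 = 2 ^ i.
  by elim: i {le_i} => //= n ->; rewrite expnS mul2n addnn.
by have := leq_trans (leq_pexp2l (isT : 0 < 2) le_i) (le_mu c); lia.
Qed.

Ltac pt_closure ::= lazymatch goal with
  | |- computes _ (fun c => map (fun x => @?f c x) (@?l c)) =>
      refine (@computes_map _ _ _ _ _ _ _ f l _ _); pt
  | |- computes _ (fun c => filter (fun x => @?f c x) (@?l c)) =>
      refine (@computes_filter _ _ _ _ _ f l _ _); pt
  | |- computes _ (fun c => has (fun x => @?f c x) (@?l c)) =>
      refine (@computes_has _ _ _ _ _ f l _ _); pt
  | |- computes _ (fun c => all (fun x => @?f c x) (@?l c)) =>
      refine (@computes_all _ _ _ _ _ f l _ _); pt
  | |- computes _ (fun c => count (fun x => @?f c x) (@?l c)) =>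
      refine (@computes_count _ _ _ _ _ f l _ _); pt
  | |- computes _ (fun c => @?f c ^ ?k) => refine (@computes_expn _ _ _ f k _); pt
  end.

(** * The algorithm *)

Lemma ptime_nseq A (EA : Enc A) : ptime (fun p => @nseq A p.1 p.2).
Proof.
apply: (ptime_ext (f := fun p => map (fun _ => p.2) (iota 0 p.1))); last by pt.
by case=> n x /=; elim: n 0 => //= n IH m; rewrite IH.
Qed.
#[export] Hint Resolve ptime_nseq : pt.

(** The input arrives reversed, since [Load] pushes it letter by letter onto a list. A reversed
    number is a zero followed by its ones, so a zero opens a new number and a one increments the
    current one. *)
Definition decode (r : seq bool) : seq nat :=
  foldl (fun out (b : bool) => if b then (head 0 out).+1 :: behead out else 0 :: out)
    [::] r.

Lemma esize_cat A (EA : Enc A) (s t : seq A) : esize (s ++ t) <= esize s + esize t.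
Proof. by elim: s => [|x s IH] /=; rewrite ?esize_cons; lia. Qed.

Lemma ptime_decode : ptime decode.
Proof.
apply: (computes_foldl_add (l := fun r => r) (g := fun _ out (b : bool) =>
  if b then (head 0 out).+1 :: behead out else 0 :: out) (h := fun=> 4)); try by pt.
  by move=> _ [|x s] []; rewrite !esize_cons /= ?esize_nil !esize_nat; lia.
by pbs.
Qed.
#[export] Hint Resolve ptime_decode : pt.

Lemma ptime_bits : ptime bits.
Proof. by rewrite /bits; pt. Qed.
#[export] Hint Resolve ptime_bits : pt.

(** Pieces come out last first. In the uses below neither pieces nor rests are longer than the word
    they are cut from, which keeps the loop polynomial. *)
Definition unfold (x y : seq nat -> seq nat) (n : nat) (s : seq nat) :=
  iter n (fun st : seq (seq nat) * seq nat => (x st.2 :: st.1, y st.2)) ([::], s).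

Lemma esize_unfold x y (s : seq nat) i :
  (forall s, esize (x s) <= esize s) -> (forall s, esize (y s) <= esize s) ->
  esize (unfold x y i s).1 <= i * (esize s).+1 + 1
  /\ esize (unfold x y i s).2 <= esize s.
Proof.
move=> lex ley; elim: i => //= i [IH1 IH2]; rewrite -/(unfold x y i s) esize_cons.
have := lex (unfold x y i s).2; have := ley (unfold x y i s).2.
by rewrite mulSn; lia.
Qed.

Lemma ptime_unfold x y : ptime x -> ptime y ->
  (forall s, esize (x s) <= esize s) -> (forall s, esize (y s) <= esize s) ->
  ptime (fun p => unfold x y p.1 p.2).
Proof.
move=> hx hy lex ley.
apply: (computes_iter (f := fun _ st => (x st.2 :: st.1, y st.2))
  (S := fun p => (esize p.1 * (esize p.2).+1 + 2 + esize p.2))); try by pt.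
  by pbs; apply: pb_le (pb_Y _) => p; rewrite esize_pair; lia.
move=> [n s] i /= le_i.
have [e1 e2] := esize_unfold s i lex ley.
by move: e1 e2; rewrite /unfold esize_pair esize_nat; nia.
Qed.

Section Algorithm.
Variables (arsR arsX : seq nat) (k k' amax : nat).

Definition skip_rels (v ars : seq nat) : seq nat :=
  foldl (fun v ar => drop (head 0 v * ar).+1 v) v ars.

Lemma ptime_skip_rels : ptime (fun p => skip_rels p.1 p.2).
Proof.
apply: (computes_foldl_add (g := fun _ v ar => drop (head 0 v * ar).+1 v) (h := fun=> 0));
  try by pt.
  by move=> c v ar; rewrite addn0 esize_drop.
by pbs.
Qed.
#[local] Hint Resolve ptime_skip_rels : pt.

Definition struct_len (v : seq nat) : nat :=
  size v - size (skip_rels (behead v) arsR).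

(* Trees are kept in the prefix notation of the input, where the tags are 0 for   *)
(* nonterminals, 1 and 2 for atoms, 3 for negation, 4 to 7 for quantifiers, and   *)
(* 8 and 9 for connectives.                                                       *)
Definition tok_len (v : seq nat) : nat :=
  if head 0 v == 0 then 2
  else if head 0 v == 1 then (nth 0 arsR (nth 0 v 1)).+2
  else if head 0 v == 2 then (nth 0 arsX (nth 0 v 1)).+2
  else if (head 0 v == 3) || (8 <= head 0 v) then 1 else 2.

Definition tok_ar (v : seq nat) : nat :=
  if head 0 v <= 2 then 0 else if head 0 v <= 7 then 1 else 2.

Lemma ptime_struct_len : ptime struct_len.
Proof. by rewrite /struct_len; pt. Qed.

Lemma ptime_tok_len : ptime tok_len.
Proof. by rewrite /tok_len; pt. Qed.

Lemma ptime_tok_ar : ptime tok_ar.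
Proof. by rewrite /tok_ar; pt. Qed.
#[local] Hint Resolve ptime_struct_len ptime_tok_len ptime_tok_ar : pt.

(* The state is the number of trees still to be read and the number of letters read. *)
Definition skip_tok (v : seq nat) (st : nat * nat) : nat * nat :=
  if st.1 == 0 then st
  else (st.1.-1 + tok_ar (drop st.2 v), st.2 + tok_len (drop st.2 v)).

(** Every token has at least one letter, so [size v] rounds reach the end of the first tree; further
    rounds change nothing, as no tree is left to read. *)
Definition tree_len (v : seq nat) : nat := (iter (size v) (skip_tok v) (1, 0)).2.

Lemma leq_nth_esize (s : seq nat) i : nth 0 s i <= esize s.
Proof.
elim: s i => [|x s IH] [|i] //=; rewrite esize_cons ?esize_nat; first lia.
by have := IH i; lia.
Qed.

Lemma ptime_tree_len : ptime tree_len.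
Proof.
rewrite /tree_len; pt.
apply: (computes_iter_add (f := skip_tok)
  (h := fun=> 2 * (esize arsR + esize arsX + 4) + 4)); try by rewrite /skip_tok; pt.
  move=> v [a b]; rewrite /skip_tok; case: ifP => [_|]; first lia.
  have hr := leq_nth_esize arsR (nth 0 (drop b v) 1).
  have hx := leq_nth_esize arsX (nth 0 (drop b v) 1).
  rewrite !esize_pair !esize_nat /=.
  have : tok_ar (drop b v) <= 2 by rewrite /tok_ar; do ?case: ifP.
  have : tok_len (drop b v) <= esize arsR + esize arsX + 2.
    by rewrite /tok_len; do ?(case: ifP => _); lia.
  lia.
by pbs.
Qed.
#[local] Hint Resolve ptime_tree_len : pt.

Definition parse_list (len : seq nat -> nat) (v : seq nat) :=
  unfold (fun v => take (len v) v) (fun v => drop (len v) v) (head 0 v) (behead v).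

Lemma ptime_parse_list len : ptime len -> ptime (parse_list len).
Proof.
move=> hlen; have hu : ptime (fun p =>
  unfold (fun v => take (len v) v) (fun v => drop (len v) v) p.1 p.2).
  apply: ptime_unfold; try by pt.
  - by move=> s; apply: esize_take.
  - by move=> s; apply: esize_drop.
by rewrite /parse_list; pt.
Qed.

Definition rule_len (v : seq nat) := (tree_len (behead v)).+1.

(** Dropping one token brings the next subtree to the front, so all subtrees are cut off in turn.
    The remaining rounds see the empty word, and their results are filtered out. *)
Definition subs (u : seq nat) : seq (seq nat) :=
  filter (fun s => 0 < size s) (unfold (fun v => take (tree_len v) v)
    (fun v => drop (tok_len v) v) (size u) u).1.

Lemma ptime_subs : ptime subs.
Proof.
have hu : ptime (fun p =>
  unfold (fun v => take (tree_len v) v) (fun v => drop (tok_len v) v) p.1 p.2).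
  apply: ptime_unfold; try by pt.
  - by move=> s; apply: esize_take.
  - by move=> s; apply: esize_drop.
by rewrite /subs; pt.
Qed.
#[local] Hint Resolve ptime_subs : pt.

Definition bit (e j : nat) := odd (iter j half e).

Lemma ptime_bit : ptime (fun p => bit p.1 p.2).
Proof.
rewrite /bit; pt.
apply: (computes_iter_add (f := fun _ n => half n) (h := fun=> 0)); try by pt.
  by move=> c n; rewrite !esize_nat; lia.
by pbs.
Qed.
#[local] Hint Resolve ptime_bit : pt.

(** The numeral with digits [t] in base [d], lowest digit first; it numbers the tuples over a domain
    of [d] elements. *)
Fixpoint rank (n d : nat) (t : seq nat) : nat :=
  if n is n'.+1 then head 0 t + d * rank n' d (behead t) else 0.

Lemma ptime_rank n : ptime (fun p => rank n p.1 p.2).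
Proof. by elim: n => [|n IH] /=; pt. Qed.
#[local] Hint Resolve ptime_rank : pt.

Definition seg_mem (ar : nat) (seg t : seq nat) : bool :=
  has (fun i => take ar (drop (i * ar).+1 seg) == t) (iota 0 (head 0 seg)).

Definition inrel (a : seq nat) (r : nat) (t : seq nat) : bool :=
  seg_mem (nth 0 arsR r) (skip_rels (behead a) (take r arsR)) t.

Lemma ptime_inrel : ptime (fun p => inrel p.1 p.2.1 p.2.2).
Proof. by rewrite /inrel /seg_mem; pt. Qed.
#[local] Hint Resolve ptime_inrel : pt.

(* Block length L, number of bits of an environment, all environments, indexed    *)
(* structures, rules, and trees occurring in rules.                               *)
Definition params : Type :=
  nat * nat * seq nat * seq (nat * seq nat) * seq (seq nat) * seq (seq nat).
Notation pL p := p.1.1.1.1.1 (only parsing).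
Notation pm p := p.1.1.1.1.2 (only parsing).
Notation pE p := p.1.1.1.2 (only parsing).
Notation pS p := p.1.1.2 (only parsing).
Notation pR p := p.1.2 (only parsing).
Notation pT p := p.2 (only parsing).

(* An environment over a structure with domain {0, ..., d} is a number e, read as *)
(* k + k' blocks of L bits.  The value of a first-order variable is the number of *)
(* ones among the first d bits of its block; a second-order variable contains the *)
(* tuples whose rank is the position of a one in its block.                       *)
Definition foval (p : params) (a : seq nat) (e x : nat) : nat :=
  count (fun j => bit e (x * pL p + j)) (iota 0 (head 0 a).-1).

(** Equality of bits outside block [v]: the environments so related to a given one are those that
    differ from it at most in one variable, which is what a quantifier ranges over. *)
Definition agree (p : params) (v e e' : nat) : bool :=
  all (fun j => ((v * pL p <= j) && (j < v * pL p + pL p)) || (bit e j == bit e' j))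
    (iota 0 (pm p)).

Definition qvar (u : seq nat) : nat :=
  if head 0 u <= 5 then nth 0 u 1 else k + nth 0 u 1.

Lemma ptime_qvar : ptime qvar.
Proof. by rewrite /qvar; pt. Qed.
#[local] Hint Resolve ptime_qvar : pt.

(** A nonterminal stands for a formula generated by the right-hand side of one of its rules, so the
    tag 0 copies the truth value. *)
Definition newbit (p : params) (u a : seq nat) (r1 r2 : seq bool) (e : nat) : bool :=
  if head 0 u == 0 then nth false r1 e
  else if head 0 u == 1 then inrel a (nth 0 u 1) (map (fun x => foval p a e x) (drop 2 u))
  else if head 0 u == 2 then
    bit e ((k + nth 0 u 1) * pL p
           + rank amax (head 0 a) (map (fun x => foval p a e x) (drop 2 u)))
  else if head 0 u == 3 then ~~ nth false r1 e
  else if (head 0 u == 4) || (head 0 u == 6) then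
    has (fun e' => agree p (qvar u) e e' && nth false r1 e') (pE p)
  else if (head 0 u == 5) || (head 0 u == 7) then
    all (fun e' => agree p (qvar u) e e' ==> nth false r1 e') (pE p)
  else if head 0 u == 8 then nth false r1 e && nth false r2 e
  else nth false r1 e || nth false r2 e.

Definition newval (p : params) (u : seq nat) (v1 v2 : seq (seq bool)) : seq (seq bool) :=
  map (fun ia => map (fun e => newbit p u ia.2 (nth [::] v1 ia.1) (nth [::] v2 ia.1) e)
                     (pE p)) (pS p).

Definition newfv (u : seq nat) (f1 f2 : seq bool) : seq bool :=
  map (fun j =>
    if head 0 u == 1 then has (fun y => y == j) (drop 2 u)
    else if head 0 u == 2 then has (fun y => y == j) (drop 2 u) || (j == k + nth 0 u 1)
    else if head 0 u <= 3 then nth false f1 j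
    else if head 0 u <= 7 then (j != qvar u) && nth false f1 j
    else nth false f1 j || nth false f2 j) (iota 0 (k + k')).

(** The entry of a nonterminal repeats the node of the formula it stands for. Thus every entry
    contributes one node, and positions in the table are positions in the DAG. *)
Definition newnode (u : seq nat) (i1 i2 : nat) (c1 : seq nat) : seq nat :=
  if head 0 u == 0 then c1
  else if head 0 u <= 2 then u
  else if head 0 u <= 7 then take (tok_len u) u ++ [:: i1]
  else take (tok_len u) u ++ [:: i1; i2].

(** The first component is the key, a tree with a meaning; the second is the coded DAG node of one
    formula with that meaning. *)
Definition entry : Type := (seq nat * (seq (seq bool) * seq bool)) * seq nat.
Notation tree_of en := en.1.1 (only parsing).
Notation val_of en := en.1.2.1 (only parsing).
Notation fv_of en := en.1.2.2 (only parsing).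
Notation node_of en := en.2 (only parsing).

(** Codes of trees are nonempty, so this entry is never mistaken for a child. *)
Definition dummy : entry := (([::], ([::], [::])), [::]).

Definition indexed (T : seq entry) : seq (nat * entry) := zip (iota 0 (size T)) T.

(* A tree of the grammar with indexed entries for its children; the dummy entry *)
(* stands for missing children.                                                *)
Definition cand : Type := (seq nat * ((nat * entry) * (nat * entry)))%type.

Definition applicable (p : params) (x : cand) : bool :=
  if head 0 x.1 == 0 then has (fun r => r == nth 0 x.1 1 :: tree_of x.2.1.2) (pR p)
  else if head 0 x.1 <= 2 then true
  else if head 0 x.1 <= 7 then tree_of x.2.1.2 == drop (tok_len x.1) x.1
  else (tree_of x.2.1.2 == take (tree_len (behead x.1)) (behead x.1))
       && (tree_of x.2.2.2 == drop (tree_len (behead x.1)) (behead x.1)).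

Definition mk (p : params) (x : cand) : entry :=
  ((x.1, (newval p x.1 (val_of x.2.1.2) (val_of x.2.2.2),
          newfv x.1 (fv_of x.2.1.2) (fv_of x.2.2.2))),
   newnode x.1 x.2.1.1 x.2.2.1 (node_of x.2.1.2)).

Definition cands (p : params) (T : seq entry) : seq cand :=
  flatten (map (fun u => flatten (map (fun i1 => map (fun i2 => (u, (i1, i2)))
    ((0, dummy) :: indexed T)) ((0, dummy) :: indexed T))) (pT p)).

Definition news (p : params) (T : seq entry) : seq cand :=
  filter (fun x => applicable p x
    && ~~ has (fun en : entry => en.1 == (mk p x).1) T) (cands p T).

(** Only one entry is added per round: before saturation the size of the table is the number of
    rounds. *)
Definition extend (p : params) (T : seq entry) : seq entry :=
  if news p T is x :: _ then rcons T (mk p x) else T.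

Lemma ptime_newval : ptime (fun x : params * (seq nat * (seq (seq bool) * seq (seq bool))) =>
  newval x.1 x.2.1 x.2.2.1 x.2.2.2).
Proof. by rewrite /newval /newbit /foval /agree; pt. Qed.

Lemma ptime_newfv : ptime (fun x => newfv x.1 x.2.1 x.2.2).
Proof. by rewrite /newfv; pt. Qed.
#[local] Hint Resolve ptime_newfv : pt.

Lemma ptime_mk : ptime (fun y => mk y.1 y.2).
Proof.
rewrite /mk /newnode; pt.
apply: (computes_comp (f := fun y : params * cand =>
  (y.1, (y.2.1, (val_of y.2.2.1.2, val_of y.2.2.2.2)))) ptime_newval); pt.
Qed.
#[local] Hint Resolve ptime_mk : pt.

Lemma ptime_applicable : ptime (fun y => applicable y.1 y.2).
Proof. by rewrite /applicable; pt. Qed.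
#[local] Hint Resolve ptime_applicable : pt.

Lemma ptime_indexed : ptime indexed.
Proof. by rewrite /indexed; pt. Qed.
#[local] Hint Resolve ptime_indexed : pt.

Lemma ptime_news : ptime (fun y => news y.1 y.2).
Proof. by rewrite /news /cands; pt. Qed.
#[local] Hint Resolve ptime_news : pt.

Lemma ptime_extend : ptime (fun y => extend y.1 y.2).
Proof.
by apply: (computes_case (l := fun y => news y.1 y.2) (z := fun y => y.2)
  (g := fun y x _ => rcons y.2 (mk y.1 x))); pt.
Qed.
#[local] Hint Resolve ptime_extend : pt.

Definition saturate (p : params) (n : nat) : seq entry := iter n (extend p) [::].

Lemma mem_esize (A : eqType) (EA : Enc A) (s : seq A) a : a \in s -> esize a < esize s.
Proof.
elim: s => //= b s IH; rewrite inE esize_cons => /orP[/eqP->|/IH]; lia.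
Qed.

Lemma esize_map_le A B (EB : Enc B) (f : A -> B) s b :
  (forall a, esize (f a) <= b) -> esize (map f s) <= size s * b.+1 + 1.
Proof.
by move=> le_b; elim: s => //= a s IH; rewrite esize_cons mulSn; have := le_b a; lia.
Qed.

Lemma esize_seq_mem (A : eqType) (EA : Enc A) (s : seq A) b :
  (forall a, a \in s -> esize a <= b) -> esize s <= size s * b.+1 + 1.
Proof.
elim: s => //= a s IH le_b; rewrite esize_cons mulSn.
have := le_b a (mem_head _ _).
have := IH (fun x xs => le_b x (mem_behead (s := a :: s) xs)).
by move=> /=; lia.
Qed.

Lemma mem_cands (p : params) T (x : cand) : x \in cands p T ->
  [/\ x.1 \in pT p, x.2.1 \in (0, dummy) :: indexed T & x.2.2 \in (0, dummy) :: indexed T].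
Proof.
case/flattenP=> s /mapP[u up ->] /flattenP[s' /mapP[i1 i1T ->]] /mapP[i2 i2T ->].
by split.
Qed.

Lemma mem_indexed T i en : (i, en) \in indexed T -> i < size T /\ en = nth dummy T i.
Proof.
move=> /(nthP (0, dummy))[j]; rewrite size_zip size_iota minnn => lt_j.
by rewrite nth_zip ?size_iota // nth_iota // => -[<- <-].
Qed.

Lemma mem_indexed0 T i en : (i, en) \in (0, dummy) :: indexed T ->
  i <= size T /\ (en = dummy \/ en \in T).
Proof.
rewrite inE => /orP[/eqP[-> ->]|/mem_indexed[lt_i ->]]; first by split=> //; left.
by split; [exact: ltnW | right; apply: mem_nth].
Qed.

(** The shape of a meaning is fixed by the parameters, whatever the children are, so keys do not
    grow from round to round. *)
Lemma esize_mk1 (p : params) (x : cand) : x.1 \in pT p ->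
  esize (mk p x).1 <= esize p + (esize p * (esize p * 4 + 2) + 1) + ((k + k') * 4 + 1) + 2.
Proof.
move=> xp; rewrite /mk [X in X <= _]esize_pair /= [X in _ + X]esize_pair /=.
have le_u : esize x.1 <= esize p.
  apply: leq_trans (ltnW (mem_esize (enc_seq enc_nat) xp)) _.
  by rewrite [esize p]esize_pair leqW // leq_addl.
have le_E : size (pE p) <= esize p.
  by have := size_esize enc_nat (pE p); rewrite !esize_pair; lia.
have le_S : size (pS p) <= esize p.
  by have := size_esize (enc_prod enc_nat (enc_seq enc_nat)) (pS p); rewrite !esize_pair; lia.
have le_v : esize (newval p x.1 (val_of x.2.1.2) (val_of x.2.2.2))
    <= esize p * (esize p * 4 + 2) + 1.
  rewrite /newval.
  apply: (leq_trans (@esize_map_le _ _ (enc_seq enc_bool) _ _ (size (pE p) * 4 + 1) _)).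
    move=> ia; apply: (leq_trans (@esize_map_le _ _ enc_bool _ _ 3 _)) => // e.
    exact: esize_bool.
  by rewrite leq_add2r leq_mul //; lia.
have le_f : esize (newfv x.1 (fv_of x.2.1.2) (fv_of x.2.2.2)) <= (k + k') * 4 + 1.
  apply: (leq_trans (@esize_map_le _ _ enc_bool _ _ 3 _)); last by rewrite size_iota.
  by move=> j; apply: esize_bool.
move: le_u le_v le_f; rewrite /=; lia.
Qed.

Let Z1 (x : params * nat) : nat :=
  esize x.1 + (esize x.1 * (esize x.1 * 4 + 2) + 1) + ((k + k') * 4 + 1) + 2.
Let Z2 (x : params * nat) : nat := esize x.1 + 4 * x.2 + 10.

Lemma saturate_bound (p : params) n i : i <= n -> size (saturate p i) <= i /\
  (forall en, en \in saturate p i -> esize en.1 <= Z1 (p, n) /\ esize en.2 <= Z2 (p, n)).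
Proof.
  elim: i => [|i IH] lt_i //; have [sT zT] := IH (ltnW lt_i).
  rewrite /saturate iterS -/(saturate p i) /extend.
  case e: (news p (saturate p i)) => [|x s]; first by split=> //; lia.
  split=> [|en]; first by rewrite size_rcons.
  rewrite mem_rcons inE => /orP[/eqP->|/zT //].
  have : x \in news p (saturate p i) by rewrite e mem_head.
  rewrite mem_filter => /andP[_ /mem_cands[xp x1 x2]].
  split; first exact: esize_mk1.
  case: x x1 x2 xp {e} => u [[i1 en1] [i2 en2]] /= /mem_indexed0[le1 T1] /mem_indexed0[le2 T2] up.
  have le_u : esize u <= esize p.
    apply: leq_trans (ltnW (mem_esize (enc_seq enc_nat) up)) _.
    by rewrite [esize p]esize_pair leqW // leq_addl.
  rewrite /newnode; case: ifP => _.
    by case: T1 => [->|/zT[_]] //=; rewrite /Z2 esize_nil; lia.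
  case: ifP => _; first by rewrite /Z2 /=; lia.
  have le_t := esize_take enc_nat (tok_len u) u.
  case: ifP => _; apply: leq_trans (esize_cat enc_nat _ _) _;
    rewrite !esize_cons esize_nil ?esize_nat /Z2 /=; move: le_t le_u; rewrite /=; lia.
Qed.

Lemma ptime_saturate : ptime (fun x => saturate x.1 x.2).
Proof.
apply: (computes_iter (f := fun x T => extend x.1 T)
  (S := fun x => x.2 * (Z1 x + Z2 x + 2) + 1)); try by pt.
  have h1 : pb (fun c => 0 + esize c) (fun x : params * nat => esize x.1).
    by apply: pb_le (pb_Y _) => x; rewrite esize_pair; lia.
  have h2 : pb (fun c => 0 + esize c) (fun x : params * nat => x.2).
    by apply: pb_le (pb_Y _) => x; rewrite esize_pair esize_nat; lia.
  by rewrite /Z1 /Z2; pbs.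
move=> [p n] i /= le_i; have [sT zT] := saturate_bound p le_i.
apply: (leq_trans (@esize_seq_mem _ (enc_prod _ _) _ (Z1 (p, n) + Z2 (p, n) + 1) _)).
  by move=> en /zT[z1 z2]; rewrite esize_pair addn1 ltnS; exact: leq_add.
rewrite leq_add2r; apply: leq_mul; first exact: leq_trans sT le_i.
by rewrite addn1 addn2.
Qed.
#[local] Hint Resolve ptime_saturate : pt.

(** The first [np] structures are the positive ones. A structure is a model if all environments
    satisfy the formula, so a negative one needs some false entry in its row. *)
Definition good (p : params) (np ax : nat) (en : entry) : bool :=
  [&& has (fun r => r == ax :: tree_of en) (pR p),
      all (fun r => all (fun b => b) r) (take np (val_of en)),
      all (fun r => ~~ all (fun b => b) r) (drop np (val_of en)) &
      ~~ has (fun b => b) (fv_of en)].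

(** Cutting the table just after the chosen entry makes its node the root of the DAG. *)
Definition answer (p : params) (np ax : nat) (T : seq entry) : seq nat :=
  if filter (fun ie => good p np ax ie.2) (indexed T) is ie :: _
  then 1 :: ie.1.+1 :: flatten (map (fun en => node_of en) (take ie.1.+1 T))
  else [:: 0].

Lemma ptime_answer : ptime (fun x : params * (nat * nat * seq entry) =>
  answer x.1 x.2.1.1 x.2.1.2 x.2.2).
Proof.
rewrite /answer /good.
by apply: (computes_case (l := fun x : params * (nat * nat * seq entry) =>
  filter (fun ie => good x.1 x.2.1.1 x.2.1.2 ie.2) (indexed x.2.2))
  (z := fun=> [:: 0]) (g := fun x ie _ =>
   1 :: ie.1.+1 :: flatten (map (fun en : entry => node_of en) (take ie.1.+1 x.2.2))));
  rewrite /good; pt.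
Qed.

(** * Reading the input and assembling the computation *)

Definition pos_part (u : seq nat) := parse_list struct_len u.
Definition neg_part (u : seq nat) := parse_list struct_len (pos_part u).2.
Definition gram_part (u : seq nat) := (neg_part u).2.
Definition rule_codes (u : seq nat) := rev (parse_list rule_len (drop 2 (gram_part u))).1.

(** With n the input length, the base exceeds all domain sizes and the exponent exceeds all arities
    of second-order variables. A block therefore has room for an element in unary and for the
    characteristic function of a relation, see [params_fits]. *)
Definition block (n : nat) := n.+1 ^ amax.+1.
Definition width (n : nat) := (k + k') * block n.

Lemma ptime_block : ptime block.
Proof. by rewrite /block; pt. Qed.
#[local] Hint Resolve ptime_block : pt.

Lemma ptime_width : ptime width.
Proof. by rewrite /width; pt. Qed.
#[local] Hint Resolve ptime_width : pt.

Definition structs (u : seq nat) : seq (seq nat) := rev (pos_part u).1 ++ rev (neg_part u).1.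

Definition mk_params (u : seq nat) (n N : nat) : params :=
  (block n, width n, iota 0 N, zip (iota 0 (size (structs u))) (structs u),
   rule_codes u, flatten (map (fun r => subs (behead r)) (rule_codes u))).

(** A strict bound on the number of keys: fewer than 2^n trees, 2^(k+k') sets of free variables, and
    at most n rows of N truth values. *)
Definition rounds (n N : nat) := 2 ^ (n + (k + k') + n * N).

Definition solve (u : seq nat) (n : nat) : seq nat :=
  answer (mk_params u n (2 ^ width n)) (size (pos_part u).1) (nth 0 (gram_part u) 1)
    (saturate (mk_params u n (2 ^ width n)) (rounds n (2 ^ width n))).

(** The two numbers that are written out in unary; everything else is polynomial in them and the
    input. *)
Definition budget (r : seq bool) := 2 ^ width (size r) + rounds (size r) (2 ^ width (size r)).

Lemma computes_solve : computes budget (fun r => rev (bits (solve (decode r) (size r)))).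
Proof.
have hsl := ptime_parse_list ptime_struct_len.
have hrl : ptime (parse_list rule_len).
  by apply: ptime_parse_list; rewrite /rule_len; pt.
have hp : ptime (fun r => rev (bits (answer r.1 r.2.1.1 r.2.1.2 r.2.2))).
  by pt; exact: ptime_answer.
have hN : computes budget (fun r : seq bool => 2 ^ width (size r)).
  apply: computes_pow2 => [|r]; last exact: leq_addr.
  by pt.
have hR : computes budget (fun r : seq bool => rounds (size r) (2 ^ width (size r))).
  apply: computes_pow2 => [|r]; last exact: leq_addl.
  by pt.
rewrite /solve.
apply: (computes_comp hp (f := fun r : seq bool =>
  let u := decode r in let n := size r in let N := 2 ^ width n in
  (mk_params u n N, (size (pos_part u).1, nth 0 (gram_part u) 1,
   saturate (mk_params u n N) (rounds n N))))).
rewrite /mk_params /rule_codes /structs /gram_part /neg_part /pos_part /=.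
by pt.
Qed.

End Algorithm.

(** * Input, output and running time *)

(** Loading and unloading both reverse the word, which accounts for the [rev] on either side in
    [machine_of_computes]. *)
Definition Load := Seq (Push tM false)
  (While tA full (If tA istrue
    (seqs [:: Pop tA; Push tM false; Push tM false; Push tM true; Push tM true])
    (seqs [:: Pop tA; Push tM false; Push tM true]))).

Definition Unload := While tM istrue (Seq (Pop tM)
  (If tM istrue (seqs [:: Pop tM; Pop tM; Pop tM; Push tC true])
                (seqs [:: Pop tM; Push tC false]))).

Lemma exec_load w :
  exec Load ([::], w, [::], [::]) (13 * size w + 3) (st (ser (enc (rev w)))).
Proof.
have loop l : exec (While tA full (If tA istrue
    (seqs [:: Pop tA; Push tM false; Push tM false; Push tM true; Push tM true])
    (seqs [:: Pop tA; Push tM false; Push tM true])))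
    (ser (enc l), w, [::], [::]) (13 * size w + 1) (st (ser (enc (catrev w l)))).
  elim: w l => [|b w IH] l; first by apply: exec_whileF.
  eapply (@exec_whileT _ _ _ _ 11); [by [] | | exact: (IH (b :: l)) |].
    eapply (@exec_if _ _ _ _ _ 9) => //=; case: b.
      by eapply exec_eq; [runs | | ].
    by eapply exec_eq; [runs | | ].
  by rewrite /=; lia.
eapply exec_seq; [runs | exact: (loop [::]) | by lia].
Qed.

Lemma exec_unload l r w :
  exec Unload (ser (enc l) ++ r, [::], [::], w) (12 * size l + 1)
    (false :: r, [::], [::], catrev l w).
Proof.
elim: l w => [|b l IH] w; first by apply: exec_whileF.
eapply (@exec_whileT _ _ _ _ 10); [by [] | | exact: (IH (b :: w)) |].
  eapply (@exec_seq _ _ _ 1 9); [by runs | | by []].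
  eapply (@exec_if _ _ _ _ _ 7) => //=; case: b.
    by eapply exec_eq; [runs | | ].
  by eapply exec_eq; [runs | | ].
by rewrite /=; lia.
Qed.

Lemma esize_bits (w : seq bool) : esize w <= 4 * size w + 1.
Proof. by elim: w => // b w IH; rewrite esize_cons /=; have := esize_bool b; lia. Qed.

Lemma machine_of_computes mu (f : seq bool -> seq bool) : computes mu f ->
  exists M k, forall w,
    outputs_within M w ((mu (rev w) + size w + 2) ^ k) (rev (f (rev w))).
Proof.
move=> hf; have [k1 hk1] := computes_esize hf; case: hf => p [t [[k2 hk2] hp]].
pose q := seqs [:: Load; p; Unload].
have [k hk] : pb (fun w => mu (rev w) + size w) (fun w =>
    (13 * size w + 3) + ((mu (rev w) + (4 * size w + 1) + 2) ^ k2
     + (12 * (mu (rev w) + (4 * size w + 1) + 2) ^ k1 + 1))).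
  have h1 : pb (fun w => mu (rev w) + size w) (fun w => mu (rev w)).
    by apply: pb_le (pb_Y _) => w; lia.
  have h2 : pb (fun w => mu (rev w) + size w) (fun w => size w).
    by apply: pb_le (pb_Y _) => w; lia.
  by pbs.
exists (machine (compile 0 q)), k => w.
have le_e : mu (rev w) + esize (rev w) <= mu (rev w) + (4 * size w + 1).
  by have := esize_bits (rev w); rewrite size_rev; lia.
have le_pow j : (mu (rev w) + esize (rev w)).+2 ^ j
    <= (mu (rev w) + (4 * size w + 1) + 2) ^ j.
  by case: j => // j; rewrite leq_exp2r //; lia.
have ex : exec q ([::], w, [::], [::]) ((mu (rev w) + size w + 2) ^ k)
  ([:: false], [::], [::], rev (f (rev w))).
  rewrite addn2; apply: EWeak (hk w).
  eapply exec_seq; [exact: exec_load | | exact: leqnn].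
  eapply exec_seq; [ | exact: exec_unload | ].
    by have := hp (rev w) [::]; rewrite !cats0 => h; exact: h.
  apply: leq_add; first exact: leq_trans (hk2 _) (le_pow _).
  rewrite leq_add2r leq_mul //; apply: leq_trans (ltnW (size_esize enc_bool _)) _.
  exact: leq_trans (hk1 _) (le_pow _).
exact: exec_outputs ex.
Qed.

Lemma poly_bound (D K a : nat) : exists c, forall n, K * n.+1 ^ a + n + D <= n ^ c + c.
Proof.
have [j hj] : pb (fun n => n) (fun n => K * n.+1 ^ a + n + D).
  by pbs; exact: pb_Y.
(* For n at least 2, n + 2 is at most n^2, so (n + 2)^j is at most n^(2j); the constant 3^j takes
   care of 0 and 1. *)
exists (3 ^ j + 2 * j) => n; apply: leq_trans (hj n) _.
case: n {hj} => [|[|n]]; first 2 last.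
- apply: leq_trans (leq_addr _ _); apply: leq_trans (_ : n.+2 ^ (2 * j) <= _).
    by rewrite expnM; case: j => // j; rewrite leq_exp2r //; nia.
  by rewrite leq_pexp2l // leq_addl.
- have : 2 ^ j <= 3 ^ j by case: (j) => // i; rewrite leq_exp2r.
  lia.
- lia.
Qed.

Lemma double_exp_bound (K a k : nat) : exists c, forall n,
  (2 ^ (K * n.+1 ^ a) + 2 ^ (n + K + n * 2 ^ (K * n.+1 ^ a)) + n + 2) ^ k
    <= 2 ^ (2 ^ (n ^ c + c)).
Proof.
have [c hc] := poly_bound (K + 5 + k) K a; exists c => n.
apply: leq_trans (_ : 2 ^ (2 ^ (K * n.+1 ^ a + n + (K + 5 + k))) <= _); last first.
  by rewrite !leq_pexp2l.
move: (K * n.+1 ^ a) => W {hc}.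
(* [X] dominates the exponents of all summands, so their sum is at most 2^(X+2). *)
pose X := n + K + n * 2 ^ W + W + 3.
have le2 i : i <= X -> 2 ^ i <= 2 ^ X by move=> le_i; rewrite leq_pexp2l.
apply: leq_trans (_ : (2 ^ (X + 2)) ^ k <= _).
  case: k => // k; rewrite leq_exp2r // (expnD 2 X 2).
  have h1 : 2 ^ W <= 2 ^ X by apply: le2; rewrite /X; lia.
  have h2 : 2 ^ (n + K + n * 2 ^ W) <= 2 ^ X by apply: le2; rewrite /X; lia.
  have h3 : n + 2 <= 2 ^ X.
    apply: leq_trans (ltnW (ltn_expl (n + 2) (isT : 1 < 2))) _; apply: le2.
    by rewrite /X; lia.
  by rewrite (_ : 2 ^ 2 = 4) //; lia.
rewrite -expnM leq_pexp2l //.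
have hk := ltn_expl k (isT : 1 < 2).
have hS := ltn_expl (n + K + W + 5) (isT : 1 < 2).
have hn := ltn_expl n (isT : 1 < 2).
(* The factor X + 2 is at most 2^(W+n+K+5), and k is below 2^k. *)
apply: leq_trans (_ : 2 ^ (W + n + K + 5) * 2 ^ k <= _); last by rewrite -expnD !addnA.
rewrite leq_mul //; last exact: ltnW.
rewrite /X; have : n * 2 ^ W <= 2 ^ (n + W) by rewrite expnD leq_mul // ltnW.
have : 2 ^ (n + W) <= 2 ^ (n + K + W + 4) by rewrite leq_pexp2l //; lia.
have := ltn_expl (n + K + W + 4) (isT : 1 < 2).
by rewrite (_ : W + n + K + 5 = (n + K + W + 4).+1) ?expnS; lia.
Qed.

(** * Parsing *)

Lemma decode_bits u : decode (rev (bits u)) = u.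
Proof.
rewrite /decode foldl_rev /bits.
elim: u => //= x u IH; rewrite foldr_cat IH -cats1 foldr_cat /=.
have nat_case n : foldr (fun (b : bool) out => if b then (head 0 out).+1 :: behead out
  else 0 :: out) (0 :: u) (nseq n true) = n :: u.
  by elim: n => //= n ->.
exact: nat_case.
Qed.

Lemma nth_map_ord m (f : 'I_m -> nat) (i : 'I_m) : nth 0 [seq f j | j <- enum 'I_m] i = f i.
Proof. by rewrite (nth_map i) ?size_enum_ord // nth_ord_enum. Qed.

Lemma parse_listE T (f : T -> seq nat) len xs r :
  (forall x r, len (f x ++ r) = size (f x)) ->
  parse_list len (code_seq f xs ++ r) = (rev (map f xs), r).
Proof.
move=> hlen; rewrite /parse_list /code_seq /=.
have loop s : iter (size xs) (fun st : seq (seq nat) * seq nat =>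
    (take (len st.2) st.2 :: st.1, drop (len st.2) st.2)) (s, flatten (map f xs) ++ r)
    = (catrev (map f xs) s, r).
  elim: xs s => [|x xs IH] s //; rewrite [size _]/= iterSr /=.
  by rewrite -catA hlen take_size_cat // drop_size_cat // IH.
by rewrite /unfold loop catrevE cats0.
Qed.

Section Codes.
Variables (tau : signature) (k k' : nat) (arX : 'I_k' -> nat).

Definition arsR := [seq arity R | R <- enum 'I_(nrel tau)].
Definition arsX := [seq arX X | X <- enum 'I_k'].

Lemma size_code_tuples (n ar : nat) (s : seq (ar.-tuple 'I_n)) :
  size (flatten (map (@code_tuple ar n) s)) = size s * ar.
Proof.
by elim: s => //= t s IH; rewrite size_cat IH size_map size_tuple mulSn.
Qed.

Lemma skip_relsE (A : structure tau) Rs r :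
  skip_rels (flatten [seq code_seq (@code_tuple _ _) (enum (interp A R)) | R <- Rs] ++ r)
    (map (fun R => arity R) Rs) = r.
Proof.
elim: Rs => //= R Rs IH; rewrite /skip_rels /= -catA -(size_code_tuples (enum _)).
by rewrite drop_size_cat.
Qed.

Lemma struct_lenE (A : structure tau) r :
  struct_len arsR (code_structure A ++ r) = size (code_structure A).
Proof. by rewrite /struct_len /= skip_relsE /= size_cat; lia. Qed.

Section Trees.
Variable N : nat.
Notation tree := (tree tau k arX 'I_N).

Definition token (t : tree) : seq nat :=
  match t with
  | Leaf B => [:: 0; nat_of_ord B]
  | Node0 a => code_sym0 a
  | Node1 f _ => code_sym1 f
  | Node2 f _ _ => code_sym2 f
  end.

Definition children (t : tree) : seq tree :=
  match t with
  | Leaf _ | Node0 _ => [::]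
  | Node1 _ p => [:: p]
  | Node2 _ p q => [:: p; q]
  end.

Fixpoint subtrees (t : tree) : seq tree :=
  t :: match t with
       | Leaf _ | Node0 _ => [::]
       | Node1 _ p => subtrees p
       | Node2 _ p q => subtrees p ++ subtrees q
       end.

Lemma code_treeE (t : tree) :
  code_tree t = token t ++ flatten (map (@code_tree _ _ _ _ N) (children t)).
Proof. by case: t => //= *; rewrite ?cats0. Qed.

Lemma tok_lenE (t : tree) r : tok_len arsR arsX (token t ++ r) = size (token t).
Proof.
case: t => [B|[R xs|X xs]|f p|f p q]; [by []| | |by case: f|by case: f].
- by rewrite /tok_len /= nth_map_ord size_map size_tuple.
- by rewrite /tok_len /= nth_map_ord size_map size_tuple.
Qed.

Lemma tok_arE (t : tree) r : tok_ar (token t ++ r) = size (children t).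
Proof. by case: t => [B|[R xs|X xs]|[|?|?|?|?] ?|[] ? ?]. Qed.

Lemma token_gt0 (t : tree) : 0 < size (token t).
Proof. by case: t => [B|[R xs|X xs]|[|?|?|?|?] ?|[] ? ?]. Qed.

Lemma code_gt0 (t : tree) : 0 < size (code_tree t).
Proof. by rewrite code_treeE size_cat ltn_addr ?token_gt0. Qed.

Lemma size_subtrees (t : tree) : 0 < size (subtrees t) <= size (code_tree t).
Proof.
elim: t => [B|a|f p IH|f p IHp q IHq] //=; rewrite ?size_cat.
- by case: a => *.
- have := token_gt0 (Node1 f p); move: IH; rewrite /=; lia.
- have := token_gt0 (Node2 f p q); move: IHp IHq; rewrite /=; lia.
Qed.

(** There is one round per token, and as many tokens as subtrees. Reading a tree lowers the counter
    by one in total, and the position ends where the next sibling starts. *)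
Lemma skip_tokE (t : tree) v a b r : drop b v = code_tree t ++ r ->
  iter (size (subtrees t)) (skip_tok arsR arsX v) (a.+1, b) = (a, b + size (code_tree t)).
Proof.
have step s r' a' b' : drop b' v = token s ++ r' -> 
  skip_tok arsR arsX v (a'.+1, b') = (a' + size (children s), b' + size (token s)).
  by move=> e; rewrite /skip_tok /= e tok_lenE tok_arE.
elim: t a b r => [B|x|f p IH|f p IHp q IHq] a b r e.
- by rewrite /= (step (Leaf _ _ _ B) r) //= addn0.
- by rewrite /= (step (Node0 _ x) r) //= addn0.
- rewrite code_treeE /= cats0 -catA in e.
  rewrite [size _]/= iterSr (step (Node1 f p) (code_tree p ++ r)) // addn1.
  by rewrite (IH _ _ r) ?size_cat ?addnA // addnC -drop_drop e drop_size_cat.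
- rewrite code_treeE /= cats0 -!catA in e.
  rewrite [size _]/= size_cat iterSr (step (Node2 f p q) (code_tree p ++ code_tree q ++ r)) //.
  rewrite addnC iterD addn2 (IHp _ _ (code_tree q ++ r)); last first.
    by rewrite addnC -drop_drop e drop_size_cat.
  rewrite (IHq _ _ r) ?size_cat ?addnA //.
  rewrite addnC -drop_drop [b + _]addnC -drop_drop e !drop_size_cat //.
Qed.

Lemma tree_lenE (t : tree) r :
  tree_len arsR arsX (code_tree t ++ r) = size (code_tree t).
Proof.
have /andP[_ le_t] := size_subtrees t; rewrite /tree_len.
have -> : size (code_tree t ++ r) =
  (size (code_tree t ++ r) - size (subtrees t)) + size (subtrees t).
  by rewrite subnK // size_cat; lia.
rewrite iterD (@skip_tokE t _ 0 0 r) ?drop0 // add0n.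
by rewrite (_ : iter _ _ _ = (0, size (code_tree t))) //; elim: (_ - _) => //= n ->.
Qed.

Lemma rule_lenE (c : 'I_N * tree) r :
  rule_len arsR arsX ((nat_of_ord c.1 :: code_tree c.2) ++ r)
    = size (nat_of_ord c.1 :: code_tree c.2).
Proof. by rewrite /rule_len /= tree_lenE. Qed.

Lemma unfold_subtrees (t : tree) s r :
  iter (size (subtrees t)) (fun st : seq (seq nat) * seq nat =>
    (take (tree_len arsR arsX st.2) st.2 :: st.1,
     drop (tok_len arsR arsX st.2) st.2)) (s, code_tree t ++ r)
  = (catrev (map (@code_tree _ _ _ _ N) (subtrees t)) s, r).
Proof.
set g := fun st => _.
have step u s' r' : g (s', code_tree u ++ r') =
    (code_tree u :: s', flatten (map (@code_tree _ _ _ _ N) (children u)) ++ r').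
  rewrite /g /= tree_lenE take_size_cat //; congr pair.
  by rewrite code_treeE -catA tok_lenE drop_size_cat.
elim: t s r => [B|x|f p IH|f p IHp q IHq] s r; rewrite [size _]/= iterSr step //.
- by rewrite /= cats0 IH.
- by rewrite size_cat addnC iterD /= cats0 -catA IHp IHq map_cat catrev_catl.
Qed.

Lemma subsE (t : tree) u :
  u \in subs arsR arsX (code_tree t) <->
  exists2 s, List.In s (subtrees t) & u = code_tree s.
Proof.
have /andP[_ le_t] := size_subtrees t.
(* The first rounds cut off the subtrees, the others see the empty word. *)
rewrite /subs /unfold -(subnK le_t) iterD -{2}[code_tree t]cats0 unfold_subtrees.
set g := (fun st : seq (seq nat) * seq nat => _).
have -> i s : (iter i g (s, [::])).1 = nseq i [::] ++ s.
  rewrite (_ : iter i g _ = (nseq i [::] ++ s, [::])) //.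
  by elim: i => //= i ->; rewrite /g /=; case: (tok_len _ _ _).
rewrite mem_filter mem_cat mem_nseq catrevE cats0 mem_rev.
move: (_ - _) => n; elim: (subtrees t) => [|s l IH] /=.
  split=> [|[s []]]; rewrite orbF; case: u => [|x u]; rewrite ?andbF //=.
split.
  rewrite inE orbCA => /andP[u0 /orP[/eqP->|ul]]; first by exists s => //; left.
  by have [|s' ls' ->] := (IH.1 _); [rewrite u0 ul | exists s' => //; right].
case=> s' [<- ->|ls' e]; first by rewrite code_gt0 /= inE eqxx orbT.
have /andP[-> /orP[->//|h]] := IH.2 (ex_intro2 _ _ s' ls' e).
by rewrite inE h !orbT.
Qed.

Lemma size_subs (u : seq nat) : size (subs arsR arsX u) <= size u.
Proof.
rewrite /subs size_filter; apply: leq_trans (count_size _ _) _.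
by rewrite /unfold; elim: (size u) => //=.
Qed.

(** Tags determine the number of indices and of subtrees, so the notation is self-delimiting. This
    lets the algorithm compare trees by their codes. *)
Lemma code_tree_inj_cat (t t' : tree) r r' :
  code_tree t ++ r = code_tree t' ++ r' -> t = t' /\ r = r'.
Proof.
have tup (n : nat) (xs ys : n.-tuple 'I_k) s s' :
  code_tuple xs ++ s = code_tuple ys ++ s' -> xs = ys /\ s = s'.
  move=> e; have sz : size (code_tuple xs) = size (code_tuple ys).
    by rewrite !size_map !size_tuple.
  have := eqseq_cat s s' sz; rewrite e eqxx => /esym/andP[/eqP ex /eqP ->].
  by split=> //; apply/val_inj/(inj_map val_inj).
elim: t t' r r' => [B|a|f p IH|f p IHp q IHq] [B'|a'|f' p'|f' p' q'] r r' /=.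
- by case=> /val_inj-> ->.
- by case: a'.
- by case: f'.
- by case: f'.
- by case: a.
- case: a a' => [R xs|X xs] [R' xs'|X' xs'] //= [].
    by move=> /val_inj eR; case: R' / eR xs' => xs' /tup[-> ->].
  by move=> /val_inj eX; case: X' / eX xs' => xs' /tup[-> ->].
- by case: a; case: f'.
- by case: a; case: f'.
- by case: f.
- by case: f; case: a'.
- case: f f' => [|x|x|X|X] [|x'|x'|X'|X'] //= [].
  + by move/IH=> [-> ->].
  + by move=> /val_inj-> /IH[-> ->].
  + by move=> /val_inj-> /IH[-> ->].
  + by move=> /val_inj-> /IH[-> ->].
  + by move=> /val_inj-> /IH[-> ->].
- by case: f; case: f'.
- by case: f.
- by case: f; case: a'.
- by case: f; case: f'.
- by case: f f' => [] [] //= []; rewrite -!catA => /IHp[-> /IHq[-> ->]].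
Qed.

Lemma code_tree_inj : injective (@code_tree tau k k' arX N).
Proof.
by move=> t t' e; have [] := @code_tree_inj_cat t t' [::] [::]; rewrite ?cats0.
Qed.

End Trees.
End Codes.

(** * Derivations *)

Section Derivations.
Variables (tau : signature) (k k' : nat) (arX : 'I_k' -> nat).
Variable G : grammar tau k arX.
Notation gtree := (tree tau k arX 'I_(nonterm G)).
Notation form := (formula tau k arX).

(** The big-step form of derivation. It follows the structure of the tree and forgets the order of
    rewriting steps, so soundness and completeness can be proved by induction on it. *)
Inductive generates : gtree -> form -> Prop :=
| GenLeaf B t phi : List.In (B, t) (rules G) -> generates t phi ->
    generates (Leaf _ _ _ B) phi
| Gen0 a : generates (Node0 _ a) (Node0 _ a)
| Gen1 f t phi : generates t phi -> generates (Node1 f t) (Node1 f phi)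
| Gen2 f t u phi psi : generates t phi -> generates u psi ->
    generates (Node2 f t u) (Node2 f phi psi).

Lemma generates_step t t' phi : derives1 t t' -> generates t' phi -> generates t phi.
Proof.
move=> d; elim: d phi => {t t'} [B t BG|f t t' _ IH|f t t' u _ IH|f t u u' _ IH] phi g.
- exact: GenLeaf BG g.
- inversion g; subst; apply: Gen1; exact: IH.
- inversion g; subst; apply: Gen2 => //; exact: IH.
- inversion g; subst; apply: Gen2 => //; exact: IH.
Qed.

Lemma generatesP t phi :
  clos_refl_trans _ (@derives1 _ _ _ _ G) t (tree_of_formula _ phi) <-> generates t phi.
Proof.
split=> [d|].
  have {}d := clos_rt_rt1n _ _ _ _ d; move: d.
  move e: (tree_of_formula _ phi) => t' d.
  elim: d e => {t t'} [t <-|t u v tu _ IH e]; last exact: generates_step tu (IH e).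
  by elim: phi => [[]|a|f p IH|f p IHp q IHq] /=; constructor.
elim=> {t phi} [B t phi BG _ IH|a|f t phi _ IH|f t u phi psi _ IHt _ IHu] /=.
- by apply: rt_trans IH; apply: rt_step; constructor.
- exact: rt_refl.
- move: IH; elim=> [x y xy|x|x y z _ h1 _ h2]; [|exact: rt_refl|exact: rt_trans h1 h2].
  by apply: rt_step; constructor.
- apply: (@rt_trans _ _ _ (Node2 f (tree_of_formula _ phi) u)).
    move: IHt; elim=> [x y xy|x|x y z _ h1 _ h2]; [|exact: rt_refl|exact: rt_trans h1 h2].
    by apply: rt_step; constructor.
  move: IHu; elim=> [x y xy|x|x y z _ h1 _ h2]; [|exact: rt_refl|exact: rt_trans h1 h2].
  by apply: rt_step; constructor.
Qed.

End Derivations.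

(** * Bit patterns of numbers and ranks of tuples *)

Lemma bit_surj m (f : nat -> bool) :
  exists2 e, e < 2 ^ m & forall j, j < m -> bit e j = f j.
Proof.
elim: m f => [|m IH] f; first by exists 0.
have [e lt_e he] := IH (fun j => f j.+1).
exists (f 0 + e.*2); first by rewrite expnS; case: (f 0); lia.
case=> [|j] lt_j; first by rewrite /bit /= oddD odd_double addbF; case: (f 0).
by rewrite /bit iterSr half_bit_double -/(bit e j) he.
Qed.

(** Reads an element back from its unary code, [a] ones followed by zeros. *)
Lemma count_ltn n a : a <= n -> count (fun j => j < a) (iota 0 n) = a.
Proof.
move=> le_a; rewrite -(subnKC le_a) iotaD count_cat.
have /eqP-> : count (fun j => j < a) (iota 0 a) == a.
  by rewrite -[X in _ == X](size_iota 0 a) -all_count; apply/allP=> j; rewrite mem_iota.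
rewrite -[RHS]addn0; congr addn; apply/eqP; rewrite -leqn0 leqNgt -has_count.
by apply/hasPn => j; rewrite mem_iota; lia.
Qed.

Lemma rank_lt n d (s : seq nat) : 0 < d -> size s <= n -> all (fun x => x < d) s ->
  rank n d s < d ^ n.
Proof.
move=> d0; elim: n s => [|n IH] [|x s] //= sz.
  by move=> _; have := IH [::] isT isT; rewrite expnS; nia.
by case/andP=> lt_x /(IH _ sz); rewrite expnS; nia.
Qed.

Lemma rank_inj n d (s t : seq nat) : size s = size t -> size s <= n ->
  all (fun x => x < d) s -> all (fun x => x < d) t ->
  rank n d s = rank n d t -> s = t.
Proof.
elim: n s t => [|n IH] [|x s] [|y t] //= [sz] sn /andP[lt_x ds] /andP[lt_y dt] e.
have d0 : 0 < d by lia.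
have exy : x = y.
  by have := congr1 (modn^~ d) e; rewrite ![_ + d * _]addnC ![d * _]mulnC !modnMDl !modn_small.
rewrite exy (IH s t) //; move: e; rewrite exy => /addnI/eqP.
by rewrite eqn_pmul2l // => /eqP.
Qed.

(** * Semantics *)

Notation pL p := p.1.1.1.1.1 (only parsing).
Notation pm p := p.1.1.1.1.2 (only parsing).
Notation pE p := p.1.1.1.2 (only parsing).
Notation pS p := p.1.1.2 (only parsing).
Notation pR p := p.1.2 (only parsing).
Notation pT p := p.2 (only parsing).

(** Environments are functions; this takes the place of functional extensionality. *)
Lemma eval_ext (tau : signature) (k k' : nat) (arX : 'I_k' -> nat) (A : structure tau)
    (phi : formula tau k arX) (s s' : env1 k A) (S S' : env2 arX A) :
  s =1 s' -> (forall X, S X = S' X) -> eval s S phi = eval s' S' phi.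
Proof.
elim: phi s s' S S' => [[]|[R xs|X xs]|f p IH|f p IHp q IHq] s s' S S' es eS /=.
- by rewrite (_ : map_tuple s xs = map_tuple s' xs) //; apply/val_inj/eq_map.
- by rewrite eS (_ : map_tuple s xs = map_tuple s' xs) //; apply/val_inj/eq_map.
- have upd1 x a : [eta s with x |-> a] =1 [eta s' with x |-> a].
    by move=> y /=; rewrite es.
  have upd2 X P Y : dfwith S (i:=X) P Y = dfwith S' P Y.
    case: (eqVneq X Y) => [<-|ne]; first by rewrite !dfwith_in.
    by rewrite !dfwith_out.
  case: f => [|x|x|X|X].
  + by congr negb; apply: IH.
  + by apply: eq_existsb => a; apply: IH.
  + by apply: eq_forallb => a; apply: IH.
  + by apply: eq_existsb => a; apply: IH.
  + by apply: eq_forallb => a; apply: IH.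
- by case: f; rewrite (IHp _ _ _ _ es eS) (IHq _ _ _ _ es eS).
Qed.

Lemma chunk_nth ar (s : seq (seq nat)) r i : all (fun t => size t == ar) s ->
  i < size s -> take ar (drop (i * ar) (flatten s ++ r)) = nth [::] s i.
Proof.
elim: s i => // t s IH [|i] /= /andP[/eqP st ss] lt_i.
  by rewrite mul0n drop0 -catA -st take_size_cat.
by rewrite mulSn addnC -drop_drop -catA (drop_size_cat _ st) IH.
Qed.

Lemma code_tuple_inj m n : injective (@code_tuple m n).
Proof. by move=> s t /(inj_map val_inj)/val_inj. Qed.

Lemma inrelE (tau : signature) (A : structure tau) (R : 'I_(nrel tau))
    (t : (arity R).-tuple 'I_(dom A).+1) :
  inrel (arsR tau) (code_structure A) R (code_tuple t) = (t \in interp A R).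
Proof.
rewrite /inrel nth_map_ord.
set cR := fun R => code_seq (@code_tuple _ _) (enum (interp A R)).
have -> : behead (code_structure A) = flatten (map cR (take R (enum 'I_(nrel tau))))
   ++ cR R ++ flatten (map cR (drop R.+1 (enum 'I_(nrel tau)))).
  have eR : drop R (enum 'I_(nrel tau)) = R :: drop R.+1 (enum 'I_(nrel tau)).
    by rewrite (drop_nth R) ?size_enum_ord // nth_ord_enum.
  by rewrite /= -{1}(cat_take_drop R (enum 'I_(nrel tau))) map_cat flatten_cat eR.
rewrite /arsR -map_take (@skip_relsE _ A (take R _)) /seg_mem /=.
set s := enum _; set r := flatten _.
have all_s : all (fun u => size u == arity R) (map (@code_tuple _ _) s).
  by apply/allP => u /mapP[v _ ->]; rewrite size_map size_tuple.
rewrite -(mem_enum (interp A R)) -(mem_map (@code_tuple_inj _ _)) -/s.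
apply/hasP/(nthP [::]) => [[i]|[i]].
  rewrite mem_iota /= => lt_i; rewrite chunk_nth ?size_map // => /eqP <-.
  by exists i; rewrite ?size_map.
rewrite size_map => lt_i e; exists i; first by rewrite mem_iota.
by rewrite chunk_nth ?size_map // e.
Qed.

Section Environments.
Variables (tau : signature) (k k' : nat) (arX : 'I_k' -> nat) (amax : nat).
Variable p : params.
Hypothesis pmE : pm p = (k + k') * pL p.
Hypothesis pEE : pE p = iota 0 (2 ^ pm p).
Hypothesis arX_le : forall X, arX X <= amax.
Notation form := (formula tau k arX).

(** A block can hold up to [dom A] ones for an element, and one bit for each tuple of length at most
    [amax]. *)
Definition fits (A : structure tau) := dom A <= pL p /\ (dom A).+1 ^ amax <= pL p.

Definition env1_of (A : structure tau) (e : nat) : env1 k A :=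
  fun x => inord (foval p (code_structure A) e x).

Definition env2_of (A : structure tau) (e : nat) : env2 arX A :=
  fun X => [set t | bit e ((k + X) * pL p + rank amax (dom A).+1 (code_tuple t))].

Definition truth (phi : form) (A : structure tau) (e : nat) : bool :=
  eval (@env1_of A e) (@env2_of A e) phi.

Definition row (phi : form) (A : structure tau) : seq bool :=
  map (truth phi A) (iota 0 (2 ^ pm p)).

Lemma nth_row phi A e : e < 2 ^ pm p -> nth false (row phi A) e = truth phi A e.
Proof. by move=> lt_e; rewrite (nth_map 0) ?size_iota // nth_iota. Qed.

Lemma fovalE A e (x : 'I_k) : foval p (code_structure A) e x = env1_of A e x.
Proof.
rewrite inordK // ltnS /foval /=; apply: leq_trans (count_size _ _) _.
by rewrite size_iota.
Qed.

Lemma map_foval n A e (xs : n.-tuple 'I_k) :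
  map (fun x => foval p (code_structure A) e x) (code_tuple xs)
    = code_tuple (map_tuple (env1_of A e) xs).
Proof. by rewrite /code_tuple -!map_comp; apply: eq_map => x /=; rewrite fovalE. Qed.

Variable A : structure tau.
Hypothesis fitsA : fits A.

Lemma rank_code_lt X (t : (arX X).-tuple 'I_(dom A).+1) :
  rank amax (dom A).+1 (code_tuple t) < pL p.
Proof.
apply: leq_trans (fitsA.2); apply: rank_lt => //.
  by rewrite size_map size_tuple.
by apply/allP => x /mapP[y _ ->].
Qed.

Lemma rank_code_inj X : injective (fun t : (arX X).-tuple 'I_(dom A).+1 =>
  rank amax (dom A).+1 (code_tuple t)).
Proof.
move=> s t e; apply: code_tuple_inj; apply: rank_inj e.
- by rewrite !size_map !size_tuple.
- by rewrite size_map size_tuple.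
- by apply/allP => x /mapP[y _ ->].
- by apply/allP => x /mapP[y _ ->].
Qed.

Lemma L_gt0 : 0 < pL p.
Proof. by apply: leq_trans (fitsA.2); rewrite expn_gt0. Qed.

Lemma block_div v j : j < pL p -> (v * pL p + j) %/ pL p = v.
Proof. by move=> lt_j; rewrite divnMDl ?L_gt0 // divn_small // addn0. Qed.

Lemma block_lt v j : v < k + k' -> j < pL p -> v * pL p + j < pm p.
Proof.
move=> lt_v lt_j; rewrite pmE; apply: leq_trans (_ : v.+1 * pL p <= _).
  by rewrite mulSn addnC ltn_add2r.
by rewrite leq_mul2r lt_v orbT.
Qed.

Lemma agreeP v e e' : reflect
  (forall j, j < pm p -> j %/ pL p != v -> bit e j = bit e' j) (agree p v e e').
Proof.
have inb j : (v * pL p <= j) && (j < v * pL p + pL p) = (j %/ pL p == v).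
  by rewrite eqn_leq leq_divRL ?L_gt0 // -[_ %/ _ <= _]ltnS ltn_divLR ?L_gt0 // mulSn addnC andbC.
apply: (iffP allP) => h j.
  move=> lt_j ne; have := h j; rewrite mem_iota /= inb (negbTE ne) => /(_ lt_j).
  by move/eqP.
rewrite mem_iota /= inb => lt_j; case: eqVneq => //= ne; exact/eqP/h.
Qed.

(** The blocks in [V] can be given any values while the others keep the bits of [e0]. A single block
    gives the environments needed for a quantifier; all blocks together show that every environment
    has a code. *)
Lemma env_surj (V : pred nat) (e0 : nat) (s : env1 k A) (S : env2 arX A) :
  exists2 e, e < 2 ^ pm p &
  [/\ forall j, j < pm p -> ~~ V (j %/ pL p) -> bit e j = bit e0 j,
      forall x : 'I_k, V x -> env1_of A e x = s x &
      forall X : 'I_k', V (k + X) -> env2_of A e X = S X].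
Proof.
(* Inside [V], an element is written in unary and a relation as the set of ranks of its tuples;
   since ranks are injective, the relation can be read back. *)
pose f j := if V (j %/ pL p) then
    if insub (j %/ pL p) : option 'I_k is Some x then j %% pL p < s x
    else if insub (j %/ pL p - k) : option 'I_k' is Some X
    then [exists t in S X, rank amax (dom A).+1 (code_tuple t) == j %% pL p] else false
  else bit e0 j.
have [e lt_e he] := bit_surj (pm p) f; exists e => //; split.
- by move=> j lt_j nV; rewrite he // /f (negbTE nV).
- move=> x Vx; apply: val_inj; rewrite /= -fovalE /foval /=.
  rewrite -[RHS](@count_ltn (dom A)); last by rewrite -ltnS.
  apply: eq_in_count => j; rewrite mem_iota /= => lt_j.
  have lt_jL : j < pL p := leq_trans lt_j fitsA.1.
  rewrite he; last by apply: block_lt => //; have := ltn_ord x; lia.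
  by rewrite /f block_div // Vx valK modnMDl modn_small.
- move=> X VX; apply/setP => t; rewrite inE.
  have lt_r := rank_code_lt t; rewrite he; last by apply: block_lt => //; have := ltn_ord X; lia.
  rewrite /f block_div // VX insubF ?addKn ?valK; last by lia.
  rewrite modnMDl modn_small //.
  by apply/exists_inP/idP => [[u Su /eqP/rank_code_inj <-]|St] //; exists t.
Qed.

Lemma agree_env1 v e e' (x : 'I_k) : agree p v e e' -> nat_of_ord x != v ->
  env1_of A e x = env1_of A e' x.
Proof.
move=> /agreeP ag ne; apply: val_inj; rewrite /= -!fovalE /foval /=.
apply: eq_in_count => j; rewrite mem_iota /= => lt_j.
have lt_jL : j < pL p := leq_trans lt_j fitsA.1.
apply: ag; last by rewrite block_div.
by apply: block_lt => //; have := ltn_ord x; lia.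
Qed.

Lemma agree_env2 v e e' (X : 'I_k') : agree p v e e' -> k + X != v ->
  env2_of A e X = env2_of A e' X.
Proof.
move=> /agreeP ag ne; apply/setP => t; rewrite !inE.
have lt_r := rank_code_lt t; apply: ag; last by rewrite block_div.
by apply: block_lt => //; have := ltn_ord X; lia.
Qed.

(** From left to right the witness is the value of [x] in the other environment; from right to left
    [env_surj] for the block of [x] alone supplies the number. *)
Lemma exists1P (phi : form) (x : 'I_k) e : e < 2 ^ pm p ->
  (exists2 e', e' < 2 ^ pm p & agree p x e e' && truth phi A e') <->
  (exists a, eval [eta env1_of A e with x |-> a] (env2_of A e) phi).
Proof.
move=> lt_e; split=> [[e' lt_e' /andP[ag ev]]|[a ev]].
  exists (env1_of A e' x); rewrite -(eval_ext _ (s := env1_of A e') (S := env2_of A e')) //.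
    move=> y /=; case: eqVneq => [-> //|ne].
    by rewrite (agree_env1 ag) //; apply: contra ne => /eqP/val_inj->.
  by move=> X; rewrite (agree_env2 ag) //; have := ltn_ord x; lia.
have [e' lt_e' [ag h1 h2]] := env_surj (pred1 (nat_of_ord x)) e (fun=> a) (env2_of A e).
have {}ag : agree p x e e' by apply/agreeP => j lt_j ne; rewrite ag.
exists e' => //; rewrite ag /truth /=.
rewrite (eval_ext _ (s' := [eta env1_of A e with x |-> a]) (S' := env2_of A e)) //.
  move=> y /=; case: eqVneq => [->|ne]; first by rewrite h1 //= eqxx.
  by rewrite (agree_env1 ag) //; apply: contra ne => /eqP/val_inj->.
by move=> X; rewrite (agree_env2 ag) //; have := ltn_ord x; lia.
Qed.

Lemma exists2P (phi : form) (X : 'I_k') e : e < 2 ^ pm p ->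
  (exists2 e', e' < 2 ^ pm p & agree p (k + X) e e' && truth phi A e') <->
  (exists P, eval (env1_of A e) (dfwith (env2_of A e) (i := X) P) phi).
Proof.
have eqX (Y : 'I_k') : X != Y -> k + Y != k + X.
  by apply: contra => /eqP/addnI/val_inj->.
move=> lt_e; split=> [[e' lt_e' /andP[ag ev]]|[P ev]].
  exists (env2_of A e' X); rewrite -(eval_ext _ (s := env1_of A e') (S := env2_of A e')) //.
    by move=> y /=; rewrite (agree_env1 ag) //; have := ltn_ord y; lia.
  move=> Y; case: (eqVneq X Y) => [<-|ne]; first by rewrite dfwith_in.
  by rewrite dfwith_out // (agree_env2 ag) // eqX.
have [e' lt_e' [ag h1 h2]] := env_surj (pred1 (k + X)) e (env1_of A e)
  (dfwith (env2_of A e) (i := X) P).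
have {}ag : agree p (k + X) e e' by apply/agreeP => j lt_j ne; rewrite ag.
exists e' => //; rewrite ag /truth /=.
rewrite (eval_ext _ (s' := env1_of A e) (S' := dfwith (env2_of A e) (i := X) P)) //.
  by move=> y /=; rewrite (agree_env1 ag) //; have := ltn_ord y; lia.
move=> Y; case: (eqVneq X Y) => [<-|ne]; first by rewrite h2 //= eqxx.
by rewrite dfwith_out // (agree_env2 ag) // eqX.
Qed.

Notation nbit u := (newbit (arsR tau) k amax p u (code_structure A)).

Lemma newbit0 (a : sym0 tau k arX) r1 r2 e :
  nbit (code_sym0 a) r1 r2 e = truth (Node0 _ a) A e.
Proof.
case: a => [R xs|X xs]; rewrite /newbit /= drop0 map_foval; first exact: inrelE.
by rewrite /truth /= inE.
Qed.

Lemma hasE v (phi : form) e :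
  has (fun e' => agree p v e e' && nth false (row phi A) e') (pE p) <->
  exists2 e', e' < 2 ^ pm p & agree p v e e' && truth phi A e'.
Proof.
rewrite pEE; split=> [/hasP[e']|[e' lt_e']].
  by rewrite mem_iota /= => lt_e'; rewrite nth_row // => h; exists e'.
by move=> h; apply/hasP; exists e'; rewrite ?mem_iota ?nth_row.
Qed.

(** Reduces universal quantifiers to existential ones over the negated formula. *)
Lemma allE v (phi : form) e :
  all (fun e' => agree p v e e' ==> nth false (row phi A) e') (pE p) =
  ~~ has (fun e' => agree p v e e' && nth false (row (Node1 (Not _ _) phi) A) e') (pE p).
Proof.
rewrite -all_predC; apply: eq_in_all => e'; rewrite pEE mem_iota /= => lt_e'.
by rewrite !nth_row // /truth /=; case: (agree _ _ _ _); rewrite /= ?negbK.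
Qed.

Lemma newbit1 (f : sym1 k k') (phi : form) u r2 e : e < 2 ^ pm p ->
  nbit (code_sym1 f ++ u) (row phi A) r2 e = truth (Node1 f phi) A e.
Proof.
move=> lt_e; case: f => [|x|x|X|X]; rewrite /newbit.
- by rewrite /= nth_row.
- rewrite [qvar _ _]/= [LHS]/=; apply/idP/existsP => [/hasE/exists1P|/exists1P h]; first exact.
  by apply/hasE; apply: h.
- rewrite [qvar _ _]/= [LHS]/= allE; apply/idP/forallP => [nh a|h].
    by apply: contraR nh => nev; apply/hasE/exists1P => //; exists a.
  by apply/negP => /hasE/exists1P[//|a ev]; apply: (negP (ev : ~~ eval _ _ phi)); apply: h.
- rewrite [qvar _ _]/= [LHS]/=; apply/idP/existsP => [/hasE/exists2P|/exists2P h]; first exact.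
  by apply/hasE; apply: h.
- rewrite [qvar _ _]/= [LHS]/= allE; apply/idP/forallP => [nh a|h].
    by apply: contraR nh => nev; apply/hasE/exists2P => //; exists a.
  by apply/negP => /hasE/exists2P[//|a ev]; apply: (negP (ev : ~~ eval _ _ phi)); apply: h.
Qed.

Lemma newbit2 (f : sym2) (phi psi : form) u e : e < 2 ^ pm p ->
  nbit (code_sym2 f ++ u) (row phi A) (row psi A) e = truth (Node2 f phi psi) A e.
Proof. by move=> lt_e; case: f; rewrite /newbit /= !nth_row. Qed.

Lemma newbit_leaf B (phi : form) u r2 e : e < 2 ^ pm p ->
  nbit (0 :: B :: u) (row phi A) r2 e = truth phi A e.
Proof. by move=> lt_e; rewrite /newbit /= nth_row. Qed.

(** A row ranges over codes and [models] over environments; by [env_surj] for all blocks the codes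
    reach every environment. *)
Lemma modelsP (phi : form) : models A phi <-> all id (row phi A).
Proof.
split=> [h|/allP h s S].
  by apply/allP => b /mapP[e _ ->]; apply: h.
have [e lt_e [_ h1 h2]] := env_surj predT 0 s S.
rewrite -(eval_ext _ (s := env1_of A e) (S := env2_of A e)).
- by apply: h; apply/mapP; exists e; rewrite ?mem_iota.
- by move=> x; apply: h1.
- by move=> X; apply: h2.
Qed.

End Environments.

(** * Formulas as DAGs, free variables *)

Section Dags.
Variables (tau : signature) (k k' : nat) (arX : 'I_k' -> nat).
Implicit Types (ns : dag tau k arX) (ts : seq (formula tau k arX)).

Lemma dag_rcons ns n : dag_formulas (rcons ns n) =
  if dag_formulas ns is Some ts then omap (rcons ts) (node_formula ts n) else None.
Proof. by rewrite /dag_formulas foldl_rcons. Qed.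

Lemma dag_rconsP ns n us : dag_formulas (rcons ns n) = Some us ->
  exists ts phi, [/\ dag_formulas ns = Some ts, node_formula ts n = Some phi &
                     us = rcons ts phi].
Proof.
rewrite dag_rcons; case: (dag_formulas ns) => // ts.
by case e: (node_formula ts n) => [phi|] //= [<-]; exists ts, phi.
Qed.

Lemma dag_size ns ts : dag_formulas ns = Some ts -> size ts = size ns.
Proof.
elim/last_ind: ns ts => [ts [<-] //|ns n IH us /dag_rconsP[ts [phi [/IH e _ ->]]]].
by rewrite !size_rcons e.
Qed.

(** Nodes refer only to earlier ones, so a prefix of a DAG is again a DAG. This is what allows the
    answer to be cut off at the chosen entry. *)
Lemma dag_take ns ts j : dag_formulas ns = Some ts ->
  dag_formulas (take j ns) = Some (take j ts).
Proof.
elim/last_ind: ns ts => [ts [<-] //|ns n IH us e].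
have [ts [phi [e1 e2 eus]]] := dag_rconsP e.
have sz := dag_size e1; rewrite eus -!cats1 !take_cat sz; case: ltnP => _.
  exact: IH.
case: (j - size ns) => [|i] /=; first by rewrite !cats0.
by rewrite cats1 e eus cats1.
Qed.

Lemma onth_rcons T (s : seq T) x i :
  onth (rcons s x) i = if i < size s then onth s i else if i == size s then Some x else None.
Proof.
rewrite -cats1 onth_cat; case: ltnP => // le_i; case: eqVneq => [->|ne].
  by rewrite subnn.
by rewrite onth_default //=; lia.
Qed.

Lemma onth_rcons_some T (s : seq T) x i y : onth s i = Some y -> onth (rcons s x) i = Some y.
Proof. by move=> e; rewrite onth_rcons -onthTE e. Qed.

Lemma node_mono ts psi n phi : node_formula ts n = Some phi ->
  node_formula (rcons ts psi) n = Some phi.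
Proof.
case: n => [a|f i|f i j] //=.
  by case e: (onth ts i) => [q|] //=; rewrite (onth_rcons_some _ e).
case e: (onth ts i) => [q|] //=; case e': (onth ts j) => [q'|] //=.
by rewrite (onth_rcons_some _ e) (onth_rcons_some _ e').
Qed.

(** A node repeated at the end of the DAG still denotes the same formula, as its references remain
    valid; entries of nonterminals rely on this. *)
Lemma dag_node ns ts i n phi : dag_formulas ns = Some ts ->
  onth ns i = Some n -> onth ts i = Some phi -> node_formula ts n = Some phi.
Proof.
elim/last_ind: ns ts => [ts [<-]|ns m IH us e]; first by rewrite onth0n.
have [ts [psi [e1 e2 ->]]] := dag_rconsP e; rewrite !onth_rcons (dag_size e1).
case: ltnP => _; first by move=> h1 h2; apply/node_mono/(IH _ e1).
by case: eqP => // _ [<-] [<-]; apply: node_mono.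
Qed.

(** Variables of both orders share one numbering, the same as that of the blocks of an
    environment. *)
Definition free_at (phi : formula tau k arX) (j : nat) : bool :=
  if insub j : option 'I_k is Some x then free1 x phi
  else if insub (j - k) : option 'I_k' is Some X then free2 X phi else false.

Definition free_vars phi := map (free_at phi) (iota 0 (k + k')).

Lemma free_at1 phi (x : 'I_k) : free_at phi x = free1 x phi.
Proof. by rewrite /free_at valK. Qed.

Lemma free_at2 phi (X : 'I_k') : free_at phi (k + X) = free2 X phi.
Proof. by rewrite /free_at insubF ?addKn ?valK //; lia. Qed.

Lemma var_ind (P : nat -> Prop) : (forall x : 'I_k, P x) -> (forall X : 'I_k', P (k + X)) ->
  forall j, j < k + k' -> P j.
Proof.
move=> h1 h2 j lt_j; case: (ltnP j k) => [lt_jk|le_kj]; first exact: (h1 (Ordinal lt_jk)).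
have lt_j' : j - k < k' by lia.
by rewrite -(subnKC le_kj); apply: (h2 (Ordinal lt_j')).
Qed.

Lemma nth_free_vars phi j : j < k + k' -> nth false (free_vars phi) j = free_at phi j.
Proof. by move=> lt_j; rewrite (nth_map 0) ?size_iota // nth_iota. Qed.

Lemma newfvE u f1 f2 phi : (forall j, j < k + k' ->
    (if head 0 u == 1 then has (fun y => y == j) (drop 2 u)
    else if head 0 u == 2 then has (fun y => y == j) (drop 2 u) || (j == k + nth 0 u 1)
    else if head 0 u <= 3 then nth false f1 j
    else if head 0 u <= 7 then (j != qvar k u) && nth false f1 j
    else nth false f1 j || nth false f2 j) = free_at phi j) ->
  newfv k k' u f1 f2 = free_vars phi.
Proof. by move=> h; apply/eq_in_map => j; rewrite mem_iota => /h. Qed.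

Lemma newfv0 (a : sym0 tau k arX) f1 f2 :
  newfv k k' (code_sym0 a) f1 f2 = free_vars (Node0 _ a).
Proof.
have hasx n (xs : n.-tuple 'I_k) (x : 'I_k) :
    has (fun y : nat => y == x) (code_tuple xs) = (x \in xs).
  rewrite has_map -has_pred1; apply: eq_has => y /=.
  by rewrite (inj_eq val_inj).
have hasX n (xs : n.-tuple 'I_k) (X : 'I_k') :
    has (fun y : nat => y == k + X) (code_tuple xs) = false.
  by rewrite has_map; apply/hasPn => y _ /=; have := ltn_ord y; lia.
apply: newfvE; case: a => [R xs|Y xs]; apply: var_ind => [x|X] /=;
  rewrite ?free_at1 ?free_at2 drop0 /= ?hasx ?hasX //.
  by rewrite (_ : _ == _ = false) ?orbF //; have := ltn_ord x; lia.
by rewrite eqn_add2l.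
Qed.

Lemma newfv1 (f : sym1 k k') phi u f2 :
  newfv k k' (code_sym1 f ++ u) (free_vars phi) f2 = free_vars (Node1 f phi).
Proof.
apply: newfvE => j lt_j; rewrite !nth_free_vars //; move: j lt_j.
case: f => [|y|y|Y|Y]; apply: var_ind => [x|X]; rewrite ?free_at1 ?free_at2 /= /qvar //=.
- by rewrite (_ : _ == _ = false) //; have := ltn_ord y; lia.
- by rewrite (_ : _ == _ = false) //; have := ltn_ord y; lia.
- by rewrite (_ : _ == _ = false) //; have := ltn_ord x; lia.
- by rewrite eqn_add2l.
- by rewrite (_ : _ == _ = false) //; have := ltn_ord x; lia.
- by rewrite eqn_add2l.
Qed.

Lemma newfv2 (f : sym2) phi psi u :
  newfv k k' (code_sym2 f ++ u) (free_vars phi) (free_vars psi) = free_vars (Node2 f phi psi).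
Proof.
apply: newfvE => j lt_j; rewrite !nth_free_vars //; move: j lt_j.
by case: f; apply: var_ind => [x|X]; rewrite ?free_at1 ?free_at2.
Qed.

Lemma newfv_leaf B phi u f2 :
  newfv k k' (0 :: B :: u) (free_vars phi) f2 = free_vars phi.
Proof. by apply: newfvE => j lt_j; rewrite nth_free_vars. Qed.

Lemma sentenceP phi : sentence phi <-> ~~ has id (free_vars phi).
Proof.
split=> [[h1 h2]|/hasPn h].
  apply/hasPn => b /mapP[j]; rewrite mem_iota /= => + ->; move: j.
  by apply: var_ind => [x|X]; rewrite ?free_at1 ?free_at2.
split=> [x|X].
  rewrite -free_at1; apply: h; apply/mapP; exists (nat_of_ord x) => //.
  by rewrite mem_iota /=; have := ltn_ord x; lia.
rewrite -free_at2; apply: h; apply/mapP; exists (k + X) => //.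
by rewrite mem_iota /=; have := ltn_ord X; lia.
Qed.

End Dags.

Lemma map_zip_iota (T B U : Type) (x0 : T) (code : T -> U) (h : nat -> U -> B) (g : T -> B) s o :
  (forall i, i < size s -> h (o + i) (code (nth x0 s i)) = g (nth x0 s i)) ->
  map (fun ia => h ia.1 ia.2) (zip (iota o (size s)) (map code s)) = map g s.
Proof.
elim: s o => //= x s IH o hs; congr cons; first by have := hs 0 isT; rewrite addn0.
by apply: IH => i lt_i; rewrite addSnnS; apply: (hs i.+1).
Qed.

(** * Saturation *)

Lemma In_nth T (x0 : T) s i : i < size s -> List.In (nth x0 s i) s.
Proof. by elim: s i => // x s IH [|i] //= lt_i; [left | right; apply: IH]. Qed.

Lemma In_map (T : Type) (U : eqType) (f : T -> U) s u :
  reflect (exists2 x, List.In x s & u = f x) (u \in map f s).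
Proof.
elim: s => [|x s IH] /=; first by constructor; case=> ? [].
rewrite inE; case: eqP => [->|ne]; first by constructor; exists x => //; left.
apply: (iffP IH) => [[y sy ->]|[y [<-|sy] e]]; [by exists y => //; right|by []|by exists y].
Qed.

Lemma subtrees_child (tau : signature) (k k' : nat) (arX : 'I_k' -> nat) (N : nat)
    (t s c : tree tau k arX 'I_N) :
  List.In s (subtrees t) -> List.In c (children s) -> List.In c (subtrees t).
Proof.
have root (u : tree tau k arX 'I_N) : List.In u (subtrees u) by case: u => *; left.
elim: t => [B|a|f p IH|f p IHp q IHq] /= [<-|] //=.
- by case=> // <-; right; apply: root.
- by move=> h1 h2; right; apply: IH.
- by case=> [<-|[<-|//]]; right; apply: List.in_or_app; [left|right]; apply: root.
- move=> h1 h2; right; apply: List.in_or_app.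
  by case: (List.in_app_or _ _ _ h1) => h; [left; apply: IHp | right; apply: IHq].
Qed.

Section Saturation.
Variables (tau : signature) (k k' : nat) (arX : 'I_k' -> nat) (amax : nat).
Variables (As : seq (structure tau)) (G : grammar tau k arX) (p : params).
Notation form := (formula tau k arX).
Notation gtree := (tree tau k arX 'I_(nonterm G)).
Hypothesis pmE : pm p = (k + k') * pL p.
Hypothesis pEE : pE p = iota 0 (2 ^ pm p).
Hypothesis arX_le : forall X, arX X <= amax.
Hypothesis fitsAs : forall A, List.In A As -> fits amax p A.
Hypothesis pSE : pS p = zip (iota 0 (size As)) (map (@code_structure tau) As).
Hypothesis pRE : pR p = map (fun r => nat_of_ord r.1 :: code_tree r.2) (rules G).

Definition in_rules (t : gtree) : Prop :=
  exists2 r, List.In r (rules G) & List.In t (subtrees r.2).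

Hypothesis pTE : forall u, u \in pT p <-> exists2 t, in_rules t & u = code_tree t.

Notation mk_ := (mk (arsR tau) (arsX arX) k k' amax p).
Notation news_ := (news (arsR tau) (arsX arX) k k' amax p).
Notation extend_ := (extend (arsR tau) (arsX arX) k k' amax p).
Notation applicable_ := (applicable (arsR tau) (arsX arX) p).

Definition values (phi : form) : seq (seq bool) := map (row amax p phi) As.

Definition meaning (phi : form) : seq (seq bool) * seq bool := (values phi, free_vars phi).

(** The last premise expresses that [i] is the position of A in [As], in a form that rewrites the
    row of whichever child is looked up. *)
Lemma newvalE u v1 v2 phi :
  (forall A i e, List.In A As -> e < 2 ^ pm p ->
     (forall psi, nth [::] (values psi) i = row amax p psi A) ->
     newbit (arsR tau) k amax p u (code_structure A) (nth [::] v1 i) (nth [::] v2 i) e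
       = truth amax p phi A e) ->
  newval (arsR tau) k amax p u v1 v2 = values phi.
Proof.
move=> h; rewrite /newval pSE.
pose A0 : structure tau := @Structure tau 0 (fun R => set0).
apply: (@map_zip_iota _ _ _ A0 _ (fun i a => map (fun e => newbit (arsR tau) k amax p u a
  (nth [::] v1 i) (nth [::] v2 i) e) (pE p))) => i lt_i.
rewrite /row pEE; apply/eq_in_map => e; rewrite mem_iota /= => lt_e.
apply: h => //; first exact: In_nth.
by move=> psi; rewrite add0n (nth_map A0).
Qed.

Lemma mk_node0 a x : x.1 = code_tree (Node0 _ a : gtree) ->
  (mk_ x).1 = (x.1, meaning (Node0 _ a)).
Proof.
move=> e; rewrite /mk e /=; congr (_, (_, _)); last exact: newfv0.
by apply: newvalE => A i e' _ _ _; apply: newbit0.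
Qed.

Lemma mk_node1 f (t : gtree) phi x : x.1 = code_tree (Node1 f t) ->
  x.2.1.2.1.2 = meaning phi -> (mk_ x).1 = (x.1, meaning (Node1 f phi)).
Proof.
move=> e e1; rewrite /mk e e1 /=; congr (_, (_, _)); last exact: newfv1.
apply: newvalE => A i e' AAs lt_e row_i; rewrite row_i; apply: newbit1 => //.
exact: fitsAs.
Qed.

Lemma mk_node2 f (t u : gtree) phi psi x : x.1 = code_tree (Node2 f t u) ->
  x.2.1.2.1.2 = meaning phi -> x.2.2.2.1.2 = meaning psi ->
  (mk_ x).1 = (x.1, meaning (Node2 f phi psi)).
Proof.
move=> e e1 e2; rewrite /mk e e1 e2 /=; congr (_, (_, _)); last exact: newfv2.
by apply: newvalE => A i e' AAs lt_e row_i; rewrite !row_i; apply: newbit2.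
Qed.

Lemma mk_leaf B phi x : x.1 = code_tree (Leaf _ _ _ B : gtree) ->
  x.2.1.2.1.2 = meaning phi -> (mk_ x).1 = (x.1, meaning phi).
Proof.
move=> e e1; rewrite /mk e e1 /=; congr (_, (_, _)); last exact: newfv_leaf.
by apply: newvalE => A i e' AAs lt_e row_i; rewrite row_i; apply: newbit_leaf.
Qed.

Definition represents (en : entry) (phi : form) : Prop :=
  exists t : gtree, [/\ in_rules t, generates t phi &
    en.1 = (code_tree t, meaning phi)].

(** The invariant of saturation: the nodes in the table form a DAG, and its formula at each position
    witnesses the entry there. *)
Definition sound (T : seq entry) : Prop :=
  exists (ns : dag tau k arX) ts, [/\ dag_formulas ns = Some ts,
    map (@code_node _ _ _ _) ns = map snd T &
    forall i, i < size T -> exists2 phi, onth ts i = Some phi & represents (nth dummy T i) phi].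

Lemma sound_rcons T ns ts n phi en : dag_formulas ns = Some ts ->
  map (@code_node _ _ _ _) ns = map snd T ->
  (forall i, i < size T -> exists2 phi, onth ts i = Some phi & represents (nth dummy T i) phi) ->
  node_formula ts n = Some phi -> code_node n = en.2 -> represents en phi ->
  sound (rcons T en).
Proof.
move=> e1 e2 e3 e4 e5 e6; exists (rcons ns n), (rcons ts phi); split.
- by rewrite dag_rcons e1 e4.
- by rewrite !map_rcons e2 e5.
- have sz : size ts = size T by rewrite (dag_size e1) -(size_map (@code_node _ _ _ _)) e2 size_map.
  move=> i; rewrite size_rcons ltnS nth_rcons onth_rcons sz; case: ltngtP => // [lt_i _|_ _].
    exact: e3.
  by exists phi.
Qed.

Lemma news_cand T x : x \in news_ T ->
  [/\ x \in cands p T, applicable_ x & ~~ has (fun en : entry => en.1 == (mk_ x).1) T].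
Proof. by rewrite mem_filter => /andP[/andP[-> ->] ->]. Qed.

Lemma sound_extend T : sound T -> sound (extend_ T).
Proof.
move=> sT; rewrite /extend; case e: (news_ T) => [|x s] //.
have /news_cand[xT ap _] : x \in news_ T by rewrite e mem_head.
case: sT => ns [ts [e1 e2 e3]]; have [/pTE[t tG xt] x1 x2] := mem_cands xT.
(* A child with the right tree yields a formula and its node; the dummy is excluded because tree
   codes are nonempty. *)
have entryP i en (t' : gtree) : (i, en) \in (0, dummy) :: indexed T -> en.1.1 = code_tree t' ->
    exists phi, [/\ onth ts i = Some phi, generates t' phi, en.1.2 = meaning phi &
      exists2 n, onth ns i = Some n & code_node n = en.2].
  rewrite inE => /orP[/eqP[_ ->] /= et|/mem_indexed[lt_i ->] et].
    by have := code_gt0 t'; rewrite -et.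
  have [phi ephi [t'' [_ gt'' een]]] := e3 _ lt_i; exists phi.
  have tt' : t'' = t' by apply: code_tree_inj; rewrite -et een.
  have lt_ins : i < size ns by rewrite -(size_map (@code_node _ _ _ _)) e2 size_map.
  split=> //; [by rewrite -tt' | by rewrite een |].
  have := onthTE ns i; rewrite lt_ins; case eni: (onth ns i) => [n|] // _; exists n => //.
  have := congr1 (fun s => onth s i) e2; rewrite !onth_map eni /=.
  have := onthTE T i; rewrite lt_i; case eT: (onth T i) => [en'|] // _ [->].
  by rewrite (onth_nth dummy _ _ _ eT).
case: x xT xt x1 x2 ap {e} => u [[i1 en1] [i2 en2]] /= xT xt x1 x2 ap.
have new n phi : node_formula ts n = Some phi -> generates t phi ->
    code_node n = (mk_ (u, ((i1, en1), (i2, en2)))).2 ->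
    (mk_ (u, ((i1, en1), (i2, en2)))).1 = (code_tree t, meaning phi) ->
    sound (rcons T (mk_ (u, ((i1, en1), (i2, en2))))).
  move=> h1 h2 h3 h4; apply: (sound_rcons e1 e2 e3 h1 h3).
  by exists t.
case: t tG xt new => [B|a|f q|f q q'] tG xt new.
(* A nonterminal reuses the node of its child, which by [dag_node] can be repeated. *)
- rewrite /applicable xt /= in ap; move: ap => /hasP[r]; rewrite pRE.
  case/In_map=> [[B' t'] rG -> /eqP[]].
  move=> /val_inj eB et'; have [phi [h1 h2 h3 [n h4 h5]]] := entryP _ _ t' x1 (esym et').
  apply: (new n phi) => //.
  + exact: dag_node e1 h4 h1.
  + by apply: GenLeaf h2; rewrite -eB.
  + by rewrite h5 /mk xt.
  + by rewrite (mk_leaf (B := B) (phi := phi)) // xt.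
- apply: (new (Dag0 a) (Node0 _ a)) => //.
  + exact: Gen0.
  + by rewrite /mk xt /newnode; case: (a) => [R xs|X xs].
  + by rewrite (mk_node0 (a := a)) // xt.
- have tokE : tok_len (arsR tau) (arsX arX) u = size (code_sym1 f).
    by rewrite xt; apply: (tok_lenE (Node1 f q)).
  have dropE : drop (tok_len (arsR tau) (arsX arX) u) u = code_tree q.
    by rewrite tokE xt /= drop_size_cat.
  have takeE : take (tok_len (arsR tau) (arsX arX) u) u = code_sym1 f.
    by rewrite tokE xt /= take_size_cat.
  have et : en1.1.1 = code_tree q.
    by move: ap; rewrite /applicable /= dropE xt; case: (f) => [|y|y|Y|Y] /= /eqP.
  have [phi [h1 h2 h3 _]] := entryP _ _ q x1 et.
  apply: (new (Dag1 _ _ f i1) (Node1 f phi)) => //.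
  + by rewrite /= h1.
  + exact: Gen1.
  + by rewrite /mk /newnode /= takeE xt; case: (f) => [|y|y|Y|Y].
  + by rewrite (mk_node1 (f := f) (t := q) (phi := phi)) // xt.
- have tokE : tok_len (arsR tau) (arsX arX) u = size (code_sym2 f).
    by rewrite xt; apply: (tok_lenE (Node2 f q q')).
  have takeE : take (tok_len (arsR tau) (arsX arX) u) u = code_sym2 f.
    by rewrite tokE xt /= take_size_cat.
  have beE : behead u = code_tree q ++ code_tree q' by rewrite xt; case: (f).
  have lenE : tree_len (arsR tau) (arsX arX) (behead u) = size (code_tree q).
    by rewrite beE tree_lenE.
  have [et1 et2] : en1.1.1 = code_tree q /\ en2.1.1 = code_tree q'.
    move: ap; rewrite /applicable /= lenE beE take_size_cat // drop_size_cat // xt.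
    by case: (f) => /= /andP[/eqP-> /eqP->].
  have [phi [h1 h2 h3 _]] := entryP _ _ q x1 et1.
  have [psi [h1' h2' h3' _]] := entryP _ _ q' x2 et2.
  apply: (new (Dag2 _ _ _ f i1 i2) (Node2 f phi psi)) => //.
  + by rewrite /= h1 h1'.
  + exact: Gen2.
  + by rewrite /mk /newnode /= takeE xt; case: (f).
  + by rewrite (mk_node2 (f := f) (t := q) (u := q') (phi := phi) (psi := psi)) // xt.
Qed.

Lemma sound_saturate n : sound (saturate (arsR tau) (arsX arX) k k' amax p n).
Proof.
elim: n => [|n IH]; first by exists [::], [::].
exact: sound_extend.
Qed.

Lemma covered T x : news_ T = [::] -> x \in cands p T -> applicable_ x ->
  exists2 en, en \in T & en.1 = (mk_ x).1.
Proof.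
move=> eT xT ap; have : x \notin news_ T by rewrite eT.
by rewrite mem_filter ap xT andbT negbK => /hasP[en enT /eqP]; exists en.
Qed.

Lemma cands_mem T u i1 i2 : u \in pT p -> i1 \in (0, dummy) :: indexed T ->
  i2 \in (0, dummy) :: indexed T -> (u, (i1, i2)) \in cands p T.
Proof.
move=> uT T1 T2; apply/flattenP; eexists; first by apply/mapP; exists u.
by apply/flattenP; eexists; apply/mapP; [exists i1 | exists i2].
Qed.

Lemma indexed_mem T en : en \in T -> exists i, (i, en) \in (0, dummy) :: indexed T.
Proof.
move=> enT; exists (index en T); rewrite inE; apply/orP; right.
have lt_i : index en T < size T by rewrite index_mem.
apply/(nthP (0, dummy)); exists (index en T).
  by rewrite size_zip size_iota minnn.
by rewrite nth_zip ?size_iota // nth_iota // nth_index.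
Qed.

(** By induction the meanings of the children are in the table, so the candidate built from them is
    applicable, and since nothing new is left its key is already listed. The entry found for a child
    may belong to another formula, but the new meaning depends only on the meanings of the
    children. *)
Lemma complete T t phi : news_ T = [::] -> generates t phi -> in_rules t ->
  exists2 en, en \in T & en.1 = (code_tree t, meaning phi).
Proof.
move=> eT g; have dT : (0, dummy) \in (0, dummy) :: indexed T by rewrite mem_head.
have mem_u (t' : gtree) : in_rules t' -> code_tree t' \in pT p by move=> h; apply/pTE; exists t'.
elim: g => {t phi} [B t phi BG g IH|a|f t phi g IH|f t u phi psi gt IHt gu IHu] tG.
- have [|en enT een] := IH; first by exists (B, t) => //=; case: (t) => *; left.
  have [i iT] := indexed_mem enT.
  have [||en' enT' een'] := @covered T (code_tree (Leaf _ _ _ B : gtree), ((i, en), (0, dummy))) eT.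
  + by apply: cands_mem => //; apply: mem_u.
  + rewrite /applicable /= een; apply/hasP; exists (nat_of_ord B :: code_tree t) => //.
    by rewrite pRE; apply/In_map; exists (B, t).
  by exists en' => //; rewrite een' (mk_leaf (B := B) (phi := phi)) //= een.
- have [||en' enT' een'] := @covered T (code_tree (Node0 _ a : gtree), ((0, dummy), (0, dummy))) eT.
  + by apply: cands_mem => //; apply: mem_u.
  + by rewrite /applicable; case: (a).
  by exists en' => //; rewrite een' (mk_node0 (a := a)).
- have tG' : in_rules t.
    by case: tG => r rG rt; exists r => //; apply: subtrees_child rt _; left.
  have [en enT een] := IH tG'; have [i iT] := indexed_mem enT.
  have [||en' enT' een'] := @covered T (code_tree (Node1 f t), ((i, en), (0, dummy))) eT.
  + by apply: cands_mem => //; apply: mem_u.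
  + have := tok_lenE (Node1 f t) (code_tree t); rewrite /applicable /= => ->.
    by rewrite drop_size_cat // een eqxx; case: (f).
  by exists en' => //; rewrite een' (mk_node1 (f := f) (t := t) (phi := phi)) //= een.
- have tG' : in_rules t.
    by case: tG => r rG rt; exists r => //; apply: subtrees_child rt _; left.
  have uG' : in_rules u.
    by case: tG => r rG rt; exists r => //; apply: subtrees_child rt _; right; left.
  have [en enT een] := IHt tG'; have [i iT] := indexed_mem enT.
  have [en2 enT2 een2] := IHu uG'; have [i2 iT2] := indexed_mem enT2.
  have [||en' enT' een'] := @covered T (code_tree (Node2 f t u), ((i, en), (i2, en2))) eT.
  + by apply: cands_mem => //; apply: mem_u.
  + rewrite /applicable /= (_ : behead _ = code_tree t ++ code_tree u); last by case: (f).
    rewrite tree_lenE take_size_cat // (drop_size_cat _ (erefl (size (code_tree t)))).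
    have -> : en.1.1 = code_tree t by rewrite een.
    have -> : en2.1.1 = code_tree u by rewrite een2.
    by rewrite !eqxx; case: (f).
  exists en' => //.
  by rewrite een' (mk_node2 (f := f) (t := t) (u := u) (phi := phi) (psi := psi)) //= ?een ?een2.
Qed.

End Saturation.

(** * Termination and the theorem *)

Fixpoint words (T : Type) (xs : seq T) (c : nat) : seq (seq T) :=
  if c is c'.+1 then [seq x :: w | x <- xs, w <- words xs c'] else [:: [::]].

Lemma size_words T (xs : seq T) c : size (words xs c) = size xs ^ c.
Proof. by elim: c => //= c IH; rewrite size_allpairs IH expnS. Qed.

Lemma mem_words (T : eqType) (xs : seq T) c w :
  size w = c -> all (mem xs) w -> w \in words xs c.
Proof.
elim: c w => [|c IH] [|x w] //= [sz] /andP[xxs wxs].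
by apply/allpairsP; exists (x, w); split=> //; apply: IH.
Qed.

Lemma mem_bit_words (w : seq bool) c : size w = c -> w \in words [:: true; false] c.
Proof. by move=> sz; apply: mem_words => //; apply/allP => -[]. Qed.

Section Counting.
Variables (tau : signature) (k k' : nat) (arX : 'I_k' -> nat) (amax : nat).
Variables (As : seq (structure tau)) (G : grammar tau k arX) (p : params) (n : nat).
Hypothesis pTE : forall u, u \in pT p <-> exists2 t, in_rules (G := G) t & u = code_tree t.
Hypothesis le_T : size (pT p) <= n.
Hypothesis le_As : size As <= n.
Notation saturate_ := (saturate (arsR tau) (arsX arX) k k' amax p).
Notation news_ := (news (arsR tau) (arsX arX) k k' amax p).

(** The keys are distinct, and each is a tree of the rules with one bit row per structure and one
    bit per variable; the set of all such triples is counted. *)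
Lemma size_sound T : sound amax As G p T -> uniq (map fst T) ->
  size T < rounds k k' n (2 ^ pm p).
Proof.
case=> ns [ts [_ _ h]] uT.
pose V := words (words [:: true; false] (2 ^ pm p)) (size As).
pose F := words [:: true; false] (k + k').
pose K := [seq (u, w) | u <- pT p, w <- [seq (v, f) | v <- V, f <- F]].
have sub : {subset map fst T <= K}.
  move=> x /(nthP dummy.1)[i]; rewrite size_map => lt_i; rewrite (nth_map dummy) // => <-.
  have [phi _ [t [tG _ ->]]] := h _ lt_i.
  apply/allpairsP; exists (code_tree t, meaning amax As p phi); split=> //.
    by apply/pTE; exists t.
  apply/allpairsP; exists (meaning amax As p phi); split=> //.
    apply: mem_words; first by rewrite size_map.
    apply/allP => w /In_map[A _ ->]; rewrite inE; apply: mem_bit_words.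
    by rewrite size_map size_iota.
  by apply: mem_bit_words; rewrite size_map size_iota.
have := uniq_leq_size uT sub; rewrite size_map => le_K.
apply: leq_ltn_trans le_K _; rewrite !size_allpairs !size_words /=.
rewrite /rounds -expnM; move: (k + k') => c.
apply: leq_ltn_trans (_ : n * (2 ^ (n * 2 ^ pm p) * 2 ^ c) < _).
  rewrite !leq_mul // leq_pexp2l // mulnC leq_mul2r le_As orbT //.
rewrite !expnD [2 ^ n * _ * _]mulnAC -mulnA ltn_mul2r muln_gt0 !expn_gt0.
exact: ltn_expl.
Qed.

Lemma uniq_saturate i : uniq (map fst (saturate_ i)).
Proof.
elim: i => // i IH; rewrite /saturate iterS -/(saturate_ i) /extend.
case e: (news_ _) => [|x s] //; rewrite map_rcons rcons_uniq IH andbT.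
have /news_cand[_ _ /hasPn nx] : x \in news_ (saturate_ i) by rewrite e mem_head.
by apply/mapP => -[en /nx /negP h eq_en]; apply: h; rewrite -eq_en.
Qed.

(** Every round before saturation adds exactly one entry, so otherwise the table would have as many
    entries as rounds, against [size_sound]. *)
Lemma saturated : (forall i, sound amax As G p (saturate_ i)) ->
  news_ (saturate_ (rounds k k' n (2 ^ pm p))) = [::].
Proof.
move=> snd_i; move: (size_sound (snd_i (rounds k k' n (2 ^ pm p))) (uniq_saturate _)).
set R := rounds _ _ _ _.
suff [//|->] : news_ (saturate_ R) = [::] \/ size (saturate_ R) = R by rewrite ltnn.
elim: R => [|i IH]; first by right.
case e: (news_ (saturate_ i)) IH => [|x s] IH.
  by left; rewrite /saturate iterS -/(saturate_ i) /extend e e.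
case: IH => // sz; right; rewrite /saturate iterS -/(saturate_ i) /extend e.
by rewrite size_rcons sz.
Qed.

End Counting.

Lemma size_bits u : size (bits u) = sumn u + size u.
Proof.
rewrite /bits; elim: u => //= x u IH; rewrite size_cat IH size_rcons size_nseq; lia.
Qed.

(** The input is in unary, so its length bounds the numbers in it, in particular the domain
    sizes. *)
Lemma mem_le_bits u x : x \in u -> x <= size (bits u).
Proof.
rewrite size_bits; elim: u => //= y u IH; rewrite inE => /orP[/eqP->|/IH]; lia.
Qed.

Lemma all_mapP T (U : eqType) (f : T -> U) (P : pred U) s :
  reflect (forall x, List.In x s -> P (f x)) (all P (map f s)).
Proof.
apply: (iffP allP) => h x; first by move=> xs; apply: h; apply/In_map; exists x.
by case/In_map=> y ys ->; apply: h.
Qed.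

Section Solve.
Variables (tau : signature) (k k' : nat) (arX : 'I_k' -> nat).
Variables (Pos Neg : seq (structure tau)) (G : grammar tau k arX).

Definition max_arity := \max_X arX X.

Let As := Pos ++ Neg.
Let u := code_seq (@code_structure tau) Pos ++ code_seq (@code_structure tau) Neg
  ++ code_grammar G.
Let n := size (bits u).
Notation rule_code := (fun r : 'I_(nonterm G) * _ => nat_of_ord r.1 :: code_tree r.2).
Let p := mk_params (arsR tau) (arsX arX) k k' max_arity u n (2 ^ width k k' max_arity n).

Lemma pos_partE : pos_part (arsR tau) u = (rev (map (@code_structure tau) Pos),
  code_seq (@code_structure tau) Neg ++ code_grammar G).
Proof. by apply: parse_listE => A r; apply: struct_lenE. Qed.

Lemma neg_partE : neg_part (arsR tau) u
  = (rev (map (@code_structure tau) Neg), code_grammar G).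
Proof. by rewrite /neg_part pos_partE; apply: parse_listE => A r; apply: struct_lenE. Qed.

Lemma structsE : structs (arsR tau) u = map (@code_structure tau) As.
Proof. by rewrite /structs neg_partE pos_partE !revK map_cat. Qed.

Lemma rule_codesE : rule_codes (arsR tau) (arsX arX) u = map rule_code (rules G).
Proof.
rewrite /rule_codes /gram_part neg_partE /code_grammar.
rewrite (_ : drop 2 _ = code_seq rule_code (rules G) ++ [::]); last by rewrite cats0.
by rewrite (parse_listE _ _ (rule_lenE (N := _))) revK.
Qed.

Lemma le_u s t : u = s ++ t -> size s + size t <= n.
Proof. by move=> e; rewrite /n size_bits -size_cat -e; apply: leq_addl. Qed.

Lemma size_As : size As <= n.
Proof.
have le_f (ss : seq (structure tau)) : size ss <= size (flatten (map (@code_structure tau) ss)).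
  by elim: ss => //= A ss IH; rewrite size_cat; lia.
have := @le_u (code_seq (@code_structure tau) Pos) _ erefl; rewrite size_cat.
move=> h; move: h; rewrite /code_seq /= /As size_cat.
by have := le_f Pos; have := le_f Neg; lia.
Qed.

Lemma dom_lt A : List.In A As -> dom A < n.
Proof.
move=> AAs; apply: (@mem_le_bits u (dom A).+1); rewrite /u !mem_cat.
have hd (ss : seq (structure tau)) : List.In A ss ->
    (dom A).+1 \in code_seq (@code_structure tau) ss.
  move=> Ass; rewrite inE; apply/orP; right; apply/flattenP.
  by exists (code_structure A); [apply/In_map; exists A | rewrite inE eqxx].
by case: (List.in_app_or _ _ _ AAs) => /hd ->; rewrite ?orbT.
Qed.

Lemma size_rule_trees : size (pT p) <= n.
Proof.
have le_n := @le_u (code_seq (@code_structure tau) Pos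
  ++ code_seq (@code_structure tau) Neg) (code_grammar G) (catA _ _ _).
apply: leq_trans (leq_trans (leq_addl _ _) le_n); rewrite /= rule_codesE.
do 3!apply: leqW; elim: (rules G) => //= r rs IH.
by rewrite size_cat size_cat; have := size_subs tau arX (code_tree r.2); lia.
Qed.

Lemma params_fits A : List.In A As -> fits max_arity p A.
Proof.
move=> /dom_lt lt_A; rewrite /fits /= /block.
have le_n : (dom A).+1 <= n.+1 by lia.
split; last first.
  rewrite expnS; apply: leq_trans (leq_pmull _ _) => //.
  by case: max_arity => // a; rewrite leq_exp2r.
by rewrite expnS; apply: leq_trans (leq_pmulr _ _); rewrite ?expn_gt0 //; lia.
Qed.

Lemma params_trees v : v \in pT p <-> exists2 t, in_rules (G := G) t & v = code_tree t.
Proof.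
rewrite /= rule_codesE; split.
  case/flattenP=> s /mapP[c /In_map[r rG ->] ->] /= /subsE[t tr ->].
  by exists t => //; exists r.
case=> t [r rG tr] ->; apply/flattenP; exists (subs (arsR tau) (arsX arX) (code_tree r.2)).
  by apply/mapP; exists (rule_code r) => //; apply/In_map; exists r.
by apply/subsE; exists t.
Qed.

Lemma arX_le X : arX X <= max_arity.
Proof. exact: leq_bigmax. Qed.

Lemma solve_correct : exists ans : option (dag tau k arX),
  bits (solve (arsR tau) (arsX arX) k k' max_arity u n) = encode_answer ans /\
  match ans with
  | Some d => exists phi : formula tau k arX, dag_denotes d phi /\ separator Pos Neg G phi
  | None => ~ exists phi : formula tau k arX, separator Pos Neg G phi
  end.
Proof.
have hpS : pS p = zip (iota 0 (size As)) (map (@code_structure tau) As).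
  by rewrite /= structsE size_map.
have hpR : pR p = map rule_code (rules G) by rewrite /= rule_codesE.
have pmE : pm p = (k + k') * pL p by [].
have pEE : pE p = iota 0 (2 ^ pm p) by [].
have snd_i := sound_saturate pmE pEE arX_le params_fits hpS hpR params_trees.
have sat := saturated params_trees size_rule_trees size_As snd_i.
have compl := fun t phi => complete (t := t) (phi := phi) pmE pEE arX_le params_fits hpS
  hpR params_trees sat.
have modE A (phi : formula tau k arX) : List.In A As ->
    models A phi <-> all (fun b => b) (row max_arity p phi A).
  by move=> AAs; exact (modelsP pmE arX_le (params_fits AAs) phi).
have goodP (en : entry) t (phi : formula tau k arX) :
    en.1 = (code_tree t, meaning max_arity As p phi) ->
    good p (size Pos) (axiom G) en <-> List.In (axiom G, t) (rules G) /\
     [/\ sentence phi, forall A, List.In A Pos -> models A phi &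
         forall A, List.In A Neg -> ~ models A phi].
  move=> een; rewrite /good een hpR /= /values map_cat take_size_cat ?size_map //.
  rewrite drop_size_cat ?size_map //; split.
    case/and4P=> /hasP[c /In_map[[B t'] rG ->] /eqP[/val_inj eB /code_tree_inj et]].
    move=> /all_mapP hP /all_mapP hN hf; rewrite -eB -et; split=> //; split.
    - exact/sentenceP.
    - by move=> A AP; apply/modE; [apply: List.in_or_app; left | apply: hP].
    - move=> A AN /modE h; move: (hN A AN); rewrite h //.
      by apply: List.in_or_app; right.
  case=> rG [/sentenceP hf hP hN]; apply/and4P; split=> //.
  - apply/hasP; exists (rule_code (axiom G, t)) => //.
    by apply/In_map; exists (axiom G, t).
  - by apply/all_mapP => A AP; apply/modE; [apply: List.in_or_app; left | apply: hP].
  - apply/all_mapP => A AN; apply/negP => h; apply: (hN A AN); apply/modE => //.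
    by apply: List.in_or_app; right.
rewrite /solve -/p pos_partE size_rev size_map.
have -> : nth 0 (gram_part (arsR tau) u) 1 = axiom G by rewrite /gram_part neg_partE.
move: (snd_i (rounds k k' n (2 ^ pm p))) compl => {snd_i sat}.
rewrite (_ : pm p = width k k' max_arity n) //.
set T := saturate _ _ _ _ _ _ _ => -[ns [ts [e1 e2 e3]]] compl.
rewrite /answer; case e: (filter _ _) => [|[i en] s].
  (* A separator would be generated by the right-hand side [t] of a rule for the axiom. By
     completeness its meaning would be listed with [t], and that entry would be good. *)
  exists None; split=> // -[phi [sen /generatesP g hP hN]].
  inversion g as [B t psi BG gt eB epsi| | |]; subst.
  have [|en enT een] := compl t phi gt; first by exists (axiom G, t) => //; case: (t) => *; left.
  have [i] := indexed_mem enT; rewrite inE => /orP[/eqP[_ ed]|iT].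
    by have := code_gt0 t; move: een; rewrite ed => -[<-].
  suff : (i, en) \in filter (fun ie => good p (size Pos) (axiom G) ie.2) (indexed T) by rewrite e.
  by rewrite mem_filter iT andbT; apply/(goodP _ _ _ een).
have : (i, en) \in filter (fun ie => good p (size Pos) (axiom G) ie.2) (indexed T).
  by rewrite e mem_head.
rewrite mem_filter => /andP[/= gd /mem_indexed[lt_i een]].
have [phi ephi [t [tG gt ent]]] := e3 _ lt_i; rewrite -een in ent.
have [rG [h1 h2 h3]] := (goodP _ _ _ ent).1 gd.
(* The chosen entry has position [i], so the first i + 1 nodes form a DAG whose root denotes
   [phi]. *)
exists (Some (take i.+1 ns)); split.
  have lt_ns : i < size ns by rewrite -(size_map (@code_node _ _ _ _)) e2 size_map.
  by rewrite /encode_answer /code_seq size_takel // !map_take e2.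
exists phi; split.
  exists (take i ts); rewrite (dag_take _ e1); congr Some.
  have lt_ts : i < size ts by rewrite (dag_size e1) -(size_map (@code_node _ _ _ _)) e2 size_map.
  by rewrite (take_nth phi) // (onth_nth phi _ _ _ ephi).
split=> //; apply/generatesP; exact: GenLeaf rG gt.
Qed.

End Solve.

Theorem theorem9p1 (tau : signature) (k k' : nat) (arX : 'I_k' -> nat) :
  exists (M : TM) (c : nat),
    forall (Pos Neg : seq (structure tau)) (G : grammar tau k arX),
      let w := encode_input Pos Neg G in
      exists ans : option (dag tau k arX),
        outputs_within M w (2 ^ (2 ^ (size w ^ c + c))) (encode_answer ans) /\
        match ans with
        | Some d => exists phi : formula tau k arX,
                      dag_denotes d phi /\ separator Pos Neg G phi
        | None => ~ exists phi : formula tau k arX, separator Pos Neg G phi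
        end.
Proof.
pose a := max_arity arX.
have [M [e hM]] := machine_of_computes (computes_solve (arsR tau) (arsX arX) k k' a).
have [c hc] := double_exp_bound (k + k') a.+1 e.
exists M, c => Pos Neg G w.
have [ans [e_ans h_ans]] := solve_correct Pos Neg G.
exists ans; split=> //; move: (hM w).
(* The reversals made by loading and unloading cancel here. *)
rewrite revK size_rev decode_bits e_ans => -[i [le_i halt_i out_i]]; exists i; split=> //.
apply: leq_trans le_i _; apply: leq_trans (hc (size w)).
by rewrite /budget /rounds /width /block size_rev.
Qed.
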